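(* Let $d\ge 1$, $T>0$, let $a:[0,T]\times\mathbb{R}^d\to\mathbb{R}_+$ be a Borel function, and let $z^0\in\mathcal{M}(\mathbb{R}^d)$. Let $z_1,z_2:[0,T]\to\mathcal{M}(\mathbb{R}^d)$ be continuous with respect to the weak topology on finite measures, and suppose that both $z_1$ and $z_2$ solve $\partial_t z=\Delta(az)$ in the sense of distributions with initial condition $z(0,\cdot)=z^0$, i.e. for $i=1,2$, every $t\in[0,T]$ and every $\phi\in\mathcal{S}(\mathbb{R}^d)$, \[\int_{\mathbb{R}^d}\phi(x)\,z_i(t,dx)=\int_{\mathbb{R}^d}\phi(x)\,z^0(dx)+\int_0^t ds\int_{\mathbb{R}^d}\Delta\phi(x)\,a(s,x)\,z_i(s,dx).\] Set $z:=z_1-z_2$ and assume the following Hypothesis (B): there is $\tilde z\in L^1_{loc}([0,T]\times\mathbb{R}^d)$ such that $z(t,\cdot)$ admits $\tilde z(t,\cdot)$ as density for almost all $t\in[0,T]$ (we write $z$ for $\tilde z$), and either (B1) or (B2) holds: (B1) (i) $\int_{[0,T]\times\mathbb{R}^d}|z(t,x)|^2\,dt\,dx<+\infty$ and (ii) $\int_{[0,T]\times\mathbb{R}^d}|az|^2(t,x)\,dt\,dx<+\infty$; (B2) $d=1$, and for every $t_0>0$: (i) $\int_{[t_0,T]\times\mathbb{R}}|z(t,x)|^2\,dt\,dx<+\infty$, (ii) $\int_{[0,T]\times\mathbb{R}}|az|(t,x)\,dt\,dx<+\infty$, (iii) $\int_{[t_0,T]\times\mathbb{R}}|az|^2(t,x)\,dt\,dx<+\infty$.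 Then $z(t,\cdot)=(z_1-z_2)(t,\cdot)$ is identically zero for every $t\in[0,T]$.
   Context: $\mathcal{M}(\mathbb{R}^d)$ denotes the set of finite (signed) Borel measures on $\mathbb{R}^d$; $\mathcal{S}(\mathbb{R}^d)$ is the Schwartz space of rapidly decreasing smooth functions; $\Delta$ is the Laplacian in $x$. *)

(* Defs.v *)
From HB Require Import structures.
From mathcomp Require Import all_boot all_order all_algebra.
From mathcomp Require Import all_classical all_reals all_analysis.
Set Implicit Arguments.
Unset Strict Implicit.
Unset Printing Implicit Defensive.
Import Order.TTheory GRing.Theory Num.Theory.
Import numFieldNormedType.Exports.
Local Open Scope classical_set_scope.
Local Open Scope ring_scope.

(** * The space R^d.
    As a measurable space, R^d is [d.-tuple R] with the library's product
    (= Borel) sigma-algebra generated by the coordinate maps.  For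
    differential calculus (Schwartz functions, Laplacian) we use the normed
    space ['rV[R]_d]; [rv] identifies the two. *)
Definition rv {R : realType} {d : nat} (x : d.-tuple R) : 'rV[R]_d :=
  \row_(i < d) tnth x i.

Fixpoint leb_tuple (R : realType) (n : nat) : set (n.-tuple R) -> \bar R :=
  match n return set (n.-tuple R) -> \bar R with
  | 0 => fun A => \d_([tuple] : 0.-tuple R) A
  | n'.+1 => pushforward ((@lebesgue_measure R) \x^ (@leb_tuple R n'))%E
               (fun p : R * n'.-tuple R => [tuple of p.1 :: p.2])
  end.
Arguments leb_tuple {R} n.

Definition leb_tx {R : realType} (d : nat) : set (R * d.-tuple R) -> \bar R :=
  ((@lebesgue_measure R) \x^ (@leb_tuple R d))%E.
Arguments leb_tx {R} d.

Section charge_integration.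
Context {R : realType} {dd : measure_display} {T : measurableType dd}.

Lemma hahn_ex (nu : {charge set T -> \bar R}) :
  exists PN : set T * set T, hahn_decomposition nu PN.1 PN.2.
Proof. by have [P [N h]] := Hahn_decomposition nu; exists (P, N). Qed.

Definition hahn_choice (nu : {charge set T -> \bar R}) := cid (hahn_ex nu).

Definition cpos (nu : {charge set T -> \bar R}) :=
  jordan_pos (projT2 (hahn_choice nu)).
Definition cneg (nu : {charge set T -> \bar R}) :=
  jordan_neg (projT2 (hahn_choice nu)).

Definition cintegrable (nu : {charge set T -> \bar R}) (f : T -> R) : Prop :=
  (cpos nu).-integrable setT (EFin \o f) /\
  (cneg nu).-integrable setT (EFin \o f).

Definition cint (nu : {charge set T -> \bar R}) (f : T -> R) : R :=
  Rintegral (cpos nu) setT f - Rintegral (cneg nu) setT f.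

End charge_integration.

Section calculus.
Context {R : realType} {d : nat}.

Definition evec (i : 'I_d) : 'rV[R]_d := delta_mx 0 i.

Fixpoint pderiv (s : seq 'I_d) (f : 'rV[R]_d -> R) : 'rV[R]_d -> R :=
  match s with
  | [::] => f
  | i :: s' => fun x => 'D_(evec i) (pderiv s' f) x
  end.

Definition laplacian (f : 'rV[R]_d -> R) : 'rV[R]_d -> R :=
  fun x => \sum_(i < d) pderiv [:: i; i] f x.

(** Schwartz space: smooth (all partial derivatives of all orders exist and
    are continuous) and x^alpha d^beta f bounded for all alpha, beta
    (equivalently (1+|x|)^k |d^beta f(x)| bounded for all k, beta). *)
Definition schwartz (f : 'rV[R]_d -> R) : Prop :=
  (forall s, continuous (pderiv s f)) /\
  (forall s i x, derivable (pderiv s f) x (evec i)) /\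
  (forall s (k : nat), exists C : R, forall x,
      (1 + `|x|) ^+ k * `|pderiv s f x| <= C).

Definition bcontinuous (f : 'rV[R]_d -> R) : Prop :=
  continuous f /\ exists M : R, forall x, `|f x| <= M.

End calculus.

Section fokker_planck.
Context {R : realType} {d : nat}.
Local Notation charge := ({charge set (d.-tuple R) -> \bar R}).

Definition weakly_continuous (T : R) (z : R -> charge) : Prop :=
  forall phi : 'rV[R]_d -> R, bcontinuous phi ->
    {within `[0, T], continuous (fun t => cint (z t) (phi \o rv))}.

Definition weak_solution (T : R) (a : R -> d.-tuple R -> R) (z0 : charge)
    (z : R -> charge) : Prop :=
  forall phi : 'rV[R]_d -> R, schwartz phi ->
    let g := fun s (x : d.-tuple R) => laplacian phi (rv x) * a s x in
    [/\ {ae (@lebesgue_measure R), forall s, s \in `[0, T] -> cintegrable (z s) (g s)},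
        (@lebesgue_measure R).-integrable `[0, T]
            (fun s => (cint (z s) (g s))%:E) &
        forall t, t \in `[0, T] ->
          cint (z t) (phi \o rv) =
          cint z0 (phi \o rv) +
          Rintegral (@lebesgue_measure R) `[0, t] (fun s => cint (z s) (g s))].

Definition L1loc (T : R) (w : R -> d.-tuple R -> R) : Prop :=
  measurable_fun (`[0, T] `*` setT) (fun p : R * d.-tuple R => w p.1 p.2) /\
  forall r : R, (leb_tx d).-integrable
    (`[0, T] `*` [set x : d.-tuple R | forall i, `|tnth x i| <= r])
    (fun p => (w p.1 p.2)%:E).

End fokker_planck.

(* Main.v *)
(* Let [w] be the density of [z = z1 - z2], [f = a w], and let [K_e] be the heat
   kernel with variance [e].  Testing the equation on [K_e (. - x)] gives
   [K_e * w(t) = int_0^t (Delta K_e) * f(s) ds].  Multiplying by [f(t, x)] and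
   integrating over [t0 < t <= T] turns [int f (K_e * w)] into half the variation
   between [t0] and [T] of [Q_e(t) = - int |grad K_(e/2) * u(t)| ^ 2], where
   [u(t) = int_0^t f ds]; hence it is at most [- Q_e(t0) / 2].  Letting [e -> 0],
   [int_(t0 < t) a w ^ 2 <= limsup - Q_e(t0) / 2].
   Under (B1) take [t0 = 0], where [Q_e] vanishes.  Under (B2),
   [Q_e(t0) = int (K_e * u(t0)) dz(t0)], the total mass of [z(t0)] is bounded by
   uniform boundedness, and in dimension one [sup |K_e * u(t0)|] is controlled by
   comparing [K_e * u(t0)] with [K_(e+h) * u(t0)], whose sup norm is
   [O(h ^ (-1/2) int_0^t0 int |f|)], the variation in [e] being [O(h ^ (1/2))];
   so [Q_e(t0) -> 0] as [t0 -> 0], uniformly in [e].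
   In both cases [a w ^ 2 = 0], hence [f = 0], so that [z] is constant in time
   against Schwartz functions and its density vanishes almost everywhere; weak
   continuity extends this to every time. *)

Require Import Defs.
From HB Require Import structures.
From mathcomp Require Import all_boot all_order all_algebra.
From mathcomp Require Import all_classical all_reals all_analysis.
From mathcomp Require Import measurable_realfun.
From mathcomp Require Import ring lra.
Set Implicit Arguments.
Unset Strict Implicit.
Unset Printing Implicit Defensive.
Import Order.TTheory GRing.Theory Num.Theory.
Import numFieldNormedType.Exports.
Local Open Scope classical_set_scope.
Local Open Scope ring_scope.

(** The coefficient [a] is only Borel and nonnegative, so the equation gives no regularity: the sign
    of [a w ^ 2] is all the structure there is. The H^-1 energy method would test with the inverse
    Laplacian of [w]; since z(t) = Delta u(t), the time primitive u(t) takes that place, and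
    mollification makes every pairing legitimate. The sign of Q_e comes from the semigroup law K_e =
    K_(e/2) * K_(e/2), the factor 1/2 from the symmetry of the kernel in its two time variables. The
    limit e -> 0 requires f and w in L^2 on a common time window, which under (B2) excludes time 0;
    the price is the boundary term at t0. There z(t0) is only known to have bounded mass, so K_e *
    u(t0) has to be bounded in sup norm. Its derivative in e is half of K_e * z(t0), at most the
    mass times the Gaussian peak, of order e^(-d/2): this is integrable at e = 0 only for d = 1,
    which is where the dimension enters. The step h depends on the target precision and the mass
    alone, and t0 is taken small afterwards, so the choices are not circular. *)

(** * Product measures and Lebesgue measure on R^d *)

Lemma product_measure12 d1 d2 (T1 : measurableType d1) (T2 : measurableType d2)
  (R : realType) (m1 : {sigma_finite_measure set T1 -> \bar R})
  (m2 : {sigma_finite_measure set T2 -> \bar R}) (A : set (T1 * T2)) :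
  measurable A -> (m1 \x^ m2)%E A = (m1 \x m2)%E A.
Proof.
move=> mA; apply/esym/product_measure_unique => //= B C mB mC.
by rewrite product_measure2E.
Qed.

(* The library's [lebesgue_measure] lives on a copy of [R] whose measurable
    structure has another display than the canonical one of [R]; [lebR] is the
    same set function on [R] itself. *)
Section lebR.
Context {R : realType}.

Let measurable_idR :
  @measurable_fun _ _ (measurableTypeR R) R setT (fun x => x).
Proof. exact: measurable_id. Qed.

Let P : {measure set R -> \bar R} :=
  measure_function_pushforward__canonical__measure_function_Measure
    (@lebesgue_measure R) measurable_idR.

Let sP : sigma_finite setT P.
Proof. exact: (sigma_finiteT (@lebesgue_measure R)). Qed.

Definition lebR : {sigma_finite_measure set R -> \bar R} :=
  HB.pack_for {sigma_finite_measure set R -> \bar R}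
    (Measure.sort P) (Measure.class P)
    (@Measure_isSigmaFinite.Build _ _ _ (Measure.sort P) sP).

Lemma lebRE (A : set R) : lebR A = lebesgue_measure A.
Proof. by []. Qed.

Lemma ge0_integral_lebR (D : set R) (f : R -> \bar R) :
  measurable D -> measurable_fun D f -> (forall x, D x -> (0 <= f x)%E) ->
  (\int[lebesgue_measure]_(x in D) f x = \int[lebR]_(x in D) f x)%E.
Proof.
move=> mD mf f0; apply/esym.
apply: (ge0_integral_pushforward measurable_idR) => //.
by move=> x /[!inE]; exact: f0.
Qed.

Lemma integrable_lebR (D : set R) (f : R -> \bar R) : measurable D ->
  (lebesgue_measure.-integrable D f <-> lebR.-integrable D f)%E.
Proof.
move=> mD; split=> /integrableP[mf ioo]; apply/integrableP; split => //.
  by rewrite -ge0_integral_lebR//; exact: measurableT_comp.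
by rewrite ge0_integral_lebR//; exact: measurableT_comp.
Qed.

Lemma integral_lebR (D : set R) (f : R -> \bar R) :
  measurable D -> measurable_fun D f ->
  (\int[lebesgue_measure]_(x in D) f x = \int[lebR]_(x in D) f x)%E.
Proof.
move=> mD mf; rewrite integralE [RHS]integralE; congr (_ - _)%E.
  by apply: ge0_integral_lebR => //; exact: measurable_funepos.
by apply: ge0_integral_lebR => //; exact: measurable_funeneg.
Qed.

End lebR.

Section leb_tuple_measure.
Context {R : realType}.
Local Notation mu := (@lebR R).

(** [leb_tuple] is a bare set function defined by recursion; the induction carries a sigma-finite
    measure along so that Fubini becomes available at each dimension. *)
Lemma leb_tuple_sigma_finite n :
  exists m : {sigma_finite_measure set (n.-tuple R) -> \bar R},
    leb_tuple n = m :> (set _ -> \bar R).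
Proof.
elim: n => [|n [m IH]].
  by exists (dirac ([tuple] : 0.-tuple R)).
pose phi := fun p : R * n.-tuple R => [tuple of p.1 :: p.2].
have mphi : measurable_fun setT phi by exact: measurable_cons.
pose P : {measure set (n.+1.-tuple R) -> \bar R} :=
  measure_function_pushforward__canonical__measure_function_Measure (mu \x^ m)%E mphi.
have sP : sigma_finite setT P.
  have /sigma_finiteP[F [FT _ Foo]] := sigma_finiteT m.
  have /sigma_finiteP[G [GT _ Goo]] := sigma_finiteT mu.
  (* Enumerates the pairs of indices of the two covers; the default value only repeats one
     rectangle. *)
  pose e (k : nat) := odflt (0%N, 0%N) (unpickle k : option (nat * nat)).
  exists (fun k => [set x : n.+1.-tuple R | G (e k).1 (thead x)] `&`
                   [set x : n.+1.-tuple R | F (e k).2 [tuple of behead x]]).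
    apply/seteqP; split => // x _.
    have [i _ Gi] : (\bigcup_i G i) (thead x) by rewrite -GT.
    have [j _ Fj] : (\bigcup_i F i) [tuple of behead x] by rewrite -FT.
    by exists (pickle (i, j)) => //; rewrite /e pickleK.
  move=> k; have [mF Fk] := Foo (e k).2; have [mG Gk] := Goo (e k).1; split.
    apply: measurableI; rewrite -[X in measurable X]setTI.
      exact: (measurable_tnth ord0).
    by apply: measurable_behead.
  suff -> : P ([set x : n.+1.-tuple R | G (e k).1 (thead x)] `&`
      [set x : n.+1.-tuple R | F (e k).2 [tuple of behead x]]) =
      (mu \x^ m)%E (G (e k).1 `*` F (e k).2).
    by rewrite product_measure2E// lte_mul_pinfty// ge0_fin_numE.
  congr product_measure2.
  have bE (x : R) (y : n.-tuple R) :
    [tuple of behead [tuple of x :: y]] = y :> n.-tuple R by exact/val_inj.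
  apply/seteqP; split => -[x y].
    by move=> [Gx Fy]; split => //=; rewrite -[y](bE x).
  by move=> [Gx Fy]; split => //=; move: Fy; rewrite -{1}[y](bE x).
pose sPm := @Measure_isSigmaFinite.Build _ _ _ (Measure.sort P) sP.
exists (HB.pack_for {sigma_finite_measure set (n.+1.-tuple R) -> \bar R}
  (Measure.sort P) (Measure.class P) sPm).
by rewrite /= IH.
Qed.

Definition leb n : {sigma_finite_measure set (n.-tuple R) -> \bar R} :=
  projT1 (cid (leb_tuple_sigma_finite n)).

Lemma lebE n : leb_tuple n = leb n :> (set _ -> \bar R).
Proof. by rewrite /leb; case: cid. Qed.

(** Peels off one coordinate: change of variables along cons, then exchange of [\x^], used by
    [leb_tuple], for [\x], used by the Fubini lemmas. *)
Lemma integrable_lebS n (f : n.+1.-tuple R -> R) : measurable_fun setT f ->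
  (mu \x leb n)%E.-integrable setT (fun p => (f [tuple of p.1 :: p.2])%:E) ->
  (leb n.+1).-integrable setT (EFin \o f) /\
  \int[leb n.+1]_x f x =
  \int[(mu \x leb n)%E]_p f [tuple of p.1 :: p.2].
Proof.
move=> mf intf.
pose phi := fun p : R * n.-tuple R => [tuple of p.1 :: p.2].
have mphi : measurable_fun setT phi by exact: measurable_cons.
have mEf : measurable_fun [set: n.+1.-tuple R] (EFin \o f) by exact/measurable_EFinP.
have intf2 : (mu \x^ leb n)%E.-integrable setT (EFin \o f \o phi).
  apply/integrableP; split.
    by apply: measurableT_comp.
  case/integrableP : intf => _; apply: le_lt_trans.
  rewrite le_eqVlt; apply/orP; left; apply/eqP.
  by apply: eq_measure_integral => A mA _; exact: product_measure12.
pose P : {measure set (n.+1.-tuple R) -> \bar R} :=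
  measure_function_pushforward__canonical__measure_function_Measure
    (mu \x^ leb n)%E mphi.
have E (A : set (n.+1.-tuple R)) : leb n.+1 A = P A by rewrite -lebE /= lebE.
split.
  have /integrableP[h1 h2] := integrable_pushforward mphi mEf intf2 measurableT.
  apply/integrableP; split => //.
  by rewrite (eq_measure_integral P)// => A _ _; exact: E.
congr fine; rewrite (eq_measure_integral P); last by move=> A _ _; exact: E.
rewrite (integral_pushforward mphi mEf intf2)//.
by apply: eq_measure_integral => A mA _; exact: product_measure12.
Qed.

End leb_tuple_measure.

Notation itg m f := (m.-integrable setT (EFin \o f)).

(** * Real-valued integrals *)

Section real_integrals.
Context d (T : measurableType d) (R : realType) (m : {measure set T -> \bar R}).
Implicit Types f g : T -> R.

Lemma itg_measurable f : itg m f -> measurable_fun setT f.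
Proof. by move=> /measurable_int /measurable_EFinP. Qed.

Lemma itg_le f g : measurable_fun setT f -> itg m g ->
  (forall x, `|f x| <= g x) -> itg m f.
Proof.
move=> mf ig fg; apply: le_integrable ig => //; first exact/measurable_EFinP.
by move=> x _ /=; rewrite lee_fin (le_trans (fg x))// ler_norm.
Qed.

Lemma itgD f g : itg m f -> itg m g -> itg m (fun x => f x + g x).
Proof. by move=> fi gi; have := integrableD measurableT fi gi. Qed.

Lemma itgB f g : itg m f -> itg m g -> itg m (fun x => f x - g x).
Proof. by move=> fi gi; have := integrableB measurableT fi gi. Qed.

Lemma itgZ k f : itg m f -> itg m (fun x => k * f x).
Proof. by move=> fi; have := integrableZl measurableT k fi. Qed.

Lemma itg_abs f : itg m f -> itg m (fun x => `|f x|).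
Proof. by move=> fi; have := integrable_norm fi. Qed.

Lemma itg_sum I (r : seq I) (P : pred I) (f : I -> T -> R) :
  (forall i, P i -> itg m (f i)) -> itg m (fun x => \sum_(i <- r | P i) f i x).
Proof.
move=> fi; have := integrable_sum measurableT r fi.
by under [X in _.-integrable _ X -> _]eq_fun do rewrite sumEFin.
Qed.

Lemma Rintegral_sum I (r : seq I) (P : pred I) (f : I -> T -> R) :
  (forall i, P i -> itg m (f i)) ->
  \int[m]_x (\sum_(i <- r | P i) f i x) = \sum_(i <- r | P i) \int[m]_x f i x.
Proof.
move=> fi; elim: r => [|i r IH].
  by under eq_Rintegral do rewrite big_nil; rewrite big_nil Rintegral_cst// mul0r.
under eq_Rintegral do rewrite big_cons.
rewrite big_cons; case: ifP => // Pi; rewrite RintegralD ?IH//; first exact: fi.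
exact: itg_sum.
Qed.

Lemma EFin_Rintegral f : itg m f ->
  (\int[m]_x (f x)%:E = (\int[m]_x f x)%:E)%E.
Proof. by move=> fi; rewrite fineK//; exact: integrable_fin_num. Qed.

Lemma le_Rint f g : itg m f -> itg m g -> (forall x, f x <= g x) ->
  \int[m]_x f x <= \int[m]_x g x.
Proof. by move=> fi gi fg; apply: le_Rintegral. Qed.

Lemma ae_eq_itg f g : measurable_fun setT g -> {ae m, forall x, f x = g x} ->
  itg m f -> itg m g /\ \int[m]_x f x = \int[m]_x g x.
Proof.
move=> mg fg fi.
have fg' : ae_eq m setT (EFin \o f) (EFin \o g).
  by apply: filterS fg => x /= -> _.
have mEg : measurable_fun setT (EFin \o g) by exact/measurable_EFinP.
have mEf : measurable_fun setT (EFin \o f) by exact: measurable_int fi.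
have e : (\int[m]_x (f x)%:E = \int[m]_x (g x)%:E)%E.
  exact: ae_eq_integral.
split; last by rewrite /Rintegral e.
apply/integrableP; split => //.
case/integrableP : fi => _; rewrite (ae_eq_integral (abse \o (EFin \o g)))//.
- exact: measurableT_comp.
- exact: measurableT_comp.
- by apply: filterS fg => x /= -> _.
Qed.

Lemma ae_eq_Rint f g : measurable_fun setT f -> measurable_fun setT g ->
  {ae m, forall x, f x = g x} -> \int[m]_x f x = \int[m]_x g x.
Proof.
move=> mf mg fg; congr fine; apply: ae_eq_integral => //; [exact/measurable_EFinP..|].
by apply: filterS fg => x /= -> _.
Qed.

Lemma Rintegral_dominated (f_ : nat -> T -> R) f g :
  (forall n, measurable_fun setT (f_ n)) -> measurable_fun setT f ->
  {ae m, forall x, f_ ^~ x @ \oo --> f x} -> itg m g ->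
  {ae m, forall x n, `|f_ n x| <= g x} ->
  \int[m]_x f_ n x @[n --> \oo] --> \int[m]_x f x.
Proof.
move=> mf_ mf cf ig fg.
have cf' : {ae m, forall x, setT x -> (fun n => (f_ n x)%:E) @ \oo --> (EFin \o f) x}.
  by apply: filterS cf => x h _; apply: cvg_EFin => //; exact: nearW.
have fg' : {ae m, forall x n, setT x -> (`|(f_ n x)%:E| <= (EFin \o g) x)%E}.
  by apply: filterS fg => x h n _; rewrite /= lee_fin.
have [fi _ c] := @dominated_convergence _ _ _ m setT measurableT
  (fun n x => (f_ n x)%:E) (EFin \o f) (EFin \o g)
  (fun n => (measurable_EFinP _ _).2 (mf_ n)) ((measurable_EFinP _ _).2 mf)
  cf' ig fg'.
by apply: fine_cvg; rewrite -EFin_Rintegral.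
Qed.

Lemma Rintegral_eq0 f : itg m f -> (forall x, 0 <= f x) ->
  \int[m]_x f x <= 0 -> {ae m, forall x, f x = 0}.
Proof.
move=> fi f0 f00; have mf : measurable_fun setT (EFin \o f) := measurable_int _ fi.
have /ae_eq_integral_abs : (\int[m]_x `|(EFin \o f) x| = 0)%E.
  under eq_integral do rewrite /= ger0_norm//.
  by rewrite EFin_Rintegral//; congr EFin; apply/le_anti; rewrite f00 Rintegral_ge0.
by move=> /(_ measurableT mf); apply: filterS => x /(_ I) [].
Qed.

End real_integrals.

(** * Fubini's theorem for real-valued functions *)

Section prodm.
Local Open Scope ereal_scope.
Context d1 d2 (T1 : measurableType d1) (T2 : measurableType d2) (R : realType).
Variables (m1 : {sigma_finite_measure set T1 -> \bar R}).
Variables (m2 : {sigma_finite_measure set T2 -> \bar R}).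

Let prodm_sigma_finite : sigma_finite setT (m1 \x m2).
Proof.
have /sigma_finiteP[F [TF ndF Foo]] := sigma_finiteT m1.
have /sigma_finiteP[G [TG ndG Goo]] := sigma_finiteT m2.
exists (fun n => F n `*` G n).
  apply/seteqP; split => // -[x y] _.
  have [i _ Fi] : (\bigcup_i F i) x by rewrite -TF.
  have [j _ Gj] : (\bigcup_i G i) y by rewrite -TG.
  exists (maxn i j) => //; split => /=.
    by move: Fi; apply/subsetPset/ndF/leq_maxl.
  by move: Gj; apply/subsetPset/ndG/leq_maxr.
move=> k; have [mF Fk] := Foo k; have [mG Gk] := Goo k.
split; first exact: measurableX.
by rewrite product_measure1E// lte_mul_pinfty// ge0_fin_numE.
Qed.

(* The library does not register the product measure as sigma-finite in a way
    that canonical structure inference can iterate. *)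
Definition prodm : {sigma_finite_measure set (T1 * T2)%type -> \bar R} :=
  let P : {measure set (T1 * T2)%type -> \bar R} := m1 \x m2 in
  HB.pack_for {sigma_finite_measure set (T1 * T2)%type -> \bar R}
    (Measure.sort P) (Measure.class P)
    (@Measure_isSigmaFinite.Build _ _ _ (Measure.sort P) prodm_sigma_finite).

End prodm.

Section real_fubini.
Context d1 d2 (T1 : measurableType d1) (T2 : measurableType d2) (R : realType).
Variables (m1 : {sigma_finite_measure set T1 -> \bar R}).
Variables (m2 : {sigma_finite_measure set T2 -> \bar R}).
Implicit Types f : T1 * T2 -> R.
Local Notation mm := (prodm m1 m2).

Lemma itg_prod1 f : measurable_fun setT f ->
  (forall x, itg m2 (fun y => f (x, y))) ->
  (exists2 g : T1 -> R, itg m1 g & forall x, \int[m2]_y `|f (x, y)| <= g x) ->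
  itg mm f.
Proof.
move=> mf fi [g gi fg]; apply/(integrable12ltyP m1 m2).
  exact/measurable_EFinP.
case/integrableP : gi => mg; apply: le_lt_trans; apply: ge0_le_integral => //.
- by move=> x _; exact: integral_ge0.
- apply: (measurable_fun_fubini_tonelli_F (fun p => `|f p|%:E)) => //.
  by apply/measurable_EFinP; exact: measurableT_comp.
- exact: measurableT_comp.
- move=> x _ /=; rewrite EFin_Rintegral ?lee_fin; last exact/itg_abs/fi.
  by rewrite (le_trans (fg x))// ler_norm.
Qed.

Lemma itg_prod1_ae f : itg mm f -> {ae m1, forall x, itg m2 (fun y => f (x, y))}.
Proof. by move=> /ae_integrable1. Qed.

Lemma itg_prod2_ae f : itg mm f -> {ae m2, forall y, itg m1 (fun x => f (x, y))}.
Proof. by move=> /ae_integrable2. Qed.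

Lemma Rfubini1 f : itg mm f ->
  itg m1 (fun x => \int[m2]_y f (x, y)) /\
  \int[mm]_p f p = \int[m1]_x \int[m2]_y f (x, y).
Proof.
move=> fi; have Fi := integrable_fubini_F fi.
(* The two sides can differ only where a section is not integrable, since [fine] then returns a
   default. *)
have FE : ae_eq m1 setT (fubini_F m2 (EFin \o f))
    (fun x => (\int[m2]_y f (x, y))%:E).
  have := itg_prod1_ae fi; apply: filterS => x fx _.
  by rewrite -EFin_Rintegral.
have mF : measurable_fun setT (fubini_F m2 (EFin \o f)) := measurable_int _ Fi.
have mG : measurable_fun setT (fun x => (\int[m2]_y f (x, y))%:E).
  apply/measurable_EFinP; apply: (measurableT_comp (f := fine)) => //.
split.
  apply/integrableP; split => //.
  case/integrableP : Fi => _; rewrite (ae_eq_integral (abse \o (fun x => (\int[m2]_y f (x, y))%:E)))//.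
  - exact: measurableT_comp.
  - exact: measurableT_comp.
  - by apply: filterS FE => x /= /(_ I) -> _.
rewrite /Rintegral -(integral12_prod_meas1 fi); congr fine.
exact: ae_eq_integral.
Qed.

Lemma itg_tensor (f : T1 -> R) (g : T2 -> R) : itg m1 f -> itg m2 g ->
  itg mm (fun p => f p.1 * g p.2) /\
  \int[mm]_p (f p.1 * g p.2) = \int[m1]_x f x * \int[m2]_y g y.
Proof.
move=> fi gi.
have mfg : measurable_fun [set: T1 * T2] (fun p => f p.1 * g p.2).
  apply: measurable_funM; apply: measurableT_comp => //.
    exact: itg_measurable fi.
  exact: itg_measurable gi.
have fgi : itg mm (fun p => f p.1 * g p.2).
  apply: itg_prod1 => // [x|]; first exact: (itgZ (f x) gi).
  exists (fun x => \int[m2]_y `|g y| * `|f x|); first exact/itgZ/itg_abs.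
  move=> x /=; under eq_Rintegral do rewrite normrM.
  by rewrite RintegralZl// 1?mulrC//; exact: itg_abs.
split => //; rewrite (Rfubini1 fgi).2 /=.
under eq_Rintegral do rewrite RintegralZl//.
by rewrite RintegralZr.
Qed.

End real_fubini.

Section real_fubini_swap.
Context d1 d2 (T1 : measurableType d1) (T2 : measurableType d2) (R : realType).
Variables (m1 : {sigma_finite_measure set T1 -> \bar R}).
Variables (m2 : {sigma_finite_measure set T2 -> \bar R}).

Lemma itg_swap (f : T1 * T2 -> R) : itg (prodm m1 m2) f ->
  itg (prodm m2 m1) (fun q => f (q.2, q.1)).
Proof.
move=> fi; have mf := itg_measurable fi.
apply/(integrable12ltyP m2 m1).
  apply/measurable_EFinP; apply: measurableT_comp => //.
  exact: measurable_fun_pair.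
have mEf : measurable_fun setT (EFin \o f) by exact/measurable_EFinP.
exact: (integrable21ltyP m1 m2 mEf).1 fi.
Qed.

Lemma Rintegral_swap (f : T1 * T2 -> R) : itg (prodm m1 m2) f ->
  \int[(prodm m1 m2)]_p f p = \int[(prodm m2 m1)]_q f (q.2, q.1).
Proof.
move=> fi; congr fine.
rewrite -(integral21_prod_meas1 fi); exact: (integral12_prod_meas1 (itg_swap fi)).
Qed.

Lemma Rfubini2 (f : T1 * T2 -> R) : itg (prodm m1 m2) f ->
  itg m2 (fun y => \int[m1]_x f (x, y)) /\
  \int[(prodm m1 m2)]_p f p = \int[m2]_y \int[m1]_x f (x, y).
Proof.
by move=> fi; rewrite Rintegral_swap//; exact: Rfubini1 (itg_swap fi).
Qed.

End real_fubini_swap.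

Section tuple_tensor.
Context (R : realType).

Lemma itg_leb_tensor n (h : 'I_n -> R -> R) : (forall i, itg (@lebR R) (h i)) ->
  itg (@leb R n) (fun x => \prod_i h i (tnth x i)) /\
  \int[leb n]_x (\prod_i h i (tnth x i)) = \prod_i \int[lebR]_x h i x.
Proof.
elim: n h => [|n IH] h hi.
  pose a := [tuple] : 0.-tuple R.
  have E : leb 0 [set: 0.-tuple R] = 1%E :> \bar R by rewrite -lebE /= diracT.
  have cE : (fun x : 0.-tuple R => \prod_(i < 0) h i (tnth x i)) = cst 1.
    by apply/funext => x; rewrite big_ord0.
  rewrite cE big_ord0 Rintegral_cst// [X in _ * fine X]E mulr1; split => //.
  apply/integrableP; split; first exact/measurable_EFinP.
  by rewrite /= integral_cst//= [X in (_ * X)%E]E mule1 normr1 ltry.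
have [] := IH (fun i => h (lift ord0 i)) (fun i => hi _).
move=> /(itg_tensor (hi ord0))[ti te] e.
have pE (p : R * n.-tuple R) : \prod_i h i (tnth [tuple of p.1 :: p.2] i) =
    h ord0 p.1 * \prod_i h (lift ord0 i) (tnth p.2 i).
  by rewrite big_ord_recl tnth0; congr (_ * _); apply: eq_bigr => i _; rewrite tnthS.
have := @integrable_lebS R n (fun x => \prod_i h i (tnth x i)).
under [X in _.-integrable _ X]eq_fun do rewrite pE.
move=> [|//|-> ->].
  apply: measurable_prod => i _; apply: measurableT_comp; last exact: measurable_tnth.
  exact: itg_measurable (hi i).
split => //; under eq_Rintegral do rewrite pE.
by rewrite te e big_ord_recl.
Qed.

End tuple_tensor.

(** * Gaussian kernels *)

Section gaussian.
Context {R : realType}.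
Implicit Types e x y m : R.

(* [gk e] is the Gaussian density of variance [e], so that [d/de gk e = gk2 e / 2]. *)
Definition gk e x : R := (Num.sqrt (2 * pi * e))^-1 * expR (- (x ^+ 2 / (2 * e))).
Definition gk1 e x : R := - (x / e) * gk e x.
Definition gk2 e x : R := (x ^+ 2 / e ^+ 2 - e^-1) * gk e x.

Lemma gk_gt0 e x : 0 < e -> 0 < gk e x.
Proof.
move=> e0; rewrite mulr_gt0 ?expR_gt0// invr_gt0 sqrtr_gt0.
by rewrite !mulr_gt0// pi_gt0.
Qed.

Lemma gk_ge0 e x : 0 <= gk e x.
Proof. by rewrite mulr_ge0 ?expR_ge0// invr_ge0. Qed.

Lemma gkC e x y : gk e (x - y) = gk e (y - x).
Proof. by rewrite /gk -sqrrN opprB. Qed.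

Lemma gk2C e x y : gk2 e (x - y) = gk2 e (y - x).
Proof. by rewrite /gk2 gkC -sqrrN opprB. Qed.

Lemma is_derive_gk e x : 0 < e -> is_derive x 1 (gk e) (gk1 e x).
Proof.
move=> e0.
have -> : gk e = fun x => (Num.sqrt (2 * pi * e))^-1 *: expR (- ((2 * e)^-1 *: x ^+ 2)).
  by apply/funext => y; rewrite /gk /GRing.scale /= [X in - X]mulrC.
apply: is_derive_eq.
rewrite /gk1 /gk /GRing.scale /=.
have e0' : e != 0 by rewrite gt_eqF.
rewrite [X in expR (- X)]mulrC; set a := _^-1; set b := expR _; field.
by [].
Qed.

Lemma is_derive_gk_var e x : 0 < e -> is_derive e 1 (gk ^~ x) (gk2 e x / 2).
Proof.
move=> e0.
pose a := 2 * pi : R.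
have se : 0 < Num.sqrt (a * e) by rewrite sqrtr_gt0 !mulr_gt0// pi_gt0.
have ds : is_derive e 1 (fun e : R => Num.sqrt (a * e)) (a / (2 * Num.sqrt (a * e))).
  have d0 : is_derive e 1 (fun e : R => a * e) a.
    have : is_derive e 1 (a \*: (@id R)) (a *: 1) by exact: is_deriveZ.
    by rewrite /GRing.scale /= mulr1.
  have d1 := @is_derive1_sqrt R (a * e).
  rewrite [_ / _]mulrC.
  apply: (is_derive1_comp (d1 _) d0).
  by rewrite !mulr_gt0// pi_gt0.
have -> : gk ^~ x = (fun e : R => (Num.sqrt (a * e))^-1) *
     (fun e : R => expR (- ((x ^+ 2 / 2) *: e^-1))).
  apply/funext => y; rewrite /gk /a /GRing.scale /=; congr (_ * expR (- _)).
  by rewrite invfM mulrA.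
have d1 : is_derive e 1 (fun e : R => (Num.sqrt (a * e))^-1) 
   (- (Num.sqrt (a * e)) ^- 2 *: (a / (2 * Num.sqrt (a * e)))).
  apply: is_deriveV. by rewrite gt_eqF.
have d2 : is_derive e 1 (fun e : R => e^-1) (- e ^- 2 *: 1).
  apply: is_deriveV. by rewrite gt_eqF.
apply: is_derive_eq; rewrite /gk2 /gk /GRing.scale /=.
have e0' : e != 0 by rewrite gt_eqF.
rewrite -/a (_ : x ^+ 2 / (2 * e) = x ^+ 2 / 2 / e); last by field.
set b := expR _; set s := Num.sqrt _ in se *.
have ss : s ^+ 2 = a * e by rewrite sqr_sqrtr// !mulr_ge0// ?ltW// pi_gt0.
have -> : a = s ^+ 2 / e by rewrite ss; field.
by field; rewrite gt_eqF.
Qed.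

Lemma gk_normal e m x : 0 < e -> gk e (x - m) = normal_pdf m (Num.sqrt e) x.
Proof.
move=> e0; rewrite normal_pdfE ?gt_eqF ?sqrtr_gt0//.
rewrite /normal_peak /normal_fun sqr_sqrtr ?ltW//; congr (_^-1 * expR _).
  by congr Num.sqrt; ring.
by rewrite mulNr; congr (- (_ / _)); ring.
Qed.

Lemma continuous_gk e : 0 < e -> continuous (gk e).
Proof.
move=> e0 x; apply: differentiable_continuous; apply/derivable1_diffP.
by have [] := is_derive_gk x e0.
Qed.

Lemma gk_peak e x : 0 < e -> gk e x <= (Num.sqrt (2 * pi * e))^-1.
Proof.
move=> e0; rewrite ler_piMr ?invr_ge0//.
by rewrite -expR0 ler_expR oppr_le0 divr_ge0 ?sqr_ge0// mulr_ge0 ?ltW.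
Qed.

Lemma measurable_gk e : measurable_fun setT (gk e).
Proof.
apply: measurable_funM => //; apply: measurableT_comp => //.
by apply: measurableT_comp => //; exact: measurable_funM.
Qed.

Lemma measurable_gk1 e : measurable_fun setT (gk1 e).
Proof.
apply: measurable_funM; last exact: measurable_gk.
by apply: measurableT_comp => //; exact: measurable_funM.
Qed.

Lemma measurable_gk2 e : measurable_fun setT (gk2 e).
Proof.
apply: measurable_funM; last exact: measurable_gk.
by apply: measurable_funB => //; exact: measurable_funM.
Qed.

Lemma gk_integral e m : 0 < e ->
  itg (@lebR R) (fun x => gk e (x - m)) /\ \int[lebR]_x gk e (x - m) = 1.
Proof.
move=> e0; have E : (fun x => gk e (x - m)) = normal_pdf m (Num.sqrt e).
  by apply/funext => x; exact: gk_normal.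
split; rewrite E.
  by apply/integrable_lebR => //; exact: integrable_normal_pdf.
rewrite /Rintegral -integral_lebR//.
  by rewrite integral_normal_pdf.
by apply/measurable_EFinP; exact: measurable_normal_pdf.
Qed.

Lemma ltW_expR x : x <= expR x.
Proof. by apply: le_trans (expR_ge1Dx x); rewrite lerDr. Qed.

(* [C] is uniform for the variance ranging over a compact subset of ]0, oo[. *)
Lemma gk_bounds u v : 0 < u -> u <= v -> exists2 C, 0 < C &
  forall e x, u <= e -> e <= v -> [/\ gk e x <= C * gk (4 * v) x,
    `|gk1 e x| <= C * gk (4 * v) x & `|gk2 e x| <= C * gk (4 * v) x].
Proof.
move=> u0 uv; have v0 : 0 < v by exact: lt_le_trans uv.
pose A := (Num.sqrt (2 * pi * u))^-1 : R.
pose B := (Num.sqrt (2 * pi * (4 * v)))^-1 : R.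
have A0 : 0 < A by rewrite invr_gt0 sqrtr_gt0 !mulr_gt0// pi_gt0.
have B0 : 0 < B by rewrite invr_gt0 sqrtr_gt0 !mulr_gt0// pi_gt0.
pose D := 1 + (1 + 8 * v) / u + (8 * v / u ^+ 2 + u^-1).
have D1 : 0 <= (1 + 8 * v) / u by rewrite divr_ge0 ?addr_ge0 ?mulr_ge0// ltW.
have D2 : 0 <= 8 * v / u ^+ 2 + u^-1.
  by rewrite addr_ge0 ?divr_ge0 ?mulr_ge0 ?invr_ge0 ?exprn_ge0// ltW.
have D0 : 0 < D by rewrite /D; lra.
exists (A / B * D); first by rewrite !mulr_gt0// invr_gt0.
move=> e x ue ev; have e0 : 0 < e by exact: lt_le_trans ue.
(* [q] is the exponent of [gk (4 * v)], whereas [gk e] decays at least like exp (- 4 q). The spare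
   exponential absorbs the polynomial factors of the derivatives, because q <= exp q. *)
pose q := x ^+ 2 / (8 * v).
have q0 : 0 <= q by rewrite divr_ge0 ?sqr_ge0 ?mulr_ge0// ltW.
have v0' : v != 0 by rewrite gt_eqF.
have xq : x ^+ 2 = 8 * v * q by rewrite /q; field.
have -> : A / B * D * gk (4 * v) x = D * (A * expR (- q)).
  rewrite /gk -/B (_ : x ^+ 2 / (2 * (4 * v)) = q); first by field; rewrite gt_eqF.
  by rewrite /q; congr (_ / _); ring.
have kA : gk e x <= A * expR (- (4 * q)).
  apply: ler_pM => //.
    by rewrite lef_pV2 ?posrE ?sqrtr_gt0 ?mulr_gt0 ?pi_gt0// ler_wsqrtr// ler_pM2l// mulr_gt0 ?pi_gt0.
  rewrite ler_expR lerN2 (_ : 4 * q = x ^+ 2 / (2 * v)); last by rewrite /q; field.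
  by rewrite ler_wpM2l ?sqr_ge0// lef_pV2 ?posrE ?mulr_gt0// ler_pM2l.
have E4 : expR (- (4 * q)) <= expR (- q) by rewrite ler_expR; lra.
have qE4 : q * expR (- (4 * q)) <= expR (- q).
  have := ltW_expR q; rewrite -(ler_pM2r (expR_gt0 (- (4 * q)))) -expRD.
  by move/le_trans; apply; rewrite ler_expR; lra.
have A1 : 0 <= A * expR (- (4 * q)) by rewrite mulr_ge0 ?expR_ge0// ltW.
have iu : e^-1 <= u^-1 by rewrite lef_pV2.
have x2 : x ^+ 2 * (A * expR (- (4 * q))) <= 8 * v * (A * expR (- q)).
  rewrite xq [leLHS](_ : _ = 8 * v * A * (q * expR (- (4 * q)))); last by ring.
  by rewrite [leRHS]mulrA ler_wpM2l// !mulr_ge0// ltW.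
have AE : A * expR (- (4 * q)) <= A * expR (- q) by rewrite ler_wpM2l// ltW.
have AEq : 0 <= A * expR (- q) by rewrite mulr_ge0 ?expR_ge0// ltW.
split.
- apply: (le_trans kA); apply: (le_trans AE); rewrite ler_peMl//.
  by rewrite /D; lra.
- rewrite /gk1 normrM normrN (ger0_norm (gk_ge0 _ _)) normrM.
  rewrite (gtr0_norm (_ : 0 < e^-1)) ?invr_gt0//.
  apply: (@le_trans _ _ ((1 + 8 * v) / u * (A * expR (- q)))); last first.
    by rewrite ler_wpM2r// /D; lra.
  have xx : `|x| <= 1 + x ^+ 2.
    by rewrite -real_normK ?num_real//; have := normr_ge0 x; nra.
  apply: (@le_trans _ _ (((1 + x ^+ 2) / u) * (A * expR (- (4 * q))))).
    by rewrite ler_pM// ?mulr_ge0 ?invr_ge0 ?gk_ge0 ?ler_pM// ?invr_ge0 ltW.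
  rewrite mulrAC [leRHS]mulrAC ler_wpM2r ?invr_ge0 ?(ltW u0)//.
  by rewrite (mulrDl 1 (x ^+ 2)) (mulrDl 1 (8 * v)) !mul1r lerD.
- rewrite /gk2 normrM (ger0_norm (gk_ge0 _ _)).
  apply: (@le_trans _ _ ((8 * v / u ^+ 2 + u^-1) * (A * expR (- q)))); last first.
    by rewrite ler_wpM2r// /D; lra.
  apply: (@le_trans _ _ ((x ^+ 2 / u ^+ 2 + u^-1) * (A * expR (- (4 * q))))).
    rewrite ler_pM ?gk_ge0//; apply: (le_trans (ler_normB _ _)).
    rewrite (gtr0_norm (_ : 0 < e^-1)) ?invr_gt0// lerD//.
    rewrite ger0_norm ?divr_ge0 ?sqr_ge0// ler_wpM2l ?sqr_ge0//.
    by rewrite lef_pV2 ?posrE ?exprn_gt0// ler_pXn2r// nnegrE ltW.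
  rewrite [leLHS]mulrDl [leRHS]mulrDl lerD//; last by rewrite ler_wpM2l ?invr_ge0 ?(ltW u0).
  by rewrite mulrAC [leRHS]mulrAC ler_wpM2r ?invr_ge0 ?exprn_ge0 ?(ltW u0).
Qed.

End gaussian.

Section gaussian_integrals.
Context {R : realType}.
Implicit Types e x y m : R.

Lemma gk2_itg e m : 0 < e -> itg (@lebR R) (fun x => gk2 e (x - m)).
Proof.
move=> e0; have [C C0 HC] := gk_bounds e0 (lexx e).
apply: (@itg_le _ _ _ _ _ (fun x => C * gk (4 * e) (x - m))).
- apply: (measurableT_comp (measurable_gk2 e)); exact: measurable_funB.
- by apply: itgZ; have [] := gk_integral m (_ : 0 < 4 * e); rewrite ?mulr_gt0.
- by move=> x; have [] := HC e (x - m) (lexx _) (lexx _).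
Qed.

(* Differentiates the constant mass of [gk e] in the variance [e]. *)
Lemma gk2_integral0 e m : 0 < e -> \int[lebR]_x gk2 e (x - m) = 0.
Proof.
move=> e0; have ee : e / 2 <= 2 * e by lra.
have [C C0 HC] := gk_bounds (divr_gt0 e0 (ltr0n R 2)) ee.
pose f e' x : R := gk e' (x - m).
have I0 x : (`](e / 2), (2 * e)[%classic : set R) x -> 0 < x.
  by rewrite /= in_itv /= => /andP[+ _]; apply: lt_trans; rewrite divr_gt0.
have d1E e' x : 0 < e' -> partial1of2 f e' x = gk2 e' (x - m) / 2.
  move=> e'0; rewrite /partial1of2 derive1E.
  by have := is_derive_gk_var (x - m) e'0 => h; rewrite /f derive_val.
have Ie : (`](e / 2), (2 * e)[%classic : set R) e by rewrite /= in_itv /=; lra.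
have dF := @differentiation_under_integral R _ R lebR f setT measurableT e
  (e / 2) (2 * e) Ie (fun x Ix => (gk_integral m (I0 x Ix)).1) _
  (fun x => C / 2 * gk (4 * (2 * e)) (x - m)).
have {dF} : (fun e' => \int[lebR]_x f e' x)^`()%classic e =
    \int[lebR]_x (partial1of2 f e x).
  apply: dF.
  - by move=> x y /I0 x0 _; have [] := is_derive_gk_var (y - m) x0.
  - by move=> y; rewrite mulr_ge0 ?gk_ge0// divr_ge0// ltW.
  - by apply: itgZ; have [] := gk_integral m (_ : 0 < 4 * (2 * e)); rewrite ?mulr_gt0.
  - move=> x y Ix _; rewrite d1E; last exact: I0.
    rewrite normrM [`|2^-1|]ger0_norm// mulrAC ler_wpM2r//.
    by move: Ix; rewrite /= in_itv /= => /andP[/ltW h1 /ltW h2]; have [] := HC x (y - m) h1 h2.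
under [RHS]eq_Rintegral do rewrite d1E//.
rewrite RintegralZr//; last exact: gk2_itg.
rewrite derive1E (@near_eq_derive R R^o R^o _ (cst 1)).
  rewrite derive_cst => /esym/eqP; rewrite mulf_eq0 => /orP[/eqP//|].
  by rewrite invr_eq0 pnatr_eq0.
near=> e'; rewrite (gk_integral m _).2//.
by near: e'; exact: lt_nbhsr.
Unshelve. all: end_near. Qed.

(** No integration by parts: x ^ 2 [gk] is a combination of [gk2], whose integral vanishes, and of
    [gk], whose mass is one. *)
Lemma gk_moment2 e m : 0 < e ->
  itg (@lebR R) (fun x => (x - m) ^+ 2 * gk e (x - m)) /\
  \int[lebR]_x ((x - m) ^+ 2 * gk e (x - m)) = e.
Proof.
move=> e0; have e0' : e != 0 by rewrite gt_eqF.
have [ki k1] := gk_integral m e0.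
have E : (fun x => (x - m) ^+ 2 * gk e (x - m)) =
    (fun x => e ^+ 2 * gk2 e (x - m) + e * gk e (x - m)).
  by apply/funext => x; rewrite /gk2; field.
rewrite E; split; first exact: itgD (itgZ _ (gk2_itg m e0)) (itgZ _ ki).
rewrite RintegralD//; [|exact: (itgZ _ (gk2_itg m e0))|exact: itgZ].
rewrite (RintegralZl _ _ (gk2_itg m e0))// (RintegralZl _ _ ki)//.
by rewrite gk2_integral0// mulr0 add0r k1 mulr1.
Qed.

(** Completing the square in [z] about the midpoint of [x] and [y]. All convolutions below reduce to
    moments of the Gaussian of variance e / 4. *)
Lemma gk_mul e x y z : 0 < e ->
  gk (e / 2) (x - z) * gk (e / 2) (y - z) =
  gk e (x - y) * gk (e / 4) (z - (x + y) / 2).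
Proof.
move=> e0; have e0' : e != 0 by rewrite gt_eqF.
rewrite /gk mulrACA [RHS]mulrACA -!invfM -!expRD; congr (_^-1 * expR _).
  rewrite -!sqrtrM ?mulr_ge0 ?pi_ge0 ?(ltW e0)//.
  by congr Num.sqrt; field.
by field.
Qed.

Lemma gk_conv e x y : 0 < e ->
  itg (@lebR R) (fun z => gk (e / 2) (x - z) * gk (e / 2) (y - z)) /\
  \int[lebR]_z (gk (e / 2) (x - z) * gk (e / 2) (y - z)) = gk e (x - y).
Proof.
move=> e0; have [ki k1] := gk_integral ((x + y) / 2) (divr_gt0 e0 (ltr0n R 4)).
have E : (fun z => gk (e / 2) (x - z) * gk (e / 2) (y - z)) =
    (fun z => gk e (x - y) * gk (e / 4) (z - (x + y) / 2)).
  by apply/funext => z; exact: gk_mul.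
rewrite E; split; first exact: itgZ.
by rewrite (RintegralZl _ _ ki)// k1 mulr1.
Qed.

Lemma gk1_conv e x y : 0 < e ->
  itg (@lebR R) (fun z => gk1 (e / 2) (x - z) * gk1 (e / 2) (y - z)) /\
  \int[lebR]_z (gk1 (e / 2) (x - z) * gk1 (e / 2) (y - z)) = - gk2 e (x - y).
Proof.
move=> e0; have e0' : e != 0 by rewrite gt_eqF.
have e4 : 0 < e / 4 by rewrite divr_gt0.
pose m := (x + y) / 2.
have [ki k1] := gk_integral m e4; have [mi m1] := gk_moment2 m e4.
pose c := 4 / e ^+ 2 * gk e (x - y).
(* With [m] the midpoint, (x - z) (y - z) = (z - m) ^ 2 - (x - y) ^ 2 / 4, so only the moments of
   order 0 and 2 occur. *)
have E : (fun z => gk1 (e / 2) (x - z) * gk1 (e / 2) (y - z)) =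
    (fun z => c * ((z - m) ^+ 2 * gk (e / 4) (z - m)) -
              c * (x - y) ^+ 2 / 4 * gk (e / 4) (z - m)).
  apply/funext => z; rewrite /gk1 mulrACA gk_mul// -/m /c.
  by rewrite /m; set g := gk e _; set h := gk (e / 4) _; field.
rewrite E; split; first exact: itgB (itgZ _ mi) (itgZ _ ki).
rewrite RintegralB//; [|exact: (itgZ _ mi)|exact: itgZ].
rewrite (RintegralZl _ _ mi)// (RintegralZl _ _ ki)// k1 m1 /c /gk2.
by set g := gk e _; field.
Qed.

End gaussian_integrals.

(** * The heat kernel on R^d and its derivatives *)

Section kernels.
Context {R : realType} {d : nat}.
Implicit Types (e : R) (x y : d.-tuple R).

Definition hk e x y : R := \prod_(i < d) gk e (tnth x i - tnth y i).

Definition hk1 (i : 'I_d) e x y : R :=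
  \prod_(j < d) (if j == i then gk1 e else gk e) (tnth x j - tnth y j).

Definition hk2 (i : 'I_d) e x y : R :=
  \prod_(j < d) (if j == i then gk2 e else gk e) (tnth x j - tnth y j).

Definition lap_hk e x y : R := \sum_(i < d) hk2 i e x y.

Lemma hk_ge0 e x y : 0 <= hk e x y.
Proof. by apply: prodr_ge0 => i _; exact: gk_ge0. Qed.

Lemma hkC e x y : hk e x y = hk e y x.
Proof. by apply: eq_bigr => i _; exact: gkC. Qed.

Lemma lap_hkC e x y : lap_hk e x y = lap_hk e y x.
Proof.
apply: eq_bigr => i _; apply: eq_bigr => j _.
by case: ifP => _; [exact: gk2C|exact: gkC].
Qed.

Section measurability.
Context dd (T : measurableType dd) (f g : T -> d.-tuple R).
Hypotheses (mf : measurable_fun setT f) (mg : measurable_fun setT g).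

Let mtnth (h : R -> R) i : measurable_fun setT h ->
  measurable_fun setT (fun t => h (tnth (f t) i - tnth (g t) i)).
Proof.
move=> mh; apply: (measurableT_comp mh); apply: measurable_funB.
  by move/measurable_fun_tnthP : mf; exact.
by move/measurable_fun_tnthP : mg; exact.
Qed.

Lemma measurable_hk e : measurable_fun setT (fun t => hk e (f t) (g t)).
Proof. by apply: measurable_prod => i _; apply: mtnth; exact: measurable_gk. Qed.

Lemma measurable_hk1 i e : measurable_fun setT (fun t => hk1 i e (f t) (g t)).
Proof.
apply: measurable_prod => j _; apply: mtnth.
by case: ifP => _; [exact: measurable_gk1|exact: measurable_gk].
Qed.

Lemma measurable_lap_hk e : measurable_fun setT (fun t => lap_hk e (f t) (g t)).
Proof.
apply: measurable_sum => i; apply: measurable_prod => j _; apply: mtnth.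
by case: ifP => _; [exact: measurable_gk2|exact: measurable_gk].
Qed.

End measurability.

Lemma hk_integral e x : 0 < e ->
  itg (@leb R d) (hk e x) /\ \int[leb d]_y hk e x y = 1.
Proof.
move=> e0; have E : hk e x = fun y => \prod_i gk e (tnth y i - tnth x i).
  by apply/funext => y; rewrite hkC.
have [h1 h2] := itg_leb_tensor (fun i => (gk_integral (tnth x i) e0).1).
rewrite E; split; first exact: h1.
by rewrite h2 big1// => i _; rewrite (gk_integral _ e0).2.
Qed.

Lemma hk_integral_l e y : 0 < e ->
  itg (@leb R d) (hk e ^~ y) /\ \int[leb d]_x hk e x y = 1.
Proof.
move=> e0; have -> : hk e ^~ y = hk e y by apply/funext => x; rewrite hkC.
exact: hk_integral.
Qed.

Lemma hk_moment2 e x (i : 'I_d) : 0 < e ->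
  itg (@leb R d) (fun y => (tnth y i - tnth x i) ^+ 2 * hk e x y) /\
  \int[leb d]_y ((tnth y i - tnth x i) ^+ 2 * hk e x y) = e.
Proof.
move=> e0; pose h j (t : R) := if j == i then (t - tnth x j) ^+ 2 * gk e (t - tnth x j)
  else gk e (t - tnth x j).
have hi j : itg (@lebR R) (h j).
  by rewrite /h; case: (j == i); [exact: (gk_moment2 (tnth x j) e0).1|exact: (gk_integral (tnth x j) e0).1].
have E : (fun y => (tnth y i - tnth x i) ^+ 2 * hk e x y) =
    fun y => \prod_j h j (tnth y j).
  apply/funext => y; rewrite hkC /hk (bigD1 i)//= [RHS](bigD1 i)//= /h eqxx mulrA.
  by congr (_ * _); apply: eq_bigr => j /negbTE ->.
have [h1 h2] := itg_leb_tensor hi; rewrite E; split; first exact: h1.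
rewrite h2 (bigD1 i)//= big1 ?mulr1.
  by rewrite /h eqxx (gk_moment2 _ e0).2.
by move=> j /negbTE ji; rewrite /h ji (gk_integral _ e0).2.
Qed.

Lemma hk_conv e x y : 0 < e ->
  itg (@leb R d) (fun z => hk (e / 2) x z * hk (e / 2) y z) /\
  \int[leb d]_z (hk (e / 2) x z * hk (e / 2) y z) = hk e x y.
Proof.
move=> e0; have [h1 h2] := itg_leb_tensor (fun i => (gk_conv (tnth x i) (tnth y i) e0).1).
have -> : (fun z => hk (e / 2) x z * hk (e / 2) y z) = fun z =>
    \prod_i (gk (e / 2) (tnth x i - tnth z i) * gk (e / 2) (tnth y i - tnth z i)).
  by apply/funext => z; rewrite big_split.
by rewrite h2; split; [exact: h1|apply: eq_bigr => i _; rewrite (gk_conv _ _ e0).2].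
Qed.

(* Exhibits the Laplacian of the heat kernel as a negative definite kernel. *)
Lemma lap_hk_conv e x y : 0 < e ->
  (forall i, itg (@leb R d) (fun z => hk1 i (e / 2) x z * hk1 i (e / 2) y z)) /\
  lap_hk e x y =
  - \sum_(i < d) \int[leb d]_z (hk1 i (e / 2) x z * hk1 i (e / 2) y z).
Proof.
move=> e0; pose h i j (t : R) := (if j == i then gk1 (e / 2) else gk (e / 2)) (tnth x j - t) *
  (if j == i then gk1 (e / 2) else gk (e / 2)) (tnth y j - t).
have hi i j : itg (@lebR R) (h i j).
  by rewrite /h; case: (j == i); [exact: (gk1_conv (tnth x j) (tnth y j) e0).1|exact: (gk_conv (tnth x j) (tnth y j) e0).1].
have E i : (fun z => hk1 i (e / 2) x z * hk1 i (e / 2) y z) =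
    fun z => \prod_j h i j (tnth z j).
  by apply/funext => z; rewrite /hk1 -big_split.
split; first by move=> i; rewrite E; exact: (itg_leb_tensor (hi i)).1.
rewrite -sumrN; apply: eq_bigr => i _; rewrite E (itg_leb_tensor (hi i)).2.
rewrite /hk2 (bigD1 i)//= [in RHS](bigD1 i)//= -mulNr; congr (_ * _).
  by rewrite /h eqxx (gk1_conv _ _ e0).2 opprK.
by apply: eq_bigr => j /negbTE ji; rewrite /h ji (gk_conv _ _ e0).2.
Qed.

Lemma hk_bounds u v : 0 < u -> u <= v -> exists2 C : R, 0 < C &
  forall e x y, u <= e -> e <= v -> [/\ hk e x y <= C * hk (4 * v) x y,
    forall i, `|hk1 i e x y| <= C * hk (4 * v) x y &
    `|lap_hk e x y| <= C * hk (4 * v) x y].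
Proof.
move=> u0 uv; have [C C0 HC] := gk_bounds u0 uv.
have CC : 0 < C ^+ d by rewrite exprn_gt0.
(* One factor [C] per coordinate, and [d] for the summands of [lap_hk]; the 1 keeps the constant
   positive, and the bounds on [hk] valid, when d = 0. *)
exists (C ^+ d * (1 + d%:R)); first by rewrite mulr_gt0// ltr_pwDl.
move=> e x y ue ev.
have P (k : 'I_d -> R -> R) : (forall i t, `|k i t| <= C * gk (4 * v) t) ->
    `|\prod_i k i (tnth x i - tnth y i)| <= C ^+ d * hk (4 * v) x y.
  move=> kC; rewrite normr_prod (@le_trans _ _ (\prod_(i < d) (C * gk (4 * v) (tnth x i - tnth y i))))//.
    by apply: ler_prod => i _; rewrite normr_ge0 kC.
  by rewrite big_split /= prodr_const card_ord.
have k0 : C ^+ d * hk (4 * v) x y <= C ^+ d * (1 + d%:R) * hk (4 * v) x y.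
  by rewrite ler_wpM2r ?hk_ge0// ler_peMr ?(ltW CC)// lerDl.
have Hk t : `|gk e t| <= C * gk (4 * v) t.
  by rewrite ger0_norm ?gk_ge0//; have [] := HC e t ue ev.
have Hk1 t : `|gk1 e t| <= C * gk (4 * v) t by have [] := HC e t ue ev.
have Hk2 t : `|gk2 e t| <= C * gk (4 * v) t by have [] := HC e t ue ev.
split.
- rewrite -(ger0_norm (hk_ge0 _ _ _)); apply: le_trans k0.
  by apply: (P (fun=> gk e)).
- move=> i; apply: le_trans k0.
  by apply: (P (fun j => if j == i then gk1 e else gk e)) => j t; case: ifP.
- rewrite (le_trans (ler_norm_sum _ _ _))//.
  apply: (@le_trans _ _ (\sum_(i < d) C ^+ d * hk (4 * v) x y)).
    apply: ler_sum => i _.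
    by apply: (P (fun j => if j == i then gk2 e else gk e)) => j t; case: ifP.
  rewrite sumr_const card_ord [leLHS](_ : _ = C ^+ d * d%:R * hk (4 * v) x y); last first.
    by rewrite -[LHS]mulr_natr mulrAC.
  by rewrite ler_wpM2r ?hk_ge0// ler_wpM2l ?(ltW CC)// lerDr.
Qed.

Lemma hk_peak e x y : 0 < e -> hk e x y <= (Num.sqrt (2 * pi * e))^-1 ^+ d.
Proof.
move=> e0; rewrite -[X in _ ^+ X]card_ord -prodr_const.
by apply: ler_prod => i _; rewrite gk_ge0/= gk_peak.
Qed.

End kernels.

(** * The heat kernel as a Schwartz test function *)

Section gaussian_schwartz.
Context {R : realType} {d : nat}.
Variables (e : R) (y : d.-tuple R).
Hypothesis e0 : 0 < e.
Local Notation E := 'rV[R]_d.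

(** Polynomials times a Gaussian form a class stable under differentiation, so all derivatives of
    the heat kernel are controlled without computing Hermite polynomials. *)
Definition pgk (q : {poly R}) (t : R) : R := q.[t] * gk e t.

Definition pgk_deriv (q : {poly R}) : {poly R} := q^`() - e^-1 *: ('X * q).

Lemma is_derive_pgk (q : {poly R}) (t : R) : is_derive t 1 (pgk q) (pgk (pgk_deriv q) t).
Proof.
have dk := is_derive_gk t e0.
have -> : pgk q = (horner q : R -> R) * gk e by apply/funext.
apply: is_derive_eq; rewrite /pgk /pgk_deriv /gk1 /GRing.scale /=; move: (gk e t) => g.
rewrite !hornerE /=.
by ring.
Qed.

Lemma continuous_pgk q : continuous (pgk q).
Proof.
move=> t; apply: cvgM; first exact: continuous_horner.
exact: continuous_gk.
Qed.

Lemma poly_growth (q : {poly R}) : exists n, exists2 C, 0 <= C &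
  forall t, `|q.[t]| <= C * (1 + `|t|) ^+ n.
Proof.
elim/poly_ind: q => [|q c [n [C C0 HC]]].
  by exists 0%N, 0 => // t; rewrite horner0 normr0 mul0r.
exists n.+1, (C + `|c|); first by rewrite addr_ge0.
move=> t; rewrite !hornerE (le_trans (ler_normD _ _))// mulrDl lerD//.
  by rewrite normrM exprSr mulrA ler_pM// lerDr.
by rewrite ler_peMr// exprn_ege1// lerDl.
Qed.

Lemma gk_decay n : exists C, forall t, (1 + `|t|) ^+ n * gk e t <= C.
Proof.
(* With s = t ^ 2 / (2 e): 1 + |t| <= 2 + 2 t ^ 2 <= (2 + 4 e) (1 + s), and 1 + s <= (n + 1) exp (s
   / (n + 1)), whose power n + 1 is cancelled by the Gaussian. Using n + 1 instead of n avoids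
   dividing by zero. *)
exists ((2 + 4 * e) ^+ n * (n.+1%:R ^+ n.+1) * (Num.sqrt (2 * pi * e))^-1) => t.
rewrite /gk [_^-1 * _]mulrC mulrA ler_wpM2r ?invr_ge0//.
set s := t ^+ 2 / (2 * e).
have s0 : 0 <= s by rewrite divr_ge0 ?sqr_ge0// mulr_ge0 ?ltW.
have e0' : e != 0 by rewrite gt_eqF.
have b0 : 0 <= 2 + 4 * e by have := ltW e0; lra.
have ts : t ^+ 2 = 2 * e * s by rewrite /s; field.
have h1 : (1 + `|t|) ^+ n <= (2 + 4 * e) ^+ n * (1 + s) ^+ n.
  rewrite -exprMn; apply: lerXn2r; rewrite ?nnegrE ?addr_ge0//.
    by rewrite mulr_ge0// addr_ge0.
  apply: (@le_trans _ _ (2 + 2 * t ^+ 2)).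
    by rewrite -(real_normK (num_real t)); have := normr_ge0 t; nra.
  by rewrite ts; move: s0; clearbody s; have := ltW e0; nra.
have h2 : (1 + s) ^+ n <= n.+1%:R ^+ n.+1 * expR s.
  apply: (@le_trans _ _ ((1 + s) ^+ n.+1)).
    by rewrite exprS ler_peMl ?exprn_ge0 ?addr_ge0// lerDl.
  have -> : expR s = expR (s / n.+1%:R) ^+ n.+1.
    by rewrite -expRM_natl mulrC divfK// pnatr_eq0.
  have p1 : 0 <= 1 + s by rewrite addr_ge0.
  have p2 : 0 <= n.+1%:R * expR (s / n.+1%:R) by rewrite mulr_ge0 ?expR_ge0.
  rewrite -exprMn lerXn2r ?nnegrE//.
  apply: (@le_trans _ _ (n.+1%:R * (1 + s / n.+1%:R))); last first.
    by apply: ler_wpM2l => //; exact: expR_ge1Dx.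
  by rewrite mulrDr mulr1 [_ * (s / _)]mulrC divfK ?pnatr_eq0// lerD2r ler1n.
apply: le_trans (ler_wpM2r (expR_ge0 (- s)) h1) _.
rewrite -[leLHS]mulrA ler_wpM2l ?exprn_ge0//.
apply: le_trans (ler_wpM2r (expR_ge0 (- s)) h2) _.
by rewrite -[leLHS]mulrA -expRD subrr expR0 mulr1.
Qed.

Lemma pgk_decay k (q : {poly R}) (a : R) : exists C, forall t,
  (1 + `|t + a|) ^+ k * `|pgk q t| <= C.
Proof.
have [n [B B0 HB]] := poly_growth q; have [C HC] := gk_decay (k + n).
exists ((1 + `|a|) ^+ k * B * C) => t.
have C0 : 0 <= C by apply: le_trans (HC 0); rewrite mulr_ge0 ?exprn_ge0 ?addr_ge0 ?gk_ge0.
rewrite /pgk normrM (ger0_norm (gk_ge0 _ _)).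
have h : (1 + `|t + a|) ^+ k <= (1 + `|a|) ^+ k * (1 + `|t|) ^+ k.
  rewrite -exprMn; apply: lerXn2r; rewrite ?nnegrE ?addr_ge0 ?mulr_ge0 ?addr_ge0//.
  by have := ler_normD t a; have := normr_ge0 t; have := normr_ge0 a; nra.
apply: (@le_trans _ _ (((1 + `|a|) ^+ k * (1 + `|t|) ^+ k) *
    (B * (1 + `|t|) ^+ n * gk e t))).
  by apply: ler_pM; rewrite ?mulr_ge0 ?exprn_ge0 ?addr_ge0 ?gk_ge0 ?ler_wpM2r ?gk_ge0.
rewrite [leLHS](_ : _ = (1 + `|a|) ^+ k * B * ((1 + `|t|) ^+ (k + n) * gk e t)).
  by rewrite ler_wpM2l// mulr_ge0 ?exprn_ge0 ?addr_ge0.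
by rewrite exprD; ring.
Qed.

Definition gtensor (q : 'I_d -> {poly R}) (v : E) : R :=
  \prod_i pgk (q i) (v 0 i - tnth y i).

Lemma continuous_gtensor (q : 'I_d -> {poly R}) : continuous (gtensor q).
Proof.
apply: continuous_big => [|i _ v]; first exact: mul_continuous.
apply: (@continuous_comp _ _ _ (fun v : E => v 0 i)
  (fun t => pgk (q i) (t - tnth y i))); first exact: coord_continuous.
apply: (@continuous_comp _ _ _ (fun t : R => t - tnth y i) (pgk (q i))).
  by apply: (@cvgB _ R^o); [exact: cvg_id|exact: cvg_cst].
exact: continuous_pgk.
Qed.

Lemma is_derive_gtensor (q : 'I_d -> {poly R}) (i : 'I_d) (v : E) : is_derive v (evec i) (gtensor q)
  (gtensor (fun j => if j == i then pgk_deriv (q i) else q j) v).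
Proof.
pose t := v 0 i - tnth y i.
pose c := \prod_(j | j != i) pgk (q j) (v 0 j - tnth y j).
have [dq eq] := is_derive_pgk (q i) t.
have gE h : h^-1 *: (gtensor q (h *: evec i + v) - gtensor q v) =
    c * (h^-1 *: (pgk (q i) (h *: 1 + t) - pgk (q i) t)).
  have -> : gtensor q v = pgk (q i) t * c by rewrite /gtensor (bigD1 i).
  have -> : gtensor q (h *: evec i + v) = pgk (q i) (h *: 1 + t) * c.
    rewrite /gtensor (bigD1 i)//=; congr (pgk _ _ * _).
      by rewrite /evec !mxE !eqxx /t /GRing.scale /= addrA.
    apply: eq_bigr => j /negbTE ji; rewrite /evec !mxE eqxx /= ji.
    by rewrite mulr0 add0r.
  by rewrite /GRing.scale /=; ring.
have lE : h^-1 *: (gtensor q (h *: evec i + v) - gtensor q v) @[h --> 0^'] -->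
    c * pgk (pgk_deriv (q i)) t.
  under eq_fun do rewrite gE.
  rewrite -eq; apply: cvgM; first exact: cvg_cst.
  exact: dq.
apply: DeriveDef; first by apply/cvg_ex; exists (c * pgk (pgk_deriv (q i)) t).
rewrite /derive (cvg_lim _ lE)// mulrC /gtensor (bigD1 i)//= eqxx; congr (_ * _).
by apply: eq_bigr => j /negbTE ->.
Qed.

Lemma derive_gtensor (q : 'I_d -> {poly R}) (i : 'I_d) (v : E) :
  'D_(evec i) (gtensor q) v =
  gtensor (fun j => if j == i then pgk_deriv (q i) else q j) v.
Proof. by have [] := is_derive_gtensor q i v. Qed.

Lemma pderiv_gtensor s (q : 'I_d -> {poly R}) : exists q', pderiv s (gtensor q) = gtensor q'.
Proof.
elim: s => [|i s [q' IH]] /=; first by exists q.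
exists (fun j => if j == i then pgk_deriv (q' i) else q' j).
by apply/funext => v; rewrite IH derive_gtensor.
Qed.

Lemma gtensor_decay k (q : 'I_d -> {poly R}) : exists C, forall v, (1 + `|v|) ^+ k * `|gtensor q v| <= C.
Proof.
have /choice[C HC] : forall i, exists C, forall t,
    (1 + `|t + tnth y i|) ^+ k * `|pgk (q i) t| <= C.
  by move=> i; exact: pgk_decay.
exists (\prod_i C i) => v.
(* The norm is the maximum norm: one factor attains it and the others are at least 1. The zero norm
   is separate because there may be no coordinate at all. *)
have nv : 1 + `|v| <= \prod_i (1 + `|v 0 i|).
  have p1 : 1 <= \prod_(i < d) (1 + `|v 0 i|).
    by elim/big_ind : _ => // [a b a1 b1|i _]; [rewrite mulr_ege1|rewrite lerDl].
  have [v0|/mx_norm_neq0[[i j] /= vij]] := eqVneq (mx_norm v) 0.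
    by rewrite [`|v|]v0 addr0.
  rewrite [`|v|]vij (ord1 i) (bigD1 j)//= ler_peMr ?addr_ge0//.
  by elim/big_ind : _ => // [a b a1 b1|l _]; [rewrite mulr_ege1|rewrite lerDl].
apply: (@le_trans _ _ (\prod_i ((1 + `|v 0 i|) ^+ k * `|pgk (q i) (v 0 i - tnth y i)|))).
  rewrite big_split /= prodrXl normr_prod ler_wpM2r ?prodr_ge0//.
  by apply: lerXn2r; rewrite ?nnegrE ?addr_ge0// prodr_ge0// => i _; rewrite addr_ge0.
apply: ler_prod => i _; rewrite mulr_ge0 ?exprn_ge0 ?addr_ge0//=.
by have := HC i (v 0 i - tnth y i); rewrite subrK.
Qed.

Lemma schwartz_gtensor (q : 'I_d -> {poly R}) : schwartz (gtensor q).
Proof.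
split; [|split].
- by move=> s; have [q' ->] := pderiv_gtensor s q; exact: continuous_gtensor.
- move=> s i v; have [q' ->] := pderiv_gtensor s q.
  by have [] := is_derive_gtensor q' i v.
- by move=> s k; have [q' ->] := pderiv_gtensor s q; exact: gtensor_decay.
Qed.

Definition hkrow (v : E) : R := \prod_i gk e (v 0 i - tnth y i).

Let hkrowE : hkrow = gtensor (fun=> 1%:P).
Proof.
apply/funext => v; apply: eq_bigr => i _; by rewrite /pgk hornerC mul1r.
Qed.

Lemma schwartz_hkrow : schwartz hkrow.
Proof. by rewrite hkrowE; exact: schwartz_gtensor. Qed.

Lemma hkrow_rv x : hkrow (rv x) = hk e x y.
Proof. by apply: eq_bigr => i _; rewrite /rv mxE. Qed.

Lemma laplacian_hkrow x : laplacian hkrow (rv x) = lap_hk e x y.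
Proof.
apply: eq_bigr => i _; have E1 : pderiv [:: i] hkrow =
    gtensor (fun j => if j == i then pgk_deriv 1%:P else 1%:P).
  by apply/funext => v; rewrite hkrowE /= derive_gtensor.
transitivity ('D_(evec i) (pderiv [:: i] hkrow) (rv x)) => //.
rewrite E1 derive_gtensor eqxx /gtensor /hk2.
apply: eq_bigr => j _; rewrite /rv mxE; case: ifP => // ji.
  rewrite /pgk /gk2; move: (gk e _) => g.
  have -> : pgk_deriv 1%:P = - (e^-1 *: 'X).
    by rewrite /pgk_deriv derivC mulr1 sub0r.
  rewrite /pgk_deriv derivN derivZ derivX !hornerE.
  by rewrite /=; field; rewrite gt_eqF.
by rewrite ji /pgk hornerC mul1r.
Qed.

End gaussian_schwartz.

(** Expands the square of s |a| - |b|. The free weight [s] makes this a substitute for the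
    Cauchy-Schwarz inequality. *)
Lemma amgm (R : realType) (s a b : R) : 0 < s ->
  `|a * b| <= 2^-1 * (s * a ^+ 2) + 2^-1 * (s^-1 * b ^+ 2).
Proof.
move=> s0; rewrite normrM -(real_normK (num_real a)) -(real_normK (num_real b)).
have s0' : s != 0 by rewrite gt_eqF.
rewrite -subr_ge0 [leRHS](_ : _ = s^-1 * (s * `|a| - `|b|) ^+ 2 / 2).
  by rewrite divr_ge0// mulr_ge0 ?sqr_ge0// invr_ge0 ltW.
by field.
Qed.

(** * Square integrable functions and the heat semigroup *)

Section L2.
Context d (T : measurableType d) (R : realType) (m : {measure set T -> \bar R}).
Implicit Types f g : T -> R.

Definition sqi f := measurable_fun setT f /\ itg m (fun x => f x ^+ 2).

Lemma sqi_le f g : measurable_fun setT f -> sqi g -> (forall x, `|f x| <= `|g x|) ->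
  sqi f.
Proof.
move=> mf [mg gi] fg; split => //; apply: itg_le gi _.
  exact: measurable_funX.
by move=> x; rewrite normrX -[leRHS]real_normK ?num_real// lerXn2r// nnegrE.
Qed.

Lemma sqiM f g : sqi f -> sqi g -> itg m (fun x => f x * g x).
Proof.
move=> [mf fi] [mg gi].
apply: (@itg_le _ _ _ _ _ (fun x => 2^-1 * (1 * f x ^+ 2) + 2^-1 * (1^-1 * g x ^+ 2))).
- exact: measurable_funM.
- by apply: itgD; apply: itgZ; apply: itgZ.
- by move=> x; exact: amgm.
Qed.

Lemma sqi_amgm f g s : sqi f -> sqi g -> 0 < s ->
  `|\int[m]_x (f x * g x)| <=
  2^-1 * (s * \int[m]_x (f x ^+ 2)) + 2^-1 * (s^-1 * \int[m]_x (g x ^+ 2)).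
Proof.
move=> f2 g2 s0; have [[mf fi] [mg gi]] := (f2, g2).
have fgi := sqiM f2 g2.
apply: le_trans (le_normr_Rintegral measurableT fgi) _.
have h1 : itg m (fun x => 2^-1 * (s * f x ^+ 2)) by do 2 apply: itgZ.
have h2 : itg m (fun x => 2^-1 * (s^-1 * g x ^+ 2)) by do 2 apply: itgZ.
apply: (@le_trans _ _ (\int[m]_x (2^-1 * (s * f x ^+ 2) + 2^-1 * (s^-1 * g x ^+ 2)))).
  apply: le_Rint; [exact: itg_abs|exact: itgD|].
  by move=> x; exact: amgm.
rewrite RintegralD// (RintegralZl _ _ (itgZ s fi))// (RintegralZl _ _ fi)//.
by rewrite (RintegralZl _ _ (itgZ s^-1 gi))// (RintegralZl _ _ gi).
Qed.

Lemma sqiZ k f : sqi f -> sqi (fun x => k * f x).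
Proof.
move=> [mf fi]; split; first exact: measurable_funM.
by under [X in _.-integrable _ X]eq_fun do rewrite /= exprMn; exact: (itgZ (k ^+ 2) fi).
Qed.

Lemma sqiD f g : sqi f -> sqi g -> sqi (fun x => f x + g x).
Proof.
move=> f2 g2; have [[mf fi] [mg gi]] := (f2, g2); split; first exact: measurable_funD.
under [X in _.-integrable _ X]eq_fun do rewrite /= sqrrD.
by apply: itgD => //; apply: itgD => //; under [X in _.-integrable _ X]eq_fun do rewrite /= -mulr_natl;
  apply: (itgZ 2); exact: sqiM.
Qed.

Lemma sqiB f g : sqi f -> sqi g -> sqi (fun x => f x - g x).
Proof.
move=> f2 g2; have := sqiD f2 (sqiZ (-1) g2).
by under [X in sqi X]eq_fun do rewrite mulN1r.
Qed.

End L2.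

(** * Schur's test for nonnegative kernels *)

Section schur.
Context d1 d2 (T1 : measurableType d1) (T2 : measurableType d2) (R : realType).
Variables (m1 : {sigma_finite_measure set T1 -> \bar R}).
Variables (m2 : {sigma_finite_measure set T2 -> \bar R}).
Variables (k : T1 * T2 -> R) (A : R).
Hypothesis mk : measurable_fun setT k.
Hypothesis k0 : forall p, 0 <= k p.
Hypothesis k1 : forall x, itg m2 (fun y => k (x, y)) /\ \int[m2]_y k (x, y) <= A.
Hypothesis k2 : forall y, itg m1 (fun x => k (x, y)) /\ \int[m1]_x k (x, y) <= A.
Local Notation mm := (prodm m1 m2).

Let row_bound f : itg m1 f -> (forall x, 0 <= f x) ->
  itg mm (fun p => f p.1 * k p) /\ \int[mm]_p (f p.1 * k p) <= A * \int[m1]_x f x.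
Proof.
move=> fi f0.
have fki : itg mm (fun p => f p.1 * k p).
  apply: itg_prod1.
  - apply: measurable_funM => //; apply: measurableT_comp => //.
    exact: itg_measurable fi.
  - by move=> x; exact: (itgZ (f x) (k1 x).1).
  - exists (fun x => A * f x); first exact: itgZ.
    move=> x /=; under eq_Rintegral do rewrite ger0_norm ?mulr_ge0//.
    by rewrite (RintegralZl _ _ (k1 x).1)// mulrC ler_wpM2r// (k1 x).2.
split => //; have [h1 ->] := Rfubini1 fki.
rewrite -RintegralZl//; apply: le_Rint; [exact: h1|exact: itgZ|].
by move=> x; rewrite /= (RintegralZl _ _ (k1 x).1)// mulrC ler_wpM2r// (k1 x).2.
Qed.

Let col_bound g : itg m2 g -> (forall y, 0 <= g y) ->
  itg mm (fun p => g p.2 * k p) /\ \int[mm]_p (g p.2 * k p) <= A * \int[m2]_y g y.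
Proof.
move=> gi g0.
have gki : itg (prodm m2 m1) (fun p => g p.1 * k (p.2, p.1)).
  apply: itg_prod1.
  - apply: measurable_funM; apply: measurableT_comp => //.
      exact: itg_measurable gi.
    exact: measurable_fun_pair.
  - by move=> x; exact: (itgZ (g x) (k2 x).1).
  - exists (fun x => A * g x); first exact: itgZ.
    move=> x /=; under eq_Rintegral do rewrite ger0_norm ?mulr_ge0//.
    by rewrite (RintegralZl _ _ (k2 x).1)// mulrC ler_wpM2r// (k2 x).2.
have gki' : itg mm (fun p => g p.2 * k p).
  have := itg_swap gki; apply: eq_integrable => // -[x y] _ /=; by [].
split => //; have [h1 ->] := Rfubini2 gki'.
rewrite -RintegralZl//; apply: le_Rint; [exact: h1|exact: itgZ|].
by move=> x; rewrite /= (RintegralZl _ _ (k2 x).1)// mulrC ler_wpM2r// (k2 x).2.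
Qed.

(** Under the weight [k] the product is dominated by f ^ 2 + g ^ 2 up to constants; integrating
    along rows handles f ^ 2, along columns g ^ 2. *)
Lemma schur_itg f g : sqi m1 f -> sqi m2 g ->
  itg mm (fun p => f p.1 * k p * g p.2).
Proof.
move=> [mf fi] [mg gi].
have [hf _] := row_bound fi (fun x => sqr_ge0 _).
have [hg _] := col_bound gi (fun x => sqr_ge0 _).
apply: (@itg_le _ _ _ _ _ (fun p => 2^-1 * (f p.1 ^+ 2 * k p) + 2^-1 * (g p.2 ^+ 2 * k p))).
- by apply: measurable_funM; [apply: measurable_funM => //|]; apply: measurableT_comp.
- by apply: itgD; apply: itgZ.
- move=> p; rewrite mulrAC normrM (ger0_norm (k0 p)).
  apply: le_trans (ler_wpM2r (k0 p) (amgm (f p.1) (g p.2) (ltr01 : 0 < 1 :> R))) _.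
  by rewrite invr1 !mul1r mulrDl !mulrA.
Qed.

Lemma schur_bound f g s : sqi m1 f -> sqi m2 g -> 0 < s ->
  `|\int[mm]_p (f p.1 * k p * g p.2)| <=
  A * (2^-1 * (s * \int[m1]_x (f x ^+ 2)) + 2^-1 * (s^-1 * \int[m2]_x (g x ^+ 2))).
Proof.
move=> f2 g2 s0; have [[mf fi] [mg gi]] := (f2, g2).
have [hf Hf] := row_bound fi (fun x => sqr_ge0 _).
have [hg Hg] := col_bound gi (fun x => sqr_ge0 _).
have i := schur_itg f2 g2.
apply: le_trans (le_normr_Rintegral measurableT i) _.
apply: (@le_trans _ _ (\int[mm]_p ((2^-1 * s) * (f p.1 ^+ 2 * k p) + (2^-1 * s^-1) * (g p.2 ^+ 2 * k p)))).
  apply: le_Rint; [exact: itg_abs|by apply: itgD; apply: itgZ|].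
  move=> p; rewrite mulrAC normrM (ger0_norm (k0 p)).
  apply: le_trans (ler_wpM2r (k0 p) (amgm (f p.1) (g p.2) s0)) _.
  by rewrite mulrDl !mulrA.
have s0' : 0 <= s^-1 by rewrite invr_ge0 ltW.
rewrite RintegralD//; [|exact: itgZ|exact: itgZ].
rewrite (RintegralZl _ _ hf)// (RintegralZl _ _ hg)//.
have c1 : 0 <= 2^-1 * s by rewrite mulr_ge0 ?ltW.
have c2 : 0 <= 2^-1 * s^-1 by rewrite mulr_ge0.
apply: le_trans (lerD (ler_wpM2l c1 Hf) (ler_wpM2l c2 Hg)) _.
by rewrite le_eqVlt; apply/orP; left; apply/eqP; move: (s^-1) => s'; ring.
Qed.

End schur.

(** * Orthants and boxes in R^d *)

Section orthants.
Context {R : realType} {d : nat}.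
Local Notation E := (d.-tuple R).

Definition orthant (b : 'I_d -> R) : set E := [set x | forall i, tnth x i < b i].

Definition orthants : set (set E) := [set orthant b | b in setT].

Definition obox (a b : 'I_d -> R) : set E :=
  [set x | forall i, a i < tnth x i < b i].

Lemma measurable_coord_set (P : 'I_d -> set R) : (forall i, measurable (P i)) ->
  measurable [set x : E | forall i, P i (tnth x i)].
Proof.
move=> mP; rewrite [X in measurable X](_ : _ =
  \bigcap_(i in [set: 'I_d]) [set x : E | P i (tnth x i)]).
  apply: fin_bigcap_measurable => // i _.
  by rewrite -[X in measurable X]setTI; exact: measurable_tnth.
by apply/seteqP; split => x /= h i => [_|]; apply: h.
Qed.

Lemma measurable_orthant b : measurable (orthant b).
Proof.
have := @measurable_coord_set (fun i => `]-oo, b i[%classic).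
rewrite (_ : [set x | _] = orthant b); first by apply.
by apply/seteqP; split => x /= h i; have := h i; rewrite in_itv.
Qed.

Lemma measurable_obox a b : measurable (obox a b).
Proof.
have := @measurable_coord_set (fun i => `]a i, b i[%classic).
rewrite (_ : [set x | _] = obox a b); first by apply.
by apply/seteqP; split => x /= h i; have := h i; rewrite in_itv.
Qed.

Lemma orthants_setI : setI_closed orthants.
Proof.
move=> _ _ [b _ <-] [c _ <-]; exists (fun i => Num.min (b i) (c i)) => //.
apply/seteqP; split => x /=.
  by move=> h; split=> i; have := h i; rewrite lt_min => /andP[].
by move=> [hb hc] i; rewrite lt_min hb hc.
Qed.

Lemma coord_bound (x : E) : exists n, forall i, `|tnth x i| < n%:R.
Proof.
exists (\max_i (Num.truncn `|tnth x i|).+1) => i.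
apply: (@lt_le_trans _ _ ((Num.truncn `|tnth x i|).+1)%:R).
  by rewrite truncnS_gt.
by rewrite ler_nat (leq_bigmax i).
Qed.

Lemma orthant_cover : \bigcup_n orthant (fun=> n%:R) = [set: E].
Proof.
apply/seteqP; split => // x _; have [n hn] := coord_bound x.
by exists n => // i; exact: le_lt_trans (ler_norm _) (hn i).
Qed.

Lemma measurable_orthants : @measurable _ E = <<s orthants >>.
Proof.
apply/seteqP; split; last first.
  apply: smallest_sub; first exact: sigma_algebra_measurable.
  by move=> _ [b _ <-]; exact: measurable_orthant.
pose T := g_sigma_algebraType orthants.
suff : @measurable_fun _ _ T E setT id.
  by move=> h A mA; have := h measurableT A mA; rewrite setTI.
apply/measurable_fun_tnthP => i.
apply: (measurability (RGenInftyO.G (R := R))).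
  by have := @RGenInftyO.measurableE R.
move=> _ [_ [b ->] <-]; rewrite setTI.
(* A half-space in direction [i] is the countable union of orthants whose other bounds tend to
   infinity. *)
pose c (n : nat) (j : 'I_d) : R := if j == i then b else n%:R.
rewrite [X in measurable X](_ : _ = \bigcup_n (orthant (c n) : set T)); last first.
  apply/seteqP; split => x /=.
    rewrite in_itv /= => xb.
    have [n _ hn] : (\bigcup_n orthant (fun=> n%:R)) x by rewrite orthant_cover.
    by exists n => // j; rewrite /c; case: eqVneq => [->|_] //; exact: hn.
  by move=> [n _ /(_ i)]; rewrite /c eqxx in_itv.
by apply: bigcupT_measurable => n; apply: sub_sigma_algebra; exists (c n).
Qed.

(** A hyperplane is unbounded, so its indicator is not a tensor of integrable functions; weighted by
    a Gaussian in every coordinate it is one, with vanishing factor [i]. Positivity of the weight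
    then removes it. *)
Lemma ae_coord_neq (i : 'I_d) (c : R) : {ae leb d, forall x, tnth x i != c}.
Proof.
pose h j (t : R) := if j == i then \1_[set c] t * gk 1 (t - 0) else gk 1 (t - 0).
have mh j : measurable_fun setT (h j).
  rewrite /h; case: (j == i).
    apply: measurable_funM; first exact: measurable_indic.
    by apply: measurableT_comp (measurable_gk 1) _; exact: measurable_funB.
  by apply: measurableT_comp (measurable_gk 1) _; exact: measurable_funB.
have [ki k1] := gk_integral 0 (ltr01 : 0 < 1 :> R).
have hi j : itg (@lebR R) (h j).
  apply: (itg_le (mh j) ki) => t; rewrite /h; case: (j == i).
    rewrite normrM (ger0_norm (gk_ge0 _ _)) ler_piMl ?gk_ge0//.
    by rewrite indicE; case: (_ \in _); rewrite ?normr1 ?normr0.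
  by rewrite (ger0_norm (gk_ge0 _ _)).
have h0 : \int[lebR]_t h i t = 0.
  have c0 : {ae @lebR R, forall t, t != c}.
    exists [set c]; split => //; first by rewrite lebRE lebesgue_measure_set1.
    by move=> t /= /negP; rewrite negbK => /eqP.
  have h0 : {ae @lebR R, forall t, h i t = 0}.
    apply: filterS c0 => t tc; rewrite /h eqxx indicE memNset ?mul0r//.
    by move=> /= /eqP; rewrite (negbTE tc).
  have [_ ->] := ae_eq_itg (measurable_cst (0 : R)) h0 (hi i).
  by rewrite Rintegral_cst// mul0r.
have [pi pe] := itg_leb_tensor hi.
have : \int[leb d]_x \prod_i0 h i0 (tnth x i0) <= 0.
  by rewrite pe (bigD1 i)//= h0 mul0r.
move/(Rintegral_eq0 pi) => ae0.
have : {ae leb d, forall x, \prod_i0 h i0 (tnth x i0) = 0}.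
  apply: ae0 => x; apply: prodr_ge0 => j _; rewrite /h; case: ifP => _; rewrite ?mulr_ge0 ?gk_ge0//.
apply: filterS => x /eqP; apply: contraTN => /eqP xc.
apply/negP; rewrite prodf_seq_eq0 => /hasP[j _ /=]; rewrite /h.
have g0 t : gk 1 t != 0 :> R by rewrite gt_eqF// gk_gt0.
case: (eqVneq j i) => [->|_]; last by rewrite (negbTE (g0 _)).
by rewrite mulf_eq0 (negbTE (g0 _)) orbF indicE mem_set//= oner_eq0.
Qed.

Lemma ae_obox_boundary (a b : 'I_d -> R) :
  {ae leb d, forall x, forall i, tnth x i != a i /\ tnth x i != b i}.
Proof.
(* The coordinates are indexed by all naturals so that the countable intersection [ae_foralln]
   applies. *)
have h (n : nat) : {ae leb d, forall x : E, forall i : 'I_d, i = n :> nat ->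
    tnth x i != a i /\ tnth x i != b i}.
  have [nd|dn] := ltnP n d; last first.
    apply: aeW => x i ni; move: (ltn_ord i); rewrite ni ltnNge dn.
    by [].
  have := ae_coord_neq (Ordinal nd) (b (Ordinal nd)).
  have := ae_coord_neq (Ordinal nd) (a (Ordinal nd)).
  apply: filterS2 => x ha hb i ni.
  by have -> : i = Ordinal nd by exact/val_inj.
by have := ae_foralln h; apply: filterS => x hx i; exact: hx.
Qed.

End orthants.

(** * The heat semigroup as a bilinear form on L^2 *)

Section heat_bilinear.
Context {R : realType} {d : nat}.
Local Notation E := (d.-tuple R).
Local Notation mu := (@leb R d).
Implicit Types (e s : R) (f g : E -> R).

Lemma sqi_hk e x : 0 < e -> sqi mu (hk e x).
Proof.
move=> e0; have [ki _] := hk_integral x e0.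
have mk := itg_measurable ki; split => //.
apply: (itg_le (measurable_funX 2%N mk) (itgZ ((Num.sqrt (2 * pi * e))^-1 ^+ d) ki)).
move=> y; rewrite ger0_norm ?sqr_ge0// expr2 ler_wpM2r ?hk_ge0//.
exact: hk_peak.
Qed.

Definition heatB e f g : R :=
  \int[(prodm mu mu)]_p (f p.1 * hk e p.1 p.2 * g p.2).

Let mk e : measurable_fun [set: E * E] (fun p => hk e p.1 p.2).
Proof. exact: measurable_hk. Qed.
Let k0 e (p : E * E) : 0 <= hk e p.1 p.2. Proof. exact: hk_ge0. Qed.
Let k1 e (e0 : 0 < e) x :
  itg mu (fun y => hk e (x, y).1 (x, y).2) /\ \int[mu]_y hk e (x, y).1 (x, y).2 <= 1.
Proof. by have [h ->] := hk_integral x e0. Qed.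
Let k2 e (e0 : 0 < e) y :
  itg mu (fun x => hk e (x, y).1 (x, y).2) /\ \int[mu]_x hk e (x, y).1 (x, y).2 <= 1.
Proof. by have [h ->] := hk_integral_l y e0. Qed.

Lemma heatB_itg e f g : 0 < e -> sqi mu f -> sqi mu g ->
  itg (prodm mu mu) (fun p => f p.1 * hk e p.1 p.2 * g p.2).
Proof. by move=> e0; exact: (schur_itg (mk e) (k0 e) (k1 e0) (k2 e0)). Qed.

Lemma heatB_bound e f g s : 0 < e -> sqi mu f -> sqi mu g -> 0 < s ->
  `|heatB e f g| <=
  2^-1 * (s * \int[mu]_x (f x ^+ 2)) + 2^-1 * (s^-1 * \int[mu]_x (g x ^+ 2)).
Proof.
move=> e0 f2 g2 s0.
by have := schur_bound (mk e) (k0 e) (k1 e0) (k2 e0) f2 g2 s0; rewrite mul1r.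
Qed.

Lemma heatBE e f g : 0 < e -> sqi mu f -> sqi mu g ->
  itg mu (fun x => f x * \int[mu]_y (hk e x y * g y)) /\
  heatB e f g = \int[mu]_x (f x * \int[mu]_y (hk e x y * g y)).
Proof.
move=> e0 f2 g2; have [h1 h2] := Rfubini1 (heatB_itg e0 f2 g2).
have E1 : (fun x => \int[mu]_y (f x * hk e x y * g y)) =
    fun x => f x * \int[mu]_y (hk e x y * g y).
  apply/funext => x; under eq_Rintegral do rewrite -mulrA.
  by rewrite (RintegralZl _ _ (sqiM (sqi_hk x e0) g2)).
by rewrite /heatB h2 -E1.
Qed.

Lemma heatBDr e f g h : 0 < e -> sqi mu f -> sqi mu g -> sqi mu h ->
  heatB e f (fun x => g x + h x) = heatB e f g + heatB e f h.
Proof.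
move=> e0 f2 g2 h2; rewrite /heatB -RintegralD//; [|exact: heatB_itg|exact: heatB_itg].
by apply: eq_Rintegral => p _; rewrite mulrDr.
Qed.

Lemma heatBZr e f g c : 0 < e -> sqi mu f -> sqi mu g ->
  heatB e f (fun x => c * g x) = c * heatB e f g.
Proof.
move=> e0 f2 g2; rewrite /heatB -RintegralZl//; last exact: heatB_itg.
by apply: eq_Rintegral => p _; rewrite mulrCA.
Qed.

(** Chebyshev's inequality: the kernel puts mass at most e / r ^ 2 per coordinate outside the cube
    of half-side [r] about [x], and membership in [A] is constant inside it. *)
Lemma hk_indic (A : set E) x (r e : R) : measurable A -> 0 < r -> 0 < e ->
  (forall y, (forall i, `|tnth y i - tnth x i| < r) -> (A y <-> A x)) ->
  `|\int[mu]_y (hk e x y * \1_A y) - \1_A x| <= d%:R * (e / r ^+ 2).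
Proof.
move=> mA r0 e0 HA; have [ki ke] := hk_integral x e0.
have mk' := itg_measurable ki.
have kAi : itg mu (fun y => hk e x y * \1_A y).
  apply: (itg_le _ ki).
    by apply: measurable_funM => //; exact: measurable_indic.
  move=> y; rewrite normrM (ger0_norm (hk_ge0 _ _ _)) ler_piMr ?hk_ge0//.
  by rewrite indicE; case: (_ \in _); rewrite ?normr1 ?normr0.
have kci : itg mu (fun y => \1_A x * hk e x y) by exact: itgZ.
have -> : \int[mu]_y (hk e x y * \1_A y) - \1_A x =
    \int[mu]_y (hk e x y * \1_A y - \1_A x * hk e x y).
  by rewrite RintegralB// (RintegralZl _ _ ki)// ke mulr1.
apply: le_trans (le_normr_Rintegral measurableT (itgB kAi kci)) _.
pose h i y := r ^- 2 * ((tnth y i - tnth x i) ^+ 2 * hk e x y).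
have hi i : itg mu (h i) by apply: itgZ; have [] := hk_moment2 x i e0.
apply: (@le_trans _ _ (\int[mu]_y \sum_i h i y)).
  apply: le_Rint; [exact/itg_abs/itgB|by apply: itg_sum => i _|].
  move=> y; have h0 i : 0 <= h i y.
    by rewrite mulr_ge0 ?invr_ge0 ?exprn_ge0 ?(ltW r0)// mulr_ge0 ?sqr_ge0 ?hk_ge0.
  rewrite [X in `|X|](_ : _ = hk e x y * (\1_A y - \1_A x)); last by rewrite mulrBr [\1_A x * _]mulrC.
  rewrite normrM (ger0_norm (hk_ge0 _ _ _)).
  have [H|/existsNP[i /negP ri]] := pselect (forall i, `|tnth y i - tnth x i| < r).
    have -> : \1_A y = \1_A x :> R.
      rewrite !indicE; congr (_%:R); congr nat_of_bool.
      by apply/idP/idP; rewrite !inE => ?; apply/(HA y H).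
    by rewrite subrr normr0 mulr0; exact: sumr_ge0.
  apply: (@le_trans _ _ (h i y)); last first.
    by rewrite (bigD1 i)//= lerDl; exact: sumr_ge0.
  rewrite /h mulrA [leRHS]mulrC ler_wpM2l ?hk_ge0//.
  apply: (@le_trans _ _ 1).
    by rewrite !indicE; do 2 case: (_ \in _);
      rewrite ?subrr ?subr0 ?sub0r ?normrN ?normr1 ?normr0.
  rewrite mulrC ler_pdivlMr ?exprn_gt0// mul1r -[leRHS]real_normK ?num_real//.
  by rewrite lerXn2r ?nnegrE// ?(ltW r0)// leNgt.
rewrite Rintegral_sum// (eq_bigr (fun=> e / r ^+ 2)).
  by rewrite sumr_const card_ord mulr_natl.
move=> i _; have [mi me] := hk_moment2 x i e0.
by rewrite (RintegralZl _ _ mi)// me mulrC.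
Qed.

Lemma itg_obox (a b : 'I_d -> R) : itg mu (\1_(obox a b) : E -> R).
Proof.
have hi i : itg (@lebR R) (\1_`]a i, b i[ : R -> R).
  by apply/integrable_lebR => //; exact: integrable_indic_itv.
have [h _] := itg_leb_tensor hi.
apply: eq_integrable h => // x _ /=; congr EFin.
have [xb|xb] := pselect (obox a b x).
  rewrite [RHS]indicE mem_set// big1// => i _.
  by rewrite indicE mem_set//= in_itv; exact: xb.
rewrite [RHS]indicE memNset//.
move/existsNP : xb => [i xi]; rewrite (bigD1 i)//= indicE memNset ?mul0r//.
Qed.

Lemma sqi_indic (A : set E) a b : measurable A -> A `<=` obox a b ->
  sqi mu (\1_A : E -> R).
Proof.
move=> mA Ab; split; first exact: measurable_indic.
apply: (itg_le _ (itg_obox a b)).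
  by apply: measurable_funX; exact: measurable_indic.
move=> x; rewrite !indicE; have [xA|xA] := boolP (x \in A).
  by rewrite expr1n normr1 mem_set//; apply: Ab; rewrite -inE.
by rewrite expr0n normr0.
Qed.

End heat_bilinear.

(** * Weak convergence of the heat semigroup as the variance tends to zero *)

Lemma same_side (R : realDomainType) (x y a : R) : `|y - x| < `|x - a| ->
  (y < a) = (x < a) /\ (a < y) = (a < x).
Proof.
case: (ltgtP x a) => xa.
- rewrite [`|x - a|]ltr0_norm ?subr_lt0// ltr_norml opprB => /andP[_ h].
  have ya : y < a by lra.
  by rewrite ya ltNge (ltW ya).
- rewrite [`|x - a|]gtr0_norm ?subr_gt0// ltr_norml => /andP[h _].
  have ya : a < y by lra.
  by rewrite ya ltNge (ltW ya).
- by rewrite xa subrr normr0 ltNge normr_ge0.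
Qed.

Section weak_convergence.
Context {R : realType} {d : nat}.
Local Notation E := (d.-tuple R).
Local Notation mu := (@leb R d).
Variable f : E -> R.
Hypotheses (f2 : sqi mu f) (f1 : itg mu f).

(** The variance runs through a sequence, as dominated convergence requires. [f] stays fixed while
    the admissible [g] grow from boxes to Borel subsets of boxes, to simple functions and to L^2. *)
Definition wconv (g : E -> R) :=
  heatB (harmonic n) f g @[n --> \oo] --> \int[mu]_x (f x * g x).

Let e0 n : 0 < harmonic n :> R := harmonic_gt0 n.

Lemma wconvD g h : sqi mu g -> sqi mu h -> wconv g -> wconv h ->
  wconv (fun x => g x + h x).
Proof.
move=> g2 h2 cg ch; rewrite /wconv.
under eq_fun do rewrite heatBDr//.
under eq_Rintegral do rewrite mulrDr.
rewrite RintegralD//; [|exact: sqiM|exact: sqiM].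
exact: cvgD.
Qed.

Lemma wconvZ c g : sqi mu g -> wconv g -> wconv (fun x => c * g x).
Proof.
move=> g2 cg; rewrite /wconv.
under eq_fun do rewrite heatBZr//.
under eq_Rintegral do rewrite mulrCA.
rewrite RintegralZl//; last exact: sqiM.
by apply: cvgM => //; exact: cvg_cst.
Qed.

Lemma wconvB g h : sqi mu g -> sqi mu h -> wconv g -> wconv h ->
  wconv (fun x => g x - h x).
Proof.
move=> g2 h2 cg ch; have := wconvD g2 (sqiZ (-1) h2) cg (@wconvZ (-1) _ h2 ch).
by under [X in wconv X]eq_fun do rewrite mulN1r.
Qed.

Lemma wconv_sum I (r : seq I) (g : I -> E -> R) :
  (forall i, sqi mu (g i)) -> (forall i, wconv (g i)) ->
  sqi mu (fun x => \sum_(i <- r) g i x) /\ wconv (fun x => \sum_(i <- r) g i x).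
Proof.
move=> g2 cg; elim: r => [|i r [IH1 IH2]].
  under [X in sqi _ X]eq_fun do rewrite big_nil.
  under [X in wconv X]eq_fun do rewrite big_nil.
  split.
    split; first exact: measurable_cst.
    under [X in _.-integrable _ X]eq_fun do rewrite /= expr0n /=.
    exact: integrable0.
  rewrite /wconv; under eq_Rintegral do rewrite mulr0.
  rewrite Rintegral_cst// mul0r.
  have h n : heatB (harmonic n) f (fun=> 0) = 0.
    rewrite /heatB; under eq_Rintegral do rewrite mulr0.
    by rewrite Rintegral_cst// mul0r.
  by under eq_fun do rewrite h; exact: cvg_cst.
under [X in sqi _ X]eq_fun do rewrite big_cons.
under [X in wconv X]eq_fun do rewrite big_cons.
by split; [exact: sqiD|exact: wconvD].
Qed.

(* By [heatB_bound], which is uniform in the variance. *)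
Lemma wconv_lim g (g_ : nat -> E -> R) : sqi mu g -> (forall k, sqi mu (g_ k)) ->
  (forall k, wconv (g_ k)) ->
  \int[mu]_x ((g x - g_ k x) ^+ 2) @[k --> \oo] --> (0 : R) -> wconv g.
Proof.
move=> g2 gk2 cg c0; apply/cvgrPdist_le => eps eps0.
pose F := \int[mu]_x (f x ^+ 2).
have F0 : 0 <= F by apply: Rintegral_ge0 => x _; exact: sqr_ge0.
(* With this weight each of the two error terms is at most eps / 8 + eps / 4, which leaves eps / 4
   for the convergence of [g_ k]. The 1 guards against F = 0. *)
pose s := eps / (4 * (F + 1)).
have s0 : 0 < s by rewrite divr_gt0// mulr_gt0// ltr_wpDl.
have [k /= Hk] : exists k, \int[mu]_x ((g x - g_ k x) ^+ 2) <= s * eps / 2.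
  have se : 0 < s * eps / 2 by rewrite divr_gt0// mulr_gt0.
  have /cvgrPdist_le/(_ _ se)[k _ H] := c0.
  exists k; have := H k (leqnn k); rewrite sub0r normrN => /(le_trans (ler_norm _)).
  exact.
have D2 : sqi mu (fun x => g x - g_ k x) by exact: sqiB.
have sF : 2^-1 * (s * F) <= eps / 8.
  rewrite /s [leLHS](_ : _ = eps / 8 * (F / (F + 1))).
    rewrite ler_piMr ?divr_ge0 ?(ltW eps0)// ler_pdivrMr ?ltr_wpDl// mul1r lerDl.
    by [].
  by field; rewrite gt_eqF// ltr_wpDl.
have sD : 2^-1 * (s^-1 * \int[mu]_x ((g x - g_ k x) ^+ 2)) <= eps / 4.
  apply: (@le_trans _ _ (2^-1 * (s^-1 * (s * eps / 2)))).
    by rewrite ler_wpM2l// ler_wpM2l// invr_ge0 ltW.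
  rewrite le_eqVlt; apply/orP; left; apply/eqP; field.
  by rewrite gt_eqF.
have /cvgrPdist_le/(_ _ (divr_gt0 eps0 (ltr0n R 4))) := cg k.
apply: filterS => n Hn.
have hB := heatB_bound (e0 n) f2 D2 s0.
have hI := sqi_amgm f2 D2 s0.
have EB : heatB (harmonic n) f g =
    heatB (harmonic n) f (g_ k) + heatB (harmonic n) f (fun x => g x - g_ k x).
  rewrite -heatBDr//; congr heatB; apply/funext => x; by rewrite addrC subrK.
have EI : \int[mu]_x (f x * g x) =
    \int[mu]_x (f x * g_ k x) + \int[mu]_x (f x * (g x - g_ k x)).
  rewrite -RintegralD//; [|exact: sqiM|exact: sqiM].
  by apply: eq_Rintegral => x _; rewrite -mulrDr addrC subrK.
rewrite EB EI; move: hB hI Hn sF sD.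
move: (heatB _ _ (g_ k)) (heatB _ _ _) (\int[mu]_x (f x * g_ k x))
  (\int[mu]_x (f x * (g x - g_ k x))) => A B C D.
rewrite -/F; move: (2^-1 * (s * F)) (2^-1 * (s^-1 * _)) => u v hB hI Hn hu hv.
have -> : C + D - (A + B) = (C - A) + (D - B) by ring.
apply: le_trans (ler_normD _ _) _.
have := ler_normB D B; lra.
Qed.

(** For a box the regularised indicator converges pointwise off the null boundary and is bounded by
    1; hence [|f|] dominates, which is what integrability of [f] is for. *)
Lemma wconv_obox a b : wconv (\1_(obox a b)).
Proof.
have g2 : sqi mu (\1_(obox a b) : E -> R).
  exact: (@sqi_indic _ _ _ a b (measurable_obox a b)).
rewrite /wconv; under eq_fun do rewrite (heatBE (e0 _) f2 g2).2.
apply: (@Rintegral_dominated _ _ _ mu _ _ (fun x => `|f x|)).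
- by move=> n; exact: itg_measurable (heatBE (e0 n) f2 g2).1.
- exact: itg_measurable (sqiM f2 g2).
- have := ae_obox_boundary a b; apply: filterS => x xab.
  apply: cvgM; first exact: cvg_cst.
  have [r r0 Hr] : exists2 r : R, 0 < r & forall y, (forall i, `|tnth y i - tnth x i| < r) ->
      (obox a b y <-> obox a b x).
    (* Distance to the nearest pair of faces in direction [i]. The minimum below starts from 1, so
       it stays positive even without coordinates. *)
    pose r i : R := Num.min `|tnth x i - a i| `|tnth x i - b i|.
    exists (\big[Num.min/1]_i r i).
      apply: lt_bigmin => // i _; have [xa xb] := xab i.
      by rewrite lt_min !normr_gt0 !subr_eq0 xa xb.
    move=> y Hy.
    have {}Hy i : `|tnth y i - tnth x i| < `|tnth x i - a i| /\
        `|tnth y i - tnth x i| < `|tnth x i - b i|.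
      have hle : \big[Num.min/1]_j r j <= r i by apply: bigmin_le.
      have := lt_le_trans (Hy i) hle.
      by rewrite /r lt_min => /andP.
    have Hi i : (a i < tnth y i < b i) = (a i < tnth x i < b i).
      by have [/same_side[_ ->] /same_side[-> _]] := Hy i.
    by split=> h i; have := h i; rewrite Hi.
  apply/cvgrPdist_le => eps eps0.
  have c0 : d%:R * (harmonic n / r ^+ 2) @[n --> \oo] --> (0 : R).
    rewrite -[X in _ --> X](mulr0 (d%:R : R)); apply: cvgM; first exact: cvg_cst.
    rewrite -[X in _ --> X](mul0r (r ^- 2)); apply: cvgM; last exact: cvg_cst.
    exact: cvg_harmonic.
  have /cvgrPdist_le/(_ _ eps0) := c0; apply: filterS => n.
  rewrite sub0r normrN => /(le_trans (ler_norm _)); apply: le_trans.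
  rewrite distrC; apply: hk_indic => //; exact: measurable_obox.
- exact: itg_abs.
- apply: aeW => x n; rewrite normrM ler_piMr//.
  have [ki k1] := hk_integral x (e0 n).
  have i2 : itg mu (fun y => hk (harmonic n) x y * \1_(obox a b) y).
    by apply: sqiM => //; exact: sqi_hk.
  apply: le_trans (le_normr_Rintegral measurableT i2) _.
  rewrite -k1; apply: le_Rint => //; first exact: itg_abs.
  move=> y; rewrite normrM (ger0_norm (hk_ge0 _ _ _)) ler_piMr ?hk_ge0//.
  by rewrite indicE; case: (_ \in _); rewrite ?normr1 ?normr0.
Qed.

End weak_convergence.

Section weak_convergence_L2.
Import HBNNSimple.
Context {R : realType} {d : nat}.
Local Notation E := (d.-tuple R).
Local Notation mu := (@leb R d).
Variable f : E -> R.
Hypotheses (f2 : sqi mu f) (f1 : itg mu f).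

Let nbox (k : nat) : set E := obox (fun=> - k%:R) (fun=> k%:R).

Let mnbox k : measurable (nbox k). Proof. exact: measurable_obox. Qed.

Let nbox_sqi k (S : set E) : measurable S -> sqi mu (\1_(S `&` nbox k) : E -> R).
Proof.
move=> mS; have mSN := measurableI _ _ mS (mnbox k).
by apply: (sqi_indic mSN) => x [_]; exact.
Qed.

(** Dynkin induction over orthants. Intersecting with a fixed box keeps every set, complements
    included, of square integrable indicator, and turns an orthant into a box. *)
Lemma wconv_indic_box k (S : set E) : measurable S -> wconv f (\1_(S `&` nbox k)).
Proof.
move=> mS; rewrite measurable_orthants in mS; move: S mS.
apply: (@dynkin_induction _ E orthants (fun S => wconv f (\1_(S `&` nbox k)))).
- exact: measurable_orthants.
- exact: orthants_setI.
- by rewrite setTI; exact: wconv_obox.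
- move=> _ [b _ <-]; rewrite (_ : _ `&` _ =
    obox (fun=> - k%:R) (fun i => Num.min (b i) k%:R)); first exact: wconv_obox.
  apply/seteqP; split => x /=.
    by move=> [h1 h2] i; have /andP[-> h3] := h2 i; rewrite lt_min h1.
  move=> h; split=> i; have := h i; rewrite lt_min => /andP[h1 /andP[h2 h3]] //.
  by rewrite h1.
- move=> S mS cS.
  rewrite (_ : \1_(~` S `&` nbox k) = fun x => \1_(nbox k) x - \1_(S `&` nbox k) x).
    apply: wconvB => //; [|exact: nbox_sqi|exact: wconv_obox].
    by have := nbox_sqi k measurableT; rewrite setTI.
  apply/funext => x; rewrite !indicE !in_setI in_setC.
  by case: (x \in S); case: (x \in nbox k); rewrite ?subrr ?subr0.
- move=> F mF tF cF.
  (* Finite unions are handled by additivity; inside the box their indicators converge in L^2 to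
     that of the whole union, so [wconv_lim] concludes. *)
  pose G n := \bigcup_(i in `I_n) F i.
  have mG n : measurable (G n) by apply: bigcup_measurable => i _.
  have cG n : wconv f (\1_(G n `&` nbox k)).
    elim: n => [|n IH].
      rewrite /G II0 bigcup_set0 set0I.
      have := @wconvB _ _ _ f2 _ _ (nbox_sqi k measurableT) (nbox_sqi k measurableT).
      have cN : wconv f (\1_(nbox k)) by exact: wconv_obox.
      rewrite setTI => /(_ cN cN).
      by under eq_fun do rewrite subrr; rewrite indic0.
    rewrite (_ : \1_(G n.+1 `&` nbox k) =
        fun x => \1_(G n `&` nbox k) x + \1_(F n `&` nbox k) x).
      by apply: wconvD => //; exact: nbox_sqi.
    apply/funext => x; rewrite !indicE !in_setI.
    have -> : (x \in G n.+1) = (x \in G n) || (x \in F n).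
      apply/idP/orP; rewrite !inE /G.
        move=> [i /=]; rewrite ltnS leq_eqVlt => /predU1P[->|iN] Fx; first by right.
        by left; exists i.
      by move=> [[i /= iN Fx]|Fx]; [exists i => //=; exact: ltnW|exists n => //=].
    case: (x \in nbox k); rewrite ?andbF ?andbT ?addr0//.
    have [xG|xG] := boolP (x \in G n); last by rewrite add0r.
    have [xF|_] := boolP (x \in F n); last by rewrite addr0.
    exfalso; move: xG xF; rewrite !inE => -[i /= iN Fi] Fn.
    have /trivIsetP/(_ i n I I) := tF; rewrite neq_ltn iN => /(_ isT) h.
    by have : (F i `&` F n) x by []; rewrite h.
  apply: (@wconv_lim _ _ _ f2 _ (fun n => \1_(G n `&` nbox k))) => //.
  + by apply: nbox_sqi; apply: bigcup_measurable.
  + by move=> n; exact: nbox_sqi.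
  have mU : measurable (\bigcup_k F k) by apply: bigcup_measurable.
  rewrite [X in _ --> X](_ : _ = \int[mu]_x (0 : R)); last by rewrite Rintegral_cst// mul0r.
  have bi : itg mu (\1_(nbox k) : E -> R) by exact: itg_obox.
  apply: (Rintegral_dominated (g := \1_(nbox k))) => //.
  + move=> n; apply: measurable_funX; apply: measurable_funB; apply: measurable_indic;
      exact: measurableI.
  + apply: aeW => x; apply: cvg_near_cst.
    have [[i _ Fx]|nx] := pselect ((\bigcup_k F k) x).
      near=> n; rewrite !indicE !in_setI [x \in \bigcup_k F k]mem_set; last by exists i.
      rewrite [x \in G n]mem_set ?subrr ?expr0n//.
      by exists i => //=; near: n; exact: nbhs_infty_gt.
    near=> n; rewrite !indicE !in_setI memNset//= memNset//= ?subrr ?expr0n//.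
    by move=> [i _ Fx]; apply: nx; exists i.
  + apply: aeW => x n; rewrite !indicE !in_setI; case: (x \in nbox k); rewrite ?andbF ?andbT.
      by do 2 case: (_ \in _); rewrite ?subrr ?subr0 ?sub0r ?expr0n ?sqrrN ?expr1n ?normr0 ?normr1.
    by rewrite subrr expr0n normr0.
Unshelve. all: end_near. Qed.

Lemma wconv_ge0 g : sqi mu g -> (forall x, 0 <= g x) -> wconv f g.
Proof.
move=> g2 g0; have [mg gi] := g2.
have mEg : measurable_fun setT (EFin \o g) by exact/measurable_EFinP.
pose s n := nnsfun_approx measurableT mEg n.
have sg n (x : E) : 0 <= s n x <= g x.
  apply/andP; split; first exact: fun_ge0.
  rewrite -lee_fin /s nnsfun_approxE.
  by apply: le_approx => // t _; rewrite lee_fin.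
have ms n : measurable_fun setT (s n) by exact: measurable_funP.
(* Truncation puts the level sets inside a box, as [wconv_indic_box] demands; 0 <= g_ n <= g gives
   the domination of (g - g_ n) ^ 2 by g ^ 2. *)
pose g_ n (x : E) : R := s n x * \1_(nbox n) x.
have mg_ n : measurable_fun setT (g_ n).
  by apply: measurable_funM => //; apply: measurable_indic.
have g_g n x : 0 <= g_ n x <= g x.
  have /andP[s0 sg'] := sg n x; rewrite /g_ indicE.
  by case: (x \in _); rewrite ?mulr1 ?mulr0 ?s0 ?sg' ?lexx ?g0.
have g_2 n : sqi mu (g_ n).
  by apply: sqi_le (mg_ n) g2 _ => x; have /andP[h1 h2] := g_g n x; rewrite !ger0_norm.
apply: (@wconv_lim _ _ _ f2 _ g_) => //.
  move=> n; pose A (c : R) : set E := s n @^-1` [set c].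
  have mA c : measurable (A c).
    by rewrite /A -[X in measurable X]setTI; exact: ms.
  have [_] := @wconv_sum _ _ _ f2 _ (finmap.enum_fset (fset_set (range (s n))))
    (fun c x => c * \1_(A c `&` nbox n) x)
    (fun c => sqiZ c (nbox_sqi n (mA c)))
    (fun c => @wconvZ _ _ _ f2 c _ (nbox_sqi n (mA c)) (@wconv_indic_box n _ (mA c))).
  rewrite (_ : (fun x => _) = g_ n)//; apply/funext => x.
  rewrite /g_ (fimfunE (s n)) fsbig_finite//= big_distrl /=; apply: eq_bigr => c _.
  by rewrite indicI mulrA.
rewrite [X in _ --> X](_ : _ = \int[mu]_x (0 : R)); last by rewrite Rintegral_cst// mul0r.
apply: (Rintegral_dominated (g := fun x => g x ^+ 2)) => //.
- by move=> n; apply: measurable_funX; exact: measurable_funB.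
- apply: aeW => x; rewrite [X in _ --> X](_ : _ = (g x - g x * 1) ^+ 2); last first.
    by rewrite mulr1 subrr expr0n.
  apply: (cvg_comp (fun n => g x - g_ n x) (fun y : R => y ^+ 2)); last first.
    exact: sqr_continuous.
  apply: cvgB; first exact: cvg_cst.
  apply: cvgM.
    have := cvg_nnsfun_approx measurableT mEg (fun x _ => g0 x) (I : setT x).
    exact: fine_cvg.
  have [N HN] := coord_bound x.
  apply: cvg_near_cst; near=> n; rewrite indicE mem_set// => i.
  rewrite -ltr_norml (lt_le_trans (HN i))// ler_nat.
  by near: n; exact: nbhs_infty_ge.
- apply: aeW => x n; have /andP[h1 h2] := g_g n x.
  rewrite ger0_norm ?sqr_ge0// lerXn2r ?nnegrE ?subr_ge0//.
  by rewrite gerBl.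
Unshelve. all: end_near. Qed.

Lemma wconv_sqi g : sqi mu g -> wconv f g.
Proof.
have pos h : sqi mu h -> sqi mu (fun x => Num.max (h x) 0).
  move=> h2; apply: (sqi_le _ h2) => [|x]; last first.
    by rewrite /Num.max; case: ifP => _; rewrite ?normr0.
  by apply: measurable_maxr => //; exact: h2.1.
have pos_ge0 h x : 0 <= Num.max (h x) 0 :> R by rewrite le_max lexx orbT.
move=> g2; have n2 := pos _ (sqiZ (-1) g2).
have -> : g = fun x => Num.max (g x) 0 - Num.max (-1 * g x) 0.
  apply/funext => x; rewrite mulN1r; have [gx|gx] := ltP (g x) 0.
    by rewrite max_l ?oppr_ge0 ?(ltW gx)// opprK add0r.
  by rewrite max_r ?oppr_le0// subr0.
by apply: wconvB => //; [exact: pos|apply: wconv_ge0|apply: wconv_ge0] => //; exact: pos.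
Qed.

End weak_convergence_L2.

(** * Charges with a density *)

Section density_measure.
Context dd (T : measurableType dd) (R : realType).
Variables (mu : {sigma_finite_measure set T -> \bar R}) (v : T -> R).
Hypotheses (iv : itg mu v) (v0 : forall x, 0 <= v x).

(** The proofs of integrability and positivity are arguments, so that the measure instances can be
    attached to this constant. *)
Definition dens (i : itg mu v) (h : forall x, 0 <= v x) : set T -> \bar R :=
  fun A => (\int[mu]_(x in A) (v x)%:E)%E.
Local Notation nu := (dens iv v0).

Let nu0 : nu set0 = 0%E. Proof. exact: integral_set0. Qed.

Let nu_ge0 A : (0 <= nu A)%E.
Proof. by apply: integral_ge0 => x _; rewrite lee_fin. Qed.

Let nu_sigma : semi_sigma_additive nu.
Proof.
apply: semi_sigma_additive_nng_induced.
  exact: measurable_int iv.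
by move=> x; rewrite lee_fin.
Qed.

HB.instance Definition _ := isMeasure.Build _ _ _ nu nu0 nu_ge0 nu_sigma.

Let nu_fin : fin_num_fun nu.
Proof.
by move=> A mA; apply: integrable_fin_num => //; exact: integrableS iv.
Qed.

HB.instance Definition _ := Measure_isFinite.Build _ _ _ nu nu_fin.

Lemma Rintegral_dens g : itg nu g ->
  itg mu (fun x => g x * v x) /\ \int[nu]_x g x = \int[mu]_x (g x * v x).
Proof.
move=> gi; have mg := itg_measurable gi.
pose M : {finite_measure set T -> \bar R} := nu.
have numu : M `<< mu.
  apply/null_content_dominatesP => A mA A0; apply: null_set_integral => //.
  by apply: measurable_funTS; exact: measurable_int iv.
(* Identifying [v] with the Radon-Nikodym derivative gives access to its change of variables
   formula. *)
have RNv : ae_eq mu setT (Radon_Nikodym_SigmaFinite.f M mu) (EFin \o v).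
  apply: integral_ae_eq => //.
  - exact: Radon_Nikodym_SigmaFinite.f_integrable.
  - exact: measurable_int iv.
  - by move=> A _ mA; rewrite -Radon_Nikodym_SigmaFinite.f_integral.
have mRN : measurable_fun setT (Radon_Nikodym_SigmaFinite.f M mu).
  exact: measurable_int (Radon_Nikodym_SigmaFinite.f_integrable numu).
have mv := itg_measurable iv.
have chg h : (forall x, 0 <= h x)%E -> measurable_fun setT h ->
    (\int[nu]_x h x = \int[mu]_x (h x * (v x)%:E))%E.
  move=> h0 mh; rewrite -(Radon_Nikodym_SigmaFinite.change_of_variables numu h0)//.
  apply: ae_eq_integral => //.
  - exact: emeasurable_funM.
  - by apply: emeasurable_funM => //; exact/measurable_EFinP.
  - by apply: filterS RNv => x /= -> .
have gvi : itg mu (fun x => g x * v x).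
  apply/integrableP; split; first exact/measurable_EFinP/measurable_funM.
  case/integrableP : gi => _; rewrite chg//; last first.
    by apply: measurableT_comp => //; exact/measurable_EFinP.
  apply: le_lt_trans; rewrite le_eqVlt; apply/orP; left; apply/eqP.
  by apply: eq_integral => x _; rewrite /= normrM (ger0_norm (v0 x)) EFinM.
split => //; congr fine; rewrite [LHS]integralE [RHS]integralE; congr (_ - _)%E.
  rewrite chg//; last by apply: measurable_funepos; exact/measurable_EFinP.
  apply: eq_integral => x _; rewrite !funeposE /=.
  by rewrite -!EFin_max -EFinM maxr_pMl// mul0r.
rewrite chg//; last by apply: measurable_funeneg; exact/measurable_EFinP.
apply: eq_integral => x _; rewrite !funenegE /=.
by rewrite -!EFin_max -EFinM maxr_pMl// mul0r mulNr.
Qed.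

End density_measure.

Section itg_measure.
Context dd (T : measurableType dd) (R : realType).
Implicit Types m : {measure set T -> \bar R}.

Lemma itg_measure_add m1 m2 (g : T -> R) : itg m1 g -> itg m2 g ->
  itg (measure_add m1 m2) g.
Proof.
move=> g1 g2; have mg := itg_measurable g1.
apply/integrableP; split; first exact/measurable_EFinP.
case/integrableP : g1 => _ h1; case/integrableP : g2 => _ h2.
rewrite ge0_integral_measure_add//; first exact: lte_add_pinfty.
by apply: measurableT_comp => //; exact/measurable_EFinP.
Qed.

Lemma itg_measure_le m1 m2 (g : T -> R) :
  (forall A, measurable A -> (m1 A <= m2 A)%E) -> itg m2 g -> itg m1 g.
Proof.
move=> m12 /integrableP[mg h]; apply/integrableP; split => //.
apply: le_lt_trans h; apply: ge0_le_measure_integral => //.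
exact: measurableT_comp.
Qed.

End itg_measure.

Section charge_density.
Context dd (T : measurableType dd) (R : realType).
Variables (mu : {sigma_finite_measure set T -> \bar R}).
Variables (nu1 nu2 : {charge set T -> \bar R}) (w : T -> R).
Hypothesis mw : measurable_fun setT w.
Hypothesis nuw : forall A, measurable A ->
  (nu1 A - nu2 A = \int[mu]_(x in A) (w x)%:E)%E.

Let wp x := Num.max (w x) 0.
Let wn x := Num.max (- w x) 0.

Let wpn x : w x = wp x - wn x.
Proof.
rewrite /wp /wn; have [wx|wx] := ltP (w x) 0.
  by rewrite max_l ?oppr_ge0 ?(ltW wx)// opprK add0r.
by rewrite max_r ?oppr_le0// subr0.
Qed.

Let wp0 x : 0 <= wp x. Proof. by rewrite le_max lexx orbT. Qed.
Let wn0 x : 0 <= wn x. Proof. by rewrite le_max lexx orbT. Qed.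

Let mwp : measurable_fun setT wp. Proof. exact: measurable_maxr. Qed.
Let mwn : measurable_fun setT wn.
Proof.
apply: measurable_maxr => //.
have -> : (fun x => - w x) = (fun x => -1 * w x) by apply/funext => x; rewrite mulN1r.
exact: measurable_funM.
Qed.

Let fin_nu A : measurable A -> (nu1 A - nu2 A)%E \is a fin_num.
Proof. by move=> mA; rewrite fin_numB !fin_num_measure. Qed.

Let P : set T := [set x | 0 <= w x].
Let mP : measurable P.
Proof.
have := measurable_fun_ler (measurable_cst (0 : R)) mw.
by move=> /(_ measurableT [set true]); rewrite setTI; apply.
Qed.

(** Charges take finite values, so evaluating the identity on the set where w >= 0 and on its
    complement bounds the integrals of both parts of [w]. *)
Lemma charge_density_itg : itg mu w.
Proof.
have wpi : itg mu wp.
  apply/integrableP; split; first exact/measurable_EFinP.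
  have : (\int[mu]_(x in P) (w x)%:E)%E \is a fin_num by rewrite -nuw// fin_nu.
  rewrite integral_mkcond ge0_fin_numE; last first.
    by apply: integral_ge0 => x _; rewrite /patch; case: ifPn => //; rewrite inE lee_fin.
  apply: le_lt_trans; rewrite le_eqVlt; apply/orP; left; apply/eqP.
  apply: eq_integral => x _; rewrite /= ger0_norm// /patch; case: ifPn; rewrite ?inE ?notin_setE /P /=.
    by move=> wx; rewrite /wp max_l.
  by move/negP; rewrite -ltNge => wx; rewrite /wp max_r// ltW.
have wni : itg mu wn.
  apply/integrableP; split; first exact/measurable_EFinP.
  have mPC : measurable (~` P) by exact: measurableC.
  have : (\int[mu]_(x in ~` P) (w x)%:E)%E \is a fin_num by rewrite -nuw// fin_nu.
  have -> : (\int[mu]_(x in ~` P) (w x)%:E = - \int[mu]_x (wn x)%:E)%E.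
    rewrite integral_mkcond -integral_ge0N//; last by move=> x _; rewrite lee_fin.
    apply: eq_integral => x _; rewrite /patch in_setC; case: (boolP (x \in P)); rewrite ?inE ?notin_setE /P /=.
      by move=> wx; rewrite /wn max_r ?oppr_le0// oppr0.
    by move/negP; rewrite -ltNge => wx; rewrite /wn max_l ?oppr_ge0 ?(ltW wx)// opprK.
  rewrite fin_numN ge0_fin_numE; last by apply: integral_ge0 => x _; rewrite lee_fin.
  apply: le_lt_trans; rewrite le_eqVlt; apply/orP; left; apply/eqP.
  by apply: eq_integral => x _; rewrite /= ger0_norm.
have -> : w = fun x => wp x - wn x by apply/funext.
exact: itgB.
Qed.

(** The Jordan parts of the two charges bear no relation to the signs of [w]. The identity is
    therefore rearranged into an equality of sums of positive measures, p1 + n2 + Wn = p2 + n1 + Wp,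
    against which [g] is integrated. *)
Lemma cint_density g : cintegrable nu1 g -> cintegrable nu2 g ->
  itg mu (fun x => g x * w x) /\
  cint nu1 g - cint nu2 g = \int[mu]_x (g x * w x).
Proof.
move=> [gp1 gn1] [gp2 gn2]; have wi := charge_density_itg.
have wpi : itg mu wp.
  by apply: (itg_le mwp (itg_abs wi)) => x; rewrite ger0_norm// ge_max ler_norm normr_ge0.
have wni : itg mu wn.
  apply: (itg_le mwn (itg_abs wi)) => x; rewrite ger0_norm// ge_max normr_ge0 andbT.
  by rewrite -normrN ler_norm.
have mg := itg_measurable gp1.
pose p1 : {finite_measure set T -> \bar R} := jordan_pos (projT2 (hahn_choice nu1)).
pose n1 : {finite_measure set T -> \bar R} := jordan_neg (projT2 (hahn_choice nu1)).
pose p2 : {finite_measure set T -> \bar R} := jordan_pos (projT2 (hahn_choice nu2)).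
pose n2 : {finite_measure set T -> \bar R} := jordan_neg (projT2 (hahn_choice nu2)).
pose Wp : {finite_measure set T -> \bar R} := dens wpi wp0.
pose Wn : {finite_measure set T -> \bar R} := dens wni wn0.
have fE (m : {finite_measure set T -> \bar R}) A : measurable A -> m A = (fine (m A))%:E.
  by move=> mA; rewrite fineK// fin_num_measure.
have jordan (nu : {charge set T -> \bar R}) A : measurable A ->
    nu A = (jordan_pos (projT2 (hahn_choice nu)) A -
            jordan_neg (projT2 (hahn_choice nu)) A)%E.
  move=> mA; rewrite (jordan_decomp (projT2 (hahn_choice nu)))// /cadd /= /cscale.
  by rewrite mulN1e.
have Wpn A : measurable A -> (Wp A - Wn A = \int[mu]_(x in A) (w x)%:E)%E.
  move=> mA; rewrite /= /dens -integralB_EFin//; first by apply: eq_integral => x _; rewrite wpn EFinB.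
    exact: (integrableS measurableT mA (@subsetT _ _) wpi).
  exact: (integrableS measurableT mA (@subsetT _ _) wni).
have I1 A : measurable A -> (p1 A + (n2 A + Wn A) = p2 A + (n1 A + Wp A))%E.
  move=> mA; have := nuw mA; rewrite -Wpn//.
  have -> : nu1 A = (p1 A - n1 A)%E by exact: jordan.
  have -> : nu2 A = (p2 A - n2 A)%E by exact: jordan.
  rewrite (fE p1 A mA) (fE p2 A mA) (fE n1 A mA) (fE n2 A mA) (fE Wp A mA) (fE Wn A mA).
  rewrite -!EFinB -!EFinD => -[] h; congr EFin; move: h.
  move: (fine _) (fine _) (fine _) (fine _) (fine _) (fine _) => a b c d e f h; lra.
have mPC : measurable (~` P) by exact: measurableC.
have wpP x : ~ P x -> wp x = 0.
  by move=> /negP; rewrite -ltNge => wx; rewrite /wp max_r// ltW.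
have wnP x : P x -> wn x = 0.
  by rewrite /P /= => wx; rewrite /wn max_r// oppr_le0.
have Wpr A B : measurable A -> measurable B -> (forall x, ~ B x -> wp x = 0) ->
    Wp (A `&` B) = Wp A.
  move=> mA mB wB; rewrite /= /dens integral_mkcondr; apply: eq_integral => x _.
  by rewrite /patch; case: ifPn => //; rewrite notin_setE => /wB ->.
have Wnr A B : measurable A -> measurable B -> (forall x, ~ B x -> wn x = 0) ->
    Wn (A `&` B) = Wn A.
  move=> mA mB wB; rewrite /= /dens integral_mkcondr; apply: eq_integral => x _.
  by rewrite /patch; case: ifPn => //; rewrite notin_setE => /wB ->.
(* [Wp] is carried by the set [P], where [Wn] vanishes; there the identity bounds [Wp] by p1 + n2,
   against which [g] is integrable. *)
have gWp : itg Wp g.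
  apply: (itg_measure_le (m2 := measure_add p1 n2)); last exact: itg_measure_add.
  move=> A mA; rewrite [leRHS](measure_addE p1 n2 A).
  rewrite [leLHS](esym (Wpr A P mA mP wpP)).
  have mAP := measurableI _ _ mA mP.
  have := I1 _ mAP; rewrite [Wn _](_ : _ = 0%E) ?adde0; last first.
    by apply: integral0_eq => x [_ /wnP ->].
  move=> e; apply: (@le_trans _ _ (p1 (A `&` P) + n2 (A `&` P)))%E.
    by rewrite e addeA leeDr// adde_ge0.
  by apply: leeD; apply: le_measure; rewrite ?inE.
have gWn : itg Wn g.
  apply: (itg_measure_le (m2 := measure_add p2 n1)); last exact: itg_measure_add.
  move=> A mA; rewrite [leRHS](measure_addE p2 n1 A).
  rewrite [leLHS](esym (Wnr A (~` P) mA mPC _)); last by move=> x /contrapT /wnP.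
  have mAP := measurableI _ _ mA mPC.
  have := I1 _ mAP; rewrite [Wp _](_ : _ = 0%E) ?adde0; last first.
    by apply: integral0_eq => x [_ /wpP ->].
  move=> e; apply: (@le_trans _ _ (p2 (A `&` ~` P) + n1 (A `&` ~` P)))%E.
    by rewrite -e addeA leeDr// adde_ge0.
  by apply: leeD; apply: le_measure; rewrite ?inE.
have S1 : (\int[p1]_x (g x)%:E + (\int[n2]_x (g x)%:E + \int[Wn]_x (g x)%:E) =
   \int[p2]_x (g x)%:E + (\int[n1]_x (g x)%:E + \int[Wp]_x (g x)%:E))%E.
  have s1 := integral_measure_add measurableT gn2 gWn.
  have s2 := integral_measure_add measurableT gp1 (itg_measure_add gn2 gWn).
  have s3 := integral_measure_add measurableT gn1 gWp.
  have s4 := integral_measure_add measurableT gp2 (itg_measure_add gn1 gWp).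
  rewrite s1 in s2; rewrite s3 in s4.
  apply: (etrans (esym s2)); apply: (etrans _ s4).
  apply: eq_measure_integral => A mA _.
  rewrite [LHS](measure_addE p1 (measure_add n2 Wn) A).
  rewrite [X in (_ + X)%E](measure_addE n2 Wn A).
  rewrite [RHS](measure_addE p2 (measure_add n1 Wp) A).
  by rewrite [X in _ = (_ + X)%E](measure_addE n1 Wp A); exact: I1.
have [h1 e1] := Rintegral_dens gWp; have [h2 e2] := Rintegral_dens gWn.
have -> : (fun x => g x * w x) = fun x => g x * wp x - g x * wn x.
  by apply/funext => x; rewrite wpn mulrBr.
split; first exact: itgB.
rewrite RintegralB// -e1 -e2 /cint.
move: S1; rewrite !EFin_Rintegral// -!EFinD => -[] S1.
rewrite -[Rintegral (cpos nu1) _ _]/(\int[p1]_x g x).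
rewrite -[Rintegral (cneg nu1) _ _]/(\int[n1]_x g x).
rewrite -[Rintegral (cpos nu2) _ _]/(\int[p2]_x g x).
rewrite -[Rintegral (cneg nu2) _ _]/(\int[n2]_x g x).
lra.
Qed.

End charge_density.

(** * Uniform boundedness *)

(* Sokal's gliding hump: from functionals of norms growing like
   4^n one builds a series of humps of size 3^-n on which they are unbounded. *)
Section uniform_boundedness.
Context {R : realType} {d : nat}.
Local Notation E := 'rV[R]_d.
Variables (I : Type) (L : I -> (E -> R) -> R).
Hypothesis LD : forall i f g, bcontinuous f -> bcontinuous g ->
  L i (fun x => f x + g x) = L i f + L i g.
Hypothesis LZ : forall i c f, bcontinuous f -> L i (fun x => c * f x) = c * L i f.
Hypothesis Lb : forall i, exists C : R, forall f, bcontinuous f ->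
  (forall x, `|f x| <= 1) -> `|L i f| <= C.
Hypothesis Lp : forall f, bcontinuous f -> exists C : R, forall i, `|L i f| <= C.

Lemma bcontinuousD (f g : E -> R) : bcontinuous f -> bcontinuous g ->
  bcontinuous (fun x => f x + g x).
Proof.
move=> [cf [M HM]] [cg [N HN]]; split.
  by move=> x; exact: (cvgD (cf x) (cg x)).
by exists (M + N) => x; rewrite (le_trans (ler_normD _ _))// lerD.
Qed.

Lemma bcontinuousZ c (f : E -> R) : bcontinuous f -> bcontinuous (fun x => c * f x).
Proof.
move=> [cf [M HM]]; split.
  by move=> x; exact: (cvgM (cvg_cst c) (cf x)).
by exists (`|c| * M) => x; rewrite normrM ler_wpM2l.
Qed.

Let subE (f g : E -> R) : (fun x => f x - g x) = fun x => f x + (-1) * g x.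
Proof. by apply/funext => x; rewrite mulN1r. Qed.

Lemma bcontinuousB (f g : E -> R) : bcontinuous f -> bcontinuous g ->
  bcontinuous (fun x => f x - g x).
Proof.
by move=> cf cg; rewrite subE; apply: bcontinuousD => //; exact: bcontinuousZ.
Qed.

Let LB i f g : bcontinuous f -> bcontinuous g ->
  L i (fun x => f x - g x) = L i f - L i g.
Proof.
by move=> cf cg; rewrite subE LD ?LZ ?mulN1r//; exact: bcontinuousZ.
Qed.

Let vals i : set R := [set r | exists2 f, bcontinuous f /\ (forall x, `|f x| <= 1) & r = `|L i f|].
Let norm i : R := sup (vals i).

Let bcont0 : bcontinuous (fun _ : E => 0 : R).
Proof. by split; [exact: cst_continuous|exists 0 => x; rewrite normr0]. Qed.

Let has_sup_vals i : has_sup (vals i).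
Proof.
split; first by exists `|L i (fun=> 0)|, (fun=> 0) => //; split => // x; rewrite normr0.
by have [C HC] := Lb i; exists C => _ [f [cf f1] ->]; exact: HC.
Qed.

Let norm_ub i f r : 0 < r -> bcontinuous f -> (forall x, `|f x| <= r) ->
  `|L i f| <= norm i * r.
Proof.
move=> r0 cf fr; rewrite -ler_pdivrMr// -[r^-1]gtr0_norm ?invr_gt0//.
rewrite -normrM mulrC -LZ//.
apply: sup_upper_bound; first exact: has_sup_vals.
exists (fun x => r^-1 * f x) => //; split; first exact: bcontinuousZ.
move=> x; rewrite normrM gtr0_norm ?invr_gt0// mulrC ler_pdivrMr// mul1r.
exact: fr.
Qed.

Let near_norm i : 0 < norm i -> exists f, [/\ bcontinuous f, forall x, `|f x| <= 1 &
  2 / 3 * norm i <= `|L i f|].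
Proof.
move=> n0; have e0 : 0 < norm i / 3 by rewrite divr_gt0.
have [_ [f [cf f1] ->] h] := sup_adherent e0 (has_sup_vals i).
exists f; split => //; apply: ltW; apply: le_lt_trans h.
rewrite -/(norm i); lra.
Qed.

Theorem uniform_boundedness : exists2 M : R, 0 < M & forall i f, bcontinuous f ->
  (forall x, `|f x| <= 1) -> `|L i f| <= M.
Proof.
have [[M HM]|] := pselect (exists M, forall i, norm i <= M).
  exists (`|M| + 1); first by rewrite ltr_wpDl.
  move=> i f cf f1; apply: le_trans (norm_ub i ltr01 cf f1) _.
  by rewrite mulr1 (le_trans (HM i))// (le_trans (ler_norm M))// lerDl.
move=> /forallNP unb; exfalso.
have ex_i n : exists i, 4 ^+ n <= norm i.
  have /existsNP[i /negP] := unb (4 ^+ n); rewrite -ltNge => /ltW h; by exists i.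
have /choice[i_ Hi] := ex_i.
have n0 n : 0 < norm (i_ n) by apply: lt_le_trans (Hi n); rewrite exprn_gt0.
have /choice[h_ Hh] : forall n, exists f, [/\ bcontinuous f, forall x, `|f x| <= 1 &
  2 / 3 * norm (i_ n) <= `|L (i_ n) f|] by move=> n; exact: near_norm.
pose g n : E -> R := fun x => 3 ^- n * h_ n x.
have cg n : bcontinuous (g n) by apply: bcontinuousZ; have [] := Hh n.
have p3 n : 0 < 3 ^- n :> R by rewrite invr_gt0 exprn_gt0.
have gb n x : `|g n x| <= 3 ^- n.
  rewrite /g normrM gtr0_norm// ler_piMr ?(ltW (p3 n))//.
  by have [_ + _] := Hh n; apply.
(* The sign of each hump is chosen so that the functional keeps at least its value on the hump: the
   two candidates differ by twice the hump, so one of them is good. *)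
pose xs := fix xs (n : nat) : E -> R := if n is m.+1 then
  if `|L (i_ n) (g n)| <= `|L (i_ n) (fun x => xs m x + g n x)|
  then fun x => xs m x + g n x else fun x => xs m x - g n x else fun=> 0.
have cxs n : bcontinuous (xs n).
  by elim: n => [|n IH] //=; case: ifP => _; [exact: bcontinuousD|exact: bcontinuousB].
have dxs n x : `|xs n.+1 x - xs n x| <= 3 ^- n.+1.
  by rewrite /=; case: ifP => _; rewrite addrAC subrr add0r ?normrN; exact: gb.
have Lxs n : 3 ^- n.+1 * (2 / 3 * norm (i_ n.+1)) <= `|L (i_ n.+1) (xs n.+1)|.
  apply: (@le_trans _ _ `|L (i_ n.+1) (g n.+1)|).
    rewrite /g LZ; last by have [] := Hh n.+1.
    by rewrite normrM gtr0_norm// ler_wpM2l ?(ltW (p3 _))//; have [] := Hh n.+1.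
  rewrite /=; case: ifPn => //; rewrite -ltNge LD// LB// => h.
  have := ler_normB (L (i_ n.+1) (xs n) + L (i_ n.+1) (g n.+1)) 
    (L (i_ n.+1) (xs n) - L (i_ n.+1) (g n.+1)).
  rewrite [X in `|X|](_ : _ = 2 * L (i_ n.+1) (g n.+1)); last by ring.
  rewrite normrM ger0_norm//; move: h.
  move: `|_| `|_| `|_| => a b c; lra.
have e3 n : 3 ^- n = 3 * 3 ^- n.+1 :> R.
  by rewrite exprS invfM mulrA divff ?mul1r// pnatr_eq0.
(* 3^-n / 2 is the sum of all later hump sizes. Adding it makes the sequence nonincreasing,
   subtracting it nondecreasing, so convergence with rate comes from monotonicity. *)
pose ys x n : R := xs n x + 3 ^- n / 2.
have ys_ni x : nonincreasing_seq (ys x).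
  apply/nonincreasing_seqP => n; rewrite /ys.
  have := dxs n x; rewrite ler_distl => /andP[_ h].
  have := e3 n; move: h; move: (xs n.+1 x) (xs n x) (3 ^- n) (3 ^- n.+1) => a b c e.
  by move=> h1 h2; lra.
have ys_lb x n m : (n <= m)%N -> xs n x - 3 ^- n / 2 <= xs m x - 3 ^- m / 2.
  elim: m => [|m IH]; first by rewrite leqn0 => /eqP ->.
  rewrite leq_eqVlt => /predU1P[->//|]; rewrite ltnS => /IH /le_trans; apply.
  have := dxs m x; rewrite ler_distl => /andP[h _].
  have := e3 m; move: h; move: (xs m.+1 x) (xs m x) (3 ^- m) (3 ^- m.+1) => a b c e.
  by move=> h1 h2; lra.
have ys_lb' x n m : xs n x - 3 ^- n / 2 <= ys x m.
  have [nm|mn] := leqP n m.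
    apply: le_trans (ys_lb x _ _ nm) _; rewrite /ys lerD2l.
    by have := p3 m; lra.
  apply: le_trans (ys_ni x _ _ (ltnW mn)); rewrite /ys lerD2l.
  by have := p3 n; lra.
have ys_cvg x : cvgn (ys x).
  apply: nonincreasing_is_cvgn => //.
  by exists (xs 0%N x - 3 ^- 0 / 2) => _ [m _ <-]; exact: ys_lb'.
pose X x := limn (ys x).
have Xxs n x : `|X x - xs n x| <= 3 ^- n / 2.
  rewrite ler_distl; apply/andP; split.
    apply: limr_ge => //; apply: nearW => m; exact: ys_lb'.
  exact: (nonincreasing_cvgn_ge (ys_ni x) (ys_cvg x) n).
have c3 : 3 ^- n @[n --> \oo] --> (0 : R).
  have -> : (fun n => 3 ^- n) = GRing.exp (3^-1 : R).
    by apply/funext => n; rewrite exprVn.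
  by apply: cvg_expr; rewrite ger0_norm ?invr_ge0// invf_lt1// ltr1n.
have cX : bcontinuous X.
  split; last first.
    exists (3 ^- 0 / 2) => x; have := Xxs 0%N x; by rewrite subr0.
  move=> x0; apply/(@cvgrPdist_le _ _ _ (nbhs x0)) => eps eps0.
  have e20 : 0 < eps / 2 by rewrite divr_gt0.
  have /cvgrPdist_le/(_ _ e20)[n _ /(_ n (leqnn n))] := c3.
  rewrite sub0r normrN gtr0_norm// => hn.
  have [cn _] := cxs n; have /(@cvgrPdist_le _ _ _ (nbhs x0))/(_ _ e20) := cn x0.
  apply: filterS => x hx.
  rewrite [X in `|X|](_ : _ = (X x0 - xs n x0) + (xs n x0 - xs n x) - (X x - xs n x)); last by ring.
  apply: le_trans (ler_normB _ _) _; apply: le_trans (lerD (ler_normD _ _) (lexx _)) _.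
  have := Xxs n x0; have := Xxs n x; move: hx hn.
  move: `|_| `|_| `|_| => a b c; lra.
have [C HC] := Lp cX.
(* The hump contributes 2/3 of the norm times 3^-(n+1) and the tail costs at most 1/2 of it; the
   remaining 1/6 still grows, as the norms exceed 4^(n+1). *)
have LX n : (4 / 3) ^+ n.+1 / 6 <= C.
  apply: le_trans (HC (i_ n.+1)).
  have h1 := Lxs n.
  have h2 : `|L (i_ n.+1) X - L (i_ n.+1) (xs n.+1)| <= norm (i_ n.+1) * (3 ^- n.+1 / 2).
    rewrite -LB//; apply: norm_ub.
    - by rewrite divr_gt0.
    - exact: bcontinuousB.
    - exact: Xxs.
  have h3 : 3 ^- n.+1 * norm (i_ n.+1) / 6 <= `|L (i_ n.+1) X|.
    have := ler_normB (L (i_ n.+1) X) (L (i_ n.+1) X - L (i_ n.+1) (xs n.+1)).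
    rewrite opprB addrC subrK; move: h1 h2.
    move: `|_| `|_| `|_| => a b c; move: (norm _) (3 ^- n.+1) => u v h1 h2 h3; nra.
  apply: le_trans h3; rewrite ler_pM2r// exprMn exprVn mulrC ler_wpM2l ?(ltW (p3 _))//.
have C6 : 0 < (6 * (`|C| + 1))^-1 by rewrite invr_gt0 mulr_gt0// ltr_wpDl.
have q1 : `|3 / 4 : R| < 1 by rewrite ger0_norm//; lra.
have /cvgrPdist_lt/(_ _ C6)[n _ /(_ n.+1 (leqnSn n))] := cvg_expr q1.
rewrite sub0r normrN gtr0_norm ?exprn_gt0 ?divr_gt0//.
have q0 : 0 < (4 / 3) ^+ n.+1 :> R by rewrite exprn_gt0// divr_gt0.
rewrite -(ltr_pM2l q0) -exprMn (_ : 4 / 3 * (3 / 4) = 1 :> R) ?expr1n; last by field.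
rewrite ltr_pdivlMr ?mul1r; last by rewrite mulr_gt0// ltr_wpDl.
have := LX n; have := ler_norm C; move: ((4 / 3) ^+ n.+1) `|C| => a b; lra.
Qed.

End uniform_boundedness.

(** * The energy identity *)

Section negativity_indicator.
Context {R : realType}.

(** Time cut-offs are factors of the integrand rather than domains of integration, so that Fubini
    and symmetrisation apply on the whole space. *)
Definition le0i (t : R) : R := \1_(`]-oo, 0%R]%classic) t.

Lemma le0iE t : le0i t = (t <= 0)%R%:R.
Proof. by rewrite /le0i indicE; congr (nat_of_bool _)%:R; rewrite mem_setE in_itv. Qed.

Lemma measurable_le0i dd (T : measurableType dd) (f : T -> R) :
  measurable_fun setT f -> measurable_fun setT (fun t => le0i (f t)).
Proof.
by move=> mf; apply: (measurableT_comp (f := le0i)) => //; exact: measurable_indic.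
Qed.

Lemma le0i_ge0 t : 0 <= le0i t. Proof. by rewrite le0iE. Qed.

Lemma le0i_le1 t : le0i t <= 1. Proof. by rewrite le0iE; case: (t <= 0); rewrite ?lexx ?ler01. Qed.

End negativity_indicator.

(* By Fubini the integral is [int_z (int_p phi p z) ^+ 2]. *)
Lemma feature_ge0 d1 d2 (X : measurableType d1) (Z : measurableType d2)
  (R : realType) (m : {sigma_finite_measure set X -> \bar R})
  (n : {sigma_finite_measure set Z -> \bar R}) (phi : X -> Z -> R) :
  measurable_fun setT (fun p => phi p.1 p.2) ->
  itg (prodm (prodm m m) n) (fun t => phi t.1.1 t.2 * phi t.1.2 t.2) ->
  0 <= \int[(prodm m m)]_p \int[n]_z (phi p.1 z * phi p.2 z).
Proof.
move=> mphi ii; have [_ e1] := Rfubini1 ii; have [i2 e2] := Rfubini2 ii.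
rewrite -e1 e2.
have ae0 : {ae n, forall z, 0 <= \int[(prodm m m)]_p (phi p.1 z * phi p.2 z)}.
  have := itg_prod2_ae ii; apply: filterS => z /= iz.
  have mz : measurable_fun setT (fun p => phi p z).
    by have := measurableT_comp mphi (pair2_measurable z).
  (* Only products of two values of [phi] are known to be integrable. If [phi p z] is nonzero for
     some [p] with integrable row, dividing by it makes the section integrable; otherwise the
     section vanishes almost everywhere. *)
  suff [phi1 | phi0] : itg m (fun p => phi p z) \/ {ae m, forall p, phi p z = 0}.
  - by have [_ ->] := itg_tensor phi1 phi1; rewrite -expr2 sqr_ge0.
  - have [phi1 _] := ae_eq_itg mz (filterS (fun x e => esym e) phi0) (integrable0 m setT).
    by have [_ ->] := itg_tensor phi1 phi1; rewrite -expr2 sqr_ge0.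
  have [|n1] := pselect (itg m (fun p => phi p z)); first by left.
  right; have := itg_prod1_ae iz; apply: filterS => p /= ip.
  apply: contrapT => /eqP p0; apply: n1.
  have := itgZ (phi p z)^-1 ip; apply: eq_integrable => // q _ /=.
  by congr EFin; rewrite mulrA mulVf// mul1r.
have mI := itg_measurable i2.
have [iM ->] := ae_eq_itg (g := fun z => Num.max (\int[(prodm m m)]_p (phi p.1 z * phi p.2 z)) 0)
  (measurable_maxr mI (measurable_cst _))
  (filterS (fun z (h : 0 <= _) => esym (max_l h)) ae0) i2.
by apply: Rintegral_ge0 => z _; rewrite le_max lexx orbT.
Qed.

Section quadratic_form.
Context {R : realType} {d : nat}.
Local Notation E := (d.-tuple R).
Local Notation X := (R * E)%type.
Local Notation mu := (prodm (@lebR R) (@leb R d)).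
Implicit Types (e t : R) (p q : X).

Lemma ae_fst_neq (c : R) : {ae mu, forall p, p.1 != c}.
Proof.
exists ([set c] `*` setT); split.
- exact: measurableX.
- rewrite [LHS](product_measure1E lebR (leb d))// [X in (X * _)%E](_ : _ = 0%E) ?mul0e//.
  exact: lebesgue_measure_set1.
- by move=> p /= /negP; rewrite negbK => /eqP.
Qed.

Variable f : X -> R.
Hypothesis mf : measurable_fun setT f.
Hypothesis H1 : forall e, 0 < e ->
  itg (prodm mu mu) (fun pq => `|f pq.1| * hk e pq.1.2 pq.2.2 * `|f pq.2|).

Let mf1 : measurable_fun [set: X * X] (fun pq => f pq.1).
Proof. exact: measurableT_comp. Qed.
Let mf2 : measurable_fun [set: X * X] (fun pq => f pq.2).
Proof. exact: measurableT_comp. Qed.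
Let mx1 : measurable_fun [set: X * X] (fun pq => pq.1.2).
Proof. exact: measurableT_comp. Qed.
Let mx2 : measurable_fun [set: X * X] (fun pq => pq.2.2).
Proof. exact: measurableT_comp. Qed.
Let ms1 : measurable_fun [set: X * X] (fun pq => pq.1.1).
Proof. exact: measurableT_comp. Qed.
Let ms2 : measurable_fun [set: X * X] (fun pq => pq.2.1).
Proof. exact: measurableT_comp. Qed.

Definition pairing e (pq : X * X) : R := f pq.1 * lap_hk e pq.1.2 pq.2.2 * f pq.2.

Lemma pairing_itg e (k : X * X -> R) : 0 < e -> measurable_fun setT k ->
  (forall pq, `|k pq| <= 1) -> itg (prodm mu mu) (fun pq => pairing e pq * k pq).
Proof.
move=> e0 mk k1; have [C C0 HC] := hk_bounds (d := d) e0 (lexx e).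
have e4 : 0 < 4 * e by rewrite mulr_gt0.
apply: (itg_le _ (itgZ C (H1 e4))) => [|pq].
  apply: measurable_funM => //; apply: measurable_funM => //.
  by apply: measurable_funM => //; exact: measurable_lap_hk.
have [_ _ h] := HC e pq.1.2 pq.2.2 (lexx _) (lexx _).
rewrite /pairing !normrM; apply: (@le_trans _ _
   (`|f pq.1| * `|lap_hk e pq.1.2 pq.2.2| * `|f pq.2|)).
  by rewrite ler_piMr ?k1// !mulr_ge0.
rewrite mulrA ler_wpM2r// mulrCA ler_wpM2l//.
Qed.

(* With [u = int_0^t f ds] and [K_e] the heat kernel this is
   [int u (Delta K_e * u) = - int |grad K_(e/2) * u| ^ 2]. *)
Definition quadform e t : R :=
  \int[(prodm mu mu)]_pq (pairing e pq * (le0i (pq.1.1 - t) * le0i (pq.2.1 - t))).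

(** By [lap_hk_conv] the kernel is minus a sum of Gram kernels with features [hk1 i (e / 2)], and
    each of these contributes a nonnegative integral. *)
Lemma quadform_le0 e t : 0 < e -> quadform e t <= 0.
Proof.
move=> e0; pose g p := f p * le0i (p.1 - t).
have mg : measurable_fun setT g.
  apply: measurable_funM => //; apply: measurable_le0i; exact: measurable_funB.
pose phi (i : 'I_d) p z := g p * hk1 i (e / 2) p.2 z.
have e20 : 0 < e / 2 by rewrite divr_gt0.
have [C C0 HC] := hk_bounds (d := d) e20 (lexx (e / 2)).
have e4 : 0 < 4 * e by rewrite mulr_gt0.
have mphi i : measurable_fun [set: X * E] (fun p : X * E => phi i p.1 p.2).
  apply: measurable_funM; first exact: measurableT_comp.
  by apply: measurable_hk1 => //; exact: measurableT_comp.
have gf p : `|g p| <= `|f p|.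
  by rewrite /g normrM ler_piMr// ger0_norm ?le0i_ge0// le0i_le1.
have phi_itg i : itg (prodm (prodm mu mu) (leb d)) (fun t : X * X * E => phi i t.1.1 t.2 * phi i t.1.2 t.2).
  have mphi2 : measurable_fun setT (fun t : (X * X) * E => phi i t.1.1 t.2 * phi i t.1.2 t.2).
    have m1 : measurable_fun [set: (X * X) * E] (fun t : X * X * E => (t.1.1, t.2)).
      by apply: measurable_fun_pair => //; exact: measurableT_comp.
    have m2 : measurable_fun [set: (X * X) * E] (fun t : X * X * E => (t.1.2, t.2)).
      by apply: measurable_fun_pair => //; exact: measurableT_comp.
    have := measurableT_comp (mphi i) m1; have := measurableT_comp (mphi i) m2.
    by move=> h2 h1; exact: measurable_funM h1 h2.
  (* The derivatives of variance e / 2 are dominated by kernels of variance 2 e, which convolve to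
     [hk (4 * e)]: exactly what [H1] controls. *)
  have bnd p q z : `|phi i p z * phi i q z| <=
      C ^+ 2 * (`|f p| * `|f q|) * (hk (4 * e / 2) p.2 z * hk (4 * e / 2) q.2 z).
    have [_ /(_ i) h1 _] := HC (e / 2) p.2 z (lexx _) (lexx _).
    have [_ /(_ i) h2 _] := HC (e / 2) q.2 z (lexx _) (lexx _).
    rewrite normrM /phi (normrM (g p)) (normrM (g q)) -[4 * e / 2]mulrA.
    apply: (@le_trans _ _ ((`|f p| * (C * hk (4 * (e / 2)) p.2 z)) *
                           (`|f q| * (C * hk (4 * (e / 2)) q.2 z)))).
      apply: ler_pM; [exact: mulr_ge0|exact: mulr_ge0| |].
        exact: (ler_pM (normr_ge0 _) (normr_ge0 _) (gf p) h1).
      exact: (ler_pM (normr_ge0 _) (normr_ge0 _) (gf q) h2).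
    by rewrite le_eqVlt; apply/orP; left; apply/eqP; ring.
  have ki (p q : X) := hk_conv p.2 q.2 e4.
  have zi (pq : X * X) : itg (leb d) (fun z => phi i pq.1 z * phi i pq.2 z).
    apply: (itg_le _ (itgZ (C ^+ 2 * (`|f pq.1| * `|f pq.2|)) (ki pq.1 pq.2).1)) => [|z].
      by apply: measurable_funM; [have := measurableT_comp (mphi i) (pair1_measurable pq.1)|
        have := measurableT_comp (mphi i) (pair1_measurable pq.2)].
    exact: bnd.
  apply: itg_prod1 => //.
  exists (fun pq => C ^+ 2 * (`|f pq.1| * hk (4 * e) pq.1.2 pq.2.2 * `|f pq.2|)).
    by apply: itgZ; exact: H1.
  move=> pq /=; apply: (@le_trans _ _ (\int[leb d]_z (C ^+ 2 * (`|f pq.1| * `|f pq.2|) *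
      (hk (4 * e / 2) pq.1.2 z * hk (4 * e / 2) pq.2.2 z)))).
    apply: le_Rint; [exact: itg_abs|exact: itgZ _ (ki _ _).1|by move=> z; exact: bnd].
  rewrite (RintegralZl _ _ (ki _ _).1)// (ki _ _).2.
  by rewrite le_eqVlt; apply/orP; left; apply/eqP; ring.
have -> : quadform e t =
    - \sum_i \int[(prodm mu mu)]_pq \int[leb d]_z (phi i pq.1 z * phi i pq.2 z).
  rewrite -Rintegral_sum; last by move=> i _; have [] := Rfubini1 (phi_itg i).
  rewrite -mulN1r -RintegralZl//; last first.
    by apply: itg_sum => i _; have [] := Rfubini1 (phi_itg i).
  apply: eq_Rintegral => pq _; rewrite /pairing.
  have [ci ->] := lap_hk_conv pq.1.2 pq.2.2 e0.
  rewrite mulrN !mulNr mul1r; congr (- _).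
  rewrite [LHS](_ : _ = (g pq.1 * g pq.2) * \sum_(i < d) \int[leb d]_z (hk1 i (e / 2) pq.1.2 z * hk1 i (e / 2) pq.2.2 z)).
    rewrite big_distrr /=; apply: eq_bigr => i _; rewrite -(RintegralZl _ _ (ci i))//.
    by apply: eq_Rintegral => z _; rewrite /phi; ring.
  by rewrite /g; ring.
by rewrite oppr_le0; apply: sumr_ge0 => i _; exact: feature_ge0.
Qed.

End quadratic_form.

Section energy.
Context {R : realType} {d : nat}.
Local Notation E := (d.-tuple R).
Local Notation X := (R * E)%type.
Local Notation mu := (prodm (@lebR R) (@leb R d)).
Implicit Types (e t : R) (p q : X).

Variable f : X -> R.
Hypothesis mf : measurable_fun setT f.
Hypothesis H0 : forall e x, 0 < e -> itg mu (fun q => f q * hk e x q.2).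
Hypothesis H1 : forall e, 0 < e ->
  itg (prodm mu mu) (fun pq => `|f pq.1| * hk e pq.1.2 pq.2.2 * `|f pq.2|).

(** For p = (s, x) this is Delta K_e convolved with the time primitive of [f] at time s; the weak
    equation identifies it with the regularised density. *)
Definition potential e p : R :=
  \int[mu]_q (f q * lap_hk e p.2 q.2 * le0i (q.1 - p.1)).

Lemma potential_itg e x (k : X -> R) : 0 < e -> measurable_fun setT k ->
  (forall q, `|k q| <= 1) -> itg mu (fun q => f q * lap_hk e x q.2 * k q).
Proof.
move=> e0 mk k1; have [C C0 HC] := hk_bounds (d := d) e0 (lexx e).
have e4 : 0 < 4 * e by rewrite mulr_gt0.
apply: (itg_le _ (itgZ C (itg_abs (H0 x e4)))) => [|q].
  by apply: measurable_funM => //; apply: measurable_funM => //; exact: measurable_lap_hk.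
have [_ _ h] := HC e x q.2 (lexx _) (lexx _).
rewrite !normrM [`|hk _ _ _|]ger0_norm ?hk_ge0//.
apply: (@le_trans _ _ (`|f q| * `|lap_hk e x q.2|)).
  by rewrite ler_piMr ?k1// mulr_ge0.
by rewrite mulrCA ler_wpM2l.
Qed.

Let norm_le0i_le1 t : `|le0i t| <= 1.
Proof. by rewrite ger0_norm ?le0i_ge0// le0i_le1. Qed.

Let mprod (k1 k2 : X * X -> R) : measurable_fun setT k1 -> measurable_fun setT k2 ->
  measurable_fun setT (fun pq => le0i (k1 pq) * le0i (k2 pq)).
Proof. by move=> m1 m2; apply: measurable_funM; exact: measurable_le0i. Qed.

Let le1prod t t' : `|le0i t * le0i t'| <= 1.
Proof. by rewrite normrM mulr_ile1. Qed.

(* The square [0,t]^2 splits along the null diagonal into two triangles, which the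
   symmetric kernel weighs equally. *)
Lemma energy_identity e t : 0 < e ->
  itg mu (fun p => f p * le0i (p.1 - t) * potential e p) /\
  quadform f e t = 2 * \int[mu]_p (f p * le0i (p.1 - t) * potential e p).
Proof.
move=> e0.
have ms1 : measurable_fun [set: X * X] (fun pq => pq.1.1) by exact: measurableT_comp.
have ms2 : measurable_fun [set: X * X] (fun pq => pq.2.1) by exact: measurableT_comp.
pose k1 (pq : X * X) : R := le0i (pq.1.1 - t) * le0i (pq.2.1 - pq.1.1).
pose k2 (pq : X * X) : R := le0i (pq.2.1 - t) * le0i (pq.1.1 - pq.2.1).
pose k0 (pq : X * X) : R := le0i (pq.1.1 - t) * le0i (pq.2.1 - t).
have i1 : itg (prodm mu mu) (fun pq => pairing f e pq * k1 pq).
  apply: (pairing_itg mf H1 e0) => [|pq]; last exact: le1prod.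
  by apply: mprod; exact: measurable_funB.
have i2 : itg (prodm mu mu) (fun pq => pairing f e pq * k2 pq).
  apply: (pairing_itg mf H1 e0) => [|pq]; last exact: le1prod.
  by apply: mprod; exact: measurable_funB.
have i0 : itg (prodm mu mu) (fun pq => pairing f e pq * k0 pq).
  apply: (pairing_itg mf H1 e0) => [|pq]; last exact: le1prod.
  by apply: mprod; exact: measurable_funB.
have sym : \int[(prodm mu mu)]_pq (pairing f e pq * k2 pq) =
    \int[(prodm mu mu)]_pq (pairing f e pq * k1 pq).
  rewrite (Rintegral_swap i2); apply: eq_Rintegral => -[p q] _ /=.
  by rewrite /pairing /= lap_hkC /k1 /k2 /=; ring.
have inner p : \int[mu]_q (pairing f e (p, q) * k1 (p, q)) =
    f p * le0i (p.1 - t) * potential e p.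
  have pi : itg mu (fun q => f q * lap_hk e p.2 q.2 * le0i (q.1 - p.1)).
    by apply: potential_itg => //; apply: measurable_le0i; exact: measurable_funB.
  rewrite -(RintegralZl _ _ pi)//; apply: eq_Rintegral => q _.
  by rewrite /pairing /k1 /=; ring.
have [j1 e1] := Rfubini1 i1.
have {}inner : (fun p => \int[mu]_q (pairing f e (p, q) * k1 (p, q))) = fun p =>
    f p * le0i (p.1 - t) * potential e p by apply/funext.
rewrite inner in j1 e1; split => //.
rewrite -e1 mulr_natl mulr2n -{2}sym -RintegralD// /quadform.
have [_ ->] := Rfubini1 i0; have [_ ->] := Rfubini1 (itgD i1 i2).
apply: eq_Rintegral => p _; apply: ae_eq_Rint.
- by have := measurableT_comp (itg_measurable i0) (pair1_measurable p).
- by have := measurableT_comp (itg_measurable (itgD i1 i2)) (pair1_measurable p).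
have := @ae_fst_neq R d p.1; apply: filterS => q qp; rewrite -mulrDr; congr (_ * _).
rewrite /k0 /k1 /k2 /= !le0iE !subr_le0.
case: (ltgtP q.1 p.1) qp => // qp _; rewrite ?mulr0 ?mulr1 ?addr0 ?add0r.
  case: (leP p.1 t) => h; rewrite ?mul0r// mul1r.
  by rewrite (le_trans (ltW qp) h).
case: (leP q.1 t) => h; rewrite ?mulr0// mulr1.
by rewrite (le_trans (ltW qp) h).
Qed.

Section limit.
Variables (T t0 : R) (w : X -> R).
Hypothesis Hpot : forall e, 0 < e -> {ae lebR, forall s, 0 <= s <= T -> forall x,
  potential e (s, x) = \int[leb d]_y (hk e x y * w (s, y))}.
Hypothesis wi : {ae lebR, forall s, 0 <= s <= T -> itg (leb d) (fun y => w (s, y))}.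
Hypothesis t0T : 0 <= t0 <= T.

(** The indicator of ]t0, T], written as a difference so that the energy identities at [T] and [t0]
    subtract. *)
Let chi (s : R) : R := le0i (s - T) - le0i (s - t0).
Let F p := f p * chi p.1.
Let W p := w p * chi p.1.
Hypothesis F2 : sqi mu F.
Hypothesis W2 : sqi mu W.

Let chi0 s : chi s = 0 \/ chi s = 1 /\ 0 <= s <= T.
Proof.
rewrite /chi !le0iE !subr_le0; case/andP: t0T => h0 hT.
have [st|st] := leP s t0; first by left; rewrite (le_trans st hT) subrr.
have [sT|sT] := leP s T; last by left; rewrite subrr.
by right; rewrite (le_trans h0 (ltW st)) subr0.
Qed.

Let mpot e : 0 < e -> itg mu (fun p => F p * potential e p) /\
  \int[mu]_p (F p * potential e p) = 2^-1 * (quadform f e T - quadform f e t0).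
Proof.
move=> e0; have [iT eT] := energy_identity T e0; have [i0 eq0] := energy_identity t0 e0.
have E1 : (fun p => F p * potential e p) = (fun p => f p * le0i (p.1 - T) * potential e p
    - f p * le0i (p.1 - t0) * potential e p).
  by apply/funext => p; rewrite /F /chi; ring.
rewrite E1; split; first exact: itgB.
by rewrite RintegralB// eT eq0 -mulrBr mulrA mulVf ?mul1r.
Qed.

Let sec_sqi (g : X -> R) : sqi mu g -> {ae lebR, forall s, sqi (leb d) (fun x => g (s, x))}.
Proof.
move=> [mg gi]; have := itg_prod1_ae gi; apply: filterS => s /= h; split => //.
by have := measurableT_comp mg (pair1_measurable s).
Qed.

Lemma pairing_limit eta : (forall n, - quadform f (harmonic n) t0 <= eta) ->
  \int[mu]_p (F p * W p) <= eta / 2.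
Proof.
move=> Heta; pose h (n : nat) : R := harmonic n.
have h0 n : 0 < h n by exact: harmonic_gt0.
pose G n s := \int[leb d]_x (F (s, x) * potential (h n) (s, x)).
(* The bound of [heatB_bound] with weight 1, uniform in the variance: it dominates the limit in
   time. *)
pose N s := 2^-1 * (1 * \int[leb d]_x (F (s, x) ^+ 2)) +
            2^-1 * (1^-1 * \int[leb d]_x (W (s, x) ^+ 2)).
have GE : {ae lebR, forall s, forall n, 
    G n s = heatB (h n) (fun x => F (s, x)) (fun x => W (s, x))}.
  apply: ae_foralln => n.
  have := Hpot (h0 n); have := sec_sqi F2; have := sec_sqi W2.
  apply: filterS3 => s W2s F2s Hs.
  have [_ ->] := heatBE (h0 n) F2s W2s.
  apply: eq_Rintegral => x _; have [c0|[c1 /Hs ->]] := chi0 s.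
    by rewrite /F /= c0 mulr0 !mul0r.
  by congr (_ * _); apply: eq_Rintegral => y _; rewrite /W /= c1 mulr1.
have FW2s : {ae lebR, forall s, sqi (leb d) (fun x => F (s, x)) /\
    sqi (leb d) (fun x => W (s, x))}.
  by have := sec_sqi F2; have := sec_sqi W2; apply: filterS2.
have NI : itg lebR N.
  by apply: itgD; apply: itgZ; apply: itgZ; [have [] := Rfubini1 F2.2|have [] := Rfubini1 W2.2].
have FW := sqiM F2 W2.
have cG : \int[lebR]_s G n s @[n --> \oo] --> \int[lebR]_s \int[leb d]_x (F (s, x) * W (s, x)).
  apply: (Rintegral_dominated (g := N)) => //.
  - by move=> n; have [/itg_measurable] := Rfubini1 (mpot (h0 n)).1.
  - by have [/itg_measurable] := Rfubini1 FW.
  - have := wi; have := GE; have := FW2s; apply: filterS3 => s [F2s W2s] GEs wis.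
    have W1s : itg (leb d) (fun x => W (s, x)).
      have [c0|[_ /wis h1]] := chi0 s; last first.
        apply: eq_integrable (itgZ (chi s) h1) => // x _ /=.
        by rewrite /W mulrC.
      apply: eq_integrable (integrable0 _ _) => // x _ /=.
      by rewrite /W c0 mulr0.
    (* [wconv_sqi] needs its fixed argument to be integrable in space, which is known for [W] and
       not for [F]; the symmetry of the kernel exchanges them. *)
    have -> : G ^~ s = fun n => heatB (h n) (fun x => W (s, x)) (fun x => F (s, x)).
      apply/funext => n; rewrite GEs /heatB (Rintegral_swap (heatB_itg (h0 n) F2s W2s)).
      by apply: eq_Rintegral => -[x y] _ /=; rewrite hkC; ring.
    have := wconv_sqi W2s W1s F2s; rewrite /wconv.
    by under [X in _ --> X -> _]eq_Rintegral do rewrite mulrC.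
  - have := GE; have := sec_sqi F2; have := sec_sqi W2.
    apply: filterS3 => s W2s F2s GEs n; rewrite GEs.
    exact: heatB_bound.
have [_ ->] := Rfubini1 FW.
rewrite -(cvg_lim _ cG)//; apply: limr_le; first by apply: cvgP; exact: cG.
apply: nearW => n; have [i e] := mpot (h0 n); have [_ e'] := Rfubini1 i.
rewrite /G -e' e mulrC ler_wpM2r ?invr_ge0//.
have := quadform_le0 mf H1 T (h0 n); have := Heta n; rewrite -/(h n) => a b.
lra.
Qed.

End limit.
End energy.

(** * Interpolation along the heat flow *)

Section heat_interpolation.
Context dd (X : measurableType dd) (R : realType).
Variables (m : {measure set X -> \bar R}) (F xi : X -> R) (K : R).
Hypotheses (iF : itg m F) (mxi : measurable_fun setT xi).
Hypothesis HK : forall r : R, 0 < r ->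
  `|\int[m]_p (F p * gk2 r (xi p))| <= K / Num.sqrt r.

Let V (r : R) := \int[m]_p (F p * gk r (xi p)).

Let V_itg (r : R) : 0 < r -> itg m (fun p => F p * gk r (xi p)).
Proof.
move=> r0; apply: (itg_le _ (itgZ (Num.sqrt (2 * pi * r))^-1 (itg_abs iF))) => [|p].
  apply: measurable_funM; first exact: itg_measurable iF.
  by apply: measurableT_comp mxi; exact: measurable_gk.
by rewrite normrM mulrC ler_wpM2r// ger0_norm ?gk_ge0// gk_peak.
Qed.

Let is_derive_V (r : R) : 0 < r -> is_derive r 1 V (\int[m]_p (F p * gk2 r (xi p)) / 2).
Proof.
move=> e0; have ee : r / 2 <= 2 * r by lra.
have [C C0 HC] := gk_bounds (divr_gt0 e0 (ltr0n R 2)) ee.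
pose f e' p : R := F p * gk e' (xi p).
have I0 x : (`](r / 2), (2 * r)[%classic : set R) x -> 0 < x.
  by rewrite /= in_itv /= => /andP[+ _]; apply: lt_trans; rewrite divr_gt0.
have df (e' : R) p : 0 < e' -> is_derive e' 1 (f ^~ p) (F p * (gk2 e' (xi p) / 2)).
  move=> e'0; have dk := is_derive_gk_var (xi p) e'0.
  rewrite (_ : f ^~ p = (F p) *: (gk ^~ (xi p))); first exact: is_derive_eq.
  by apply/funext.
have d1E (e' : R) p : 0 < e' -> partial1of2 f e' p = F p * (gk2 e' (xi p) / 2).
  by move=> e'0; rewrite /partial1of2 derive1E; have h := df e' p e'0; rewrite derive_val.
have Ie : (`](r / 2), (2 * r)[%classic : set R) r by rewrite /= in_itv /=; lra.
pose P := (Num.sqrt (2 * pi * (4 * (2 * r))))^-1.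
have G_ub x y : (`](r / 2), (2 * r)[%classic : set R) x -> setT y ->
    `|partial1of2 f x y| <= C / 2 * P * `|F y|.
  move=> Ix _; rewrite d1E; last exact: I0.
  rewrite normrM (normrM (gk2 _ _)) [`|2^-1|]ger0_norm// mulrC ler_wpM2r//.
  rewrite [C / 2 * P]mulrAC ler_wpM2r//.
  have : r / 2 <= x /\ x <= 2 * r by move: Ix; rewrite /= in_itv /= => /andP[/ltW h1 /ltW h2].
  move=> [h1 h2]; have [_ _ h3] := HC x (xi y) h1 h2; apply: le_trans h3 _.
  by rewrite (ler_wpM2l (ltW C0))// gk_peak// !mulr_gt0.
have df1 x p : (`](r / 2), (2 * r)[%classic : set R) x -> setT p -> derivable (f ^~ p) x 1.
  by move=> /I0 x0 _; have [] := df x p x0.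
have G0 p : 0 <= C / 2 * P * `|F p| by rewrite !mulr_ge0 ?invr_ge0// ltW.
have iG : itg m (fun p => C / 2 * P * `|F p|) by apply: itgZ; exact: itg_abs.
have fi x : (`](r / 2), (2 * r)[%classic : set R) x -> itg m (f x).
  by move=> /I0; exact: V_itg.
have dV := derivable_under_integral measurableT Ie fi df1 G0 iG G_ub.
have := differentiation_under_integral measurableT Ie fi df1 G0 iG G_ub.
under eq_Rintegral do rewrite d1E//.
move=> E; apply: DeriveDef; first exact: dV.
rewrite -derive1E E -RintegralZr//.
  by apply: eq_Rintegral => p _; rewrite mulrA.
have [C' C'0 HC'] := gk_bounds e0 (lexx r).
apply: (itg_le _ (itgZ (C' * (Num.sqrt (2 * pi * (4 * r)))^-1) (itg_abs iF))) => [|p].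
  apply: measurable_funM; first exact: itg_measurable iF.
  by apply: measurableT_comp mxi; exact: measurable_gk2.
rewrite normrM mulrC ler_wpM2r//; have [_ _ h] := HC' r (xi p) (lexx _) (lexx _).
by apply: le_trans h _; rewrite (ler_wpM2l (ltW C'0))// gk_peak// mulr_gt0.
Qed.

(* [V] is compared at the times [e] and [e + h], its derivative being of order
   [r ^ (-1/2)]; this is a mean value argument in the variable [sqrt r]. *)
Lemma heat_interpolation (e h : R) : 0 < e -> 0 < h ->
  `|\int[m]_p (F p * gk e (xi p))| <=
  (Num.sqrt h)^-1 * \int[m]_p `|F p| + K * Num.sqrt h.
Proof.
move=> e0 h0; have eh0 : 0 < e + h by rewrite addr_gt0.
(* In the variable s = sqrt r the singular bound K / sqrt r on the integral against [gk2] becomes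
   the constant bound [K] on the derivative of [U]. *)
pose U (s : R) := V (s ^+ 2).
have dU (s : R) : 0 < s -> is_derive s 1 U (s * \int[m]_p (F p * gk2 (s ^+ 2) (xi p))).
  move=> s0; have s20 : 0 < s ^+ 2 by rewrite exprn_gt0.
  have dV := is_derive_V s20.
  have dX : is_derive s 1 (fun s : R => s ^+ 2) (2 * s).
    by apply: is_derive_eq; rewrite /GRing.scale /= -mulr_natl; ring.
  have := @is_derive1_comp R V (fun s : R => s ^+ 2) s _ _ dV dX.
  rewrite (_ : V \o _ = U)// => dU; apply: is_derive_eq.
  by rewrite /GRing.scale /=; field.
have K0 : 0 <= K.
  by have := HK ltr01; rewrite sqrtr1 divr1; apply: le_trans.
have lese : Num.sqrt e <= Num.sqrt (e + h) by rewrite ler_sqrt ?lerDl ltW.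
have se0 : 0 < Num.sqrt e by rewrite sqrtr_gt0.
have [s /andP[/andP[s1 s2] E]] : exists s, (Num.sqrt e <= s <= Num.sqrt (e + h)) &&
    (U (Num.sqrt (e + h)) - U (Num.sqrt e) == (s * \int[m]_p (F p * gk2 (s ^+ 2) (xi p))) *
      (Num.sqrt (e + h) - Num.sqrt e)).
  have [] := @MVT_segment R U (fun s => s * \int[m]_p (F p * gk2 (s ^+ 2) (xi p))) _ _ lese.
  - by move=> x; rewrite in_itv /= => /andP[h1 _]; apply: dU; exact: lt_trans h1.
  - apply: continuous_in_subspaceT => x; rewrite inE /= in_itv /= => /andP[h1 _].
    have [d _] := dU x (lt_le_trans se0 h1).
    by apply: differentiable_continuous; exact/derivable1_diffP.
  by move=> s; rewrite in_itv /= => sI E; exists s; rewrite sI; apply/eqP.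
have s0 : 0 < s by exact: lt_le_trans s1.
have B : `|s * \int[m]_p (F p * gk2 (s ^+ 2) (xi p))| <= K.
  have := HK (exprn_gt0 2 s0); rewrite sqrtr_sqr (gtr0_norm s0) ler_pdivlMr//.
  by rewrite normrM (gtr0_norm s0) mulrC.
(* The first term is bounded by the peak of the wider Gaussian, at most 1 / sqrt h; the second by
   [K] times sqrt (e + h) - sqrt e <= sqrt h. *)
have E1 : V e = V (e + h) - (U (Num.sqrt (e + h)) - U (Num.sqrt e)).
  by rewrite /U !sqr_sqrtr ?ltW//; ring.
rewrite -/(V e) E1 (eqP E) (le_trans (ler_normB _ _))// lerD//.
  apply: le_trans (le_normr_Rintegral measurableT (V_itg eh0)) _.
  rewrite -(RintegralZl _ measurableT (itg_abs iF)).
  apply: le_Rint; [exact: itg_abs (V_itg eh0)|exact: itgZ _ (itg_abs iF)|move=> p].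
  rewrite normrM mulrC ler_wpM2r// (ger0_norm (gk_ge0 _ _)).
  apply: le_trans (gk_peak _ eh0) _; rewrite lef_pV2 ?posrE ?sqrtr_gt0 ?mulr_gt0 ?pi_gt0//.
  have p0 : 0 <= 2 * pi * (e + h) by rewrite !mulr_ge0 ?pi_ge0// ltW.
  rewrite (ler_sqrt _ p0).
  have : 1 * h <= 2 * pi * (e + h).
    apply: ler_pM; [by []|exact: ltW| |by rewrite lerDr ltW].
    by rewrite (@le_trans _ _ (2 * 2))// ?ler_pM2l ?pi_ge2// -natrM ler1n.
  by rewrite mul1r.
rewrite normrM; apply: ler_pM => //.
rewrite ger0_norm ?subr_ge0// lerBlDr.
rewrite -(ler_pXn2r (n := 2)) ?nnegrE ?addr_ge0 ?sqrtr_ge0//.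
rewrite sqrrD !sqr_sqrtr ?(ltW e0) ?(ltW h0) ?(ltW eh0)//.
have : 0 <= Num.sqrt h * Num.sqrt e *+ 2 by rewrite mulrn_wge0 ?mulr_ge0 ?sqrtr_ge0.
move: (_ *+ 2) => q q0; rewrite [leRHS](_ : _ = e + h + q); first by rewrite lerDl.
by ring.
Qed.

End heat_interpolation.

(** * Charges and continuous test functions *)

Section charges_on_Rd.
Context {R : realType} {d : nat}.
Local Notation E := (d.-tuple R).
Local Notation charge := ({charge set E -> \bar R}).
Implicit Types (phi : 'rV[R]_d -> R) (nu : charge).

(** Links the topology of row vectors to the product sigma-algebra on tuples: an open set is the
    union of the rational boxes it contains, whose corners, as finite functions, form a countable
    type. *)
Lemma measurable_rv_open (U : set 'rV[R]_d) : open U -> measurable (rv @^-1` U : set E).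
Proof.
move=> oU; pose box (ab : {ffun 'I_d -> rat} * {ffun 'I_d -> rat}) : set E :=
  obox (fun i => ratr (ab.1 i)) (fun i => ratr (ab.2 i)).
rewrite [X in measurable X](_ : _ =
    \bigcup_(ab in [set ab | box ab `<=` rv @^-1` U]) box ab).
  rewrite bigcup_mkcond; apply: countable_bigcupT_measurable; first exact: countableP.
  by move=> ab; case: ifP => _ //; exact: measurable_obox.
apply/seteqP; split => [x /= Ux|x [ab /= h]]; last exact: h.
have : nbhs (rv x) U by exact: open_nbhs_nbhs.
move=> /nbhs_ballP[e /= e0 xeU].
have /choice[a Ha] (i : 'I_d) : exists q : rat, tnth x i - e < ratr q < tnth x i.
  have [|q] := @rat_in_itvoo R (tnth x i - e) (tnth x i); first by rewrite ltrBlDr ltrDl.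
  by rewrite in_itv /= => h; exists q.
have /choice[b Hb] (i : 'I_d) : exists q : rat, tnth x i < ratr q < tnth x i + e.
  have [|q] := @rat_in_itvoo R (tnth x i) (tnth x i + e); first by rewrite ltrDl.
  by rewrite in_itv /= => h; exists q.
exists ([ffun i => a i], [ffun i => b i]) => /=; last first.
  by move=> i; rewrite /= !ffunE; have /andP[_ ->] := Ha i; have /andP[-> _] := Hb i.
move=> y hy; apply: xeU; split=> // i j; rewrite /ball /= !mxE ltr_distlC.
have /andP[h1 h2] := hy j; rewrite !ffunE in h1 h2.
have /andP[h3 _] := Ha j; have /andP[_ h4] := Hb j.
by apply/andP; split; lra.
Qed.

Lemma measurable_rv phi : continuous phi -> measurable_fun setT (phi \o @rv R d).
Proof.
move=> /continuousP cphi; apply: (measurability _ (RGenOpens.measurableE R)).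
move=> _ [_ [a [b ->] <-]]; rewrite setTI comp_preimage.
by apply: measurable_rv_open; apply: cphi; exact: interval_open.
Qed.

Lemma itg_bounded dd (X : measurableType dd) (m : {finite_measure set X -> \bar R})
  (g : X -> R) M : measurable_fun setT g -> (forall x, `|g x| <= M) -> itg m g.
Proof.
move=> mg gM; apply: measurable_bounded_integrable => //.
  by rewrite ltey_eq fin_num_measure.
exists M; split; rewrite ?num_real // => t Mt y _ /=.
by rewrite (le_trans (gM y))// ltW.
Qed.

Lemma bcontinuous_cintegrable nu phi : bcontinuous phi -> cintegrable nu (phi \o rv).
Proof.
move=> [/measurable_rv mphi [M HM]]; split.
- exact: (itg_bounded (jordan_pos (projT2 (hahn_choice nu))) mphi (fun x => HM (rv x))).
- exact: (itg_bounded (jordan_neg (projT2 (hahn_choice nu))) mphi (fun x => HM (rv x))).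
Qed.

Lemma schwartz_bcontinuous phi : schwartz phi -> bcontinuous phi.
Proof.
move=> [cphi [_ bphi]]; split; first exact: (cphi [::]).
have [C HC] := bphi [::] 0%N; exists C => x.
by have := HC x; rewrite expr0 mul1r.
Qed.

Lemma schwartz_laplacian phi : schwartz phi -> measurable_fun setT (laplacian phi \o @rv R d).
Proof.
move=> [cphi _]; apply: measurable_rv; rewrite /laplacian.
by apply: continuous_big => [|i _]; [exact: add_continuous|exact: (cphi [:: i; i])].
Qed.

Lemma cintD nu phi psi : bcontinuous phi -> bcontinuous psi ->
  cint nu ((fun v => phi v + psi v) \o rv) = cint nu (phi \o rv) + cint nu (psi \o rv).
Proof.
move=> /(bcontinuous_cintegrable nu)[p1 n1] /(bcontinuous_cintegrable nu)[p2 n2].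
by rewrite /cint (RintegralD _ p1 p2)// (RintegralD _ n1 n2)//; ring.
Qed.

Lemma cintZ nu c phi : bcontinuous phi ->
  cint nu ((fun v => c * phi v) \o rv) = c * cint nu (phi \o rv).
Proof.
move=> /(bcontinuous_cintegrable nu)[p1 n1].
by rewrite /cint (RintegralZl _ _ p1)// (RintegralZl _ _ n1)//; ring.
Qed.

Lemma cint_bounded nu : exists C, forall phi, bcontinuous phi ->
  (forall v, `|phi v| <= 1) -> `|cint nu (phi \o rv)| <= C.
Proof.
pose p : {finite_measure set E -> \bar R} := jordan_pos (projT2 (hahn_choice nu)).
pose n : {finite_measure set E -> \bar R} := jordan_neg (projT2 (hahn_choice nu)).
exists (fine (p setT) + fine (n setT)) => phi bphi phi1.
have [ip inn] := bcontinuous_cintegrable nu bphi.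
have bnd (m : {finite_measure set E -> \bar R}) : itg m (phi \o rv) ->
    `|Rintegral m setT (phi \o rv)| <= fine (m setT).
  move=> im; apply: le_trans (le_normr_Rintegral measurableT im) _.
  have -> : fine (m setT) = \int[m]_x 1.
    by rewrite Rintegral_cst// mul1r.
  apply: le_Rint; [exact: itg_abs im|exact: (itg_bounded m (measurable_cst (1 : R)) (fun=> lexx `|1|))|move=> x; exact: phi1].
rewrite /cint (le_trans (ler_normB _ _))// lerD//; [exact: bnd p ip|exact: bnd n inn].
Qed.


Lemma charge_jordan nu A : measurable A ->
  nu A = (jordan_pos (projT2 (hahn_choice nu)) A -
          jordan_neg (projT2 (hahn_choice nu)) A)%E.
Proof.
move=> mA; rewrite (jordan_decomp (projT2 (hahn_choice nu)))// /cadd /= /cscale.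
by rewrite mulN1e.
Qed.

Let ramp (n : nat) (c : R) : R := Num.min 1 (Num.max 0 (n%:R * c)).

Let cut (b : 'I_d -> R) n (v : 'rV[R]_d) : R := \prod_i ramp n (b i - v 0 i).

Let ramp01 n c : 0 <= ramp n c <= 1.
Proof. by rewrite /ramp le_min ler01 le_max lexx ge_min lexx. Qed.

Let cut_le1 b n v : `|cut b n v| <= 1.
Proof.
rewrite ger0_norm; last by apply: prodr_ge0 => i _; have /andP[] := ramp01 n (b i - v 0 i).
have : \prod_(i < d) ramp n (b i - v 0 i) <= \prod_(i < d) 1.
  by apply: ler_prod => i _; exact: ramp01.
by rewrite big1_eq.
Qed.

Let bcontinuous_cut b n : bcontinuous (cut b n).
Proof.
split; last by exists 1; exact: cut_le1.
apply: continuous_big => [|i _ v]; first exact: mul_continuous.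
have c : {for v, continuous (fun v : 'rV[R]_d => n%:R * (b i - v 0 i) : R^o)}.
  apply: (@cvgM _ _ (nbhs v)); first exact: cvg_cst.
  by apply: (@cvgB _ R^o); [exact: cvg_cst|exact: coord_continuous].
have c1 : {for v, continuous (fun v : 'rV[R]_d => 1 : R^o)} by exact: cst_continuous.
have c0 : {for v, continuous (fun v : 'rV[R]_d => 0 : R^o)} by exact: cst_continuous.
exact: (continuous_min c1 (continuous_max c0 c)).
Qed.

Let ramp_cvg c : ramp n c @[n --> \oo] --> ((0 < c)%R%:R : R).
Proof.
have [c0|c0] := ltP 0 c.
  apply: cvg_near_cst; near=> n; rewrite /ramp min_l// le_max; apply/orP; right.
  rewrite -ler_pdivrMr// div1r.
  near: n; exact: nbhs_infty_ger.
rewrite (_ : ramp ^~ c = cst 0); first exact: cvg_cst.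
apply/funext => n; rewrite /ramp max_l ?min_r//.
by rewrite mulr_ge0_le0.
Unshelve. all: end_near. Qed.

Let cut_cvg b (x : E) : cut b n (rv x) @[n --> \oo] --> (\1_(orthant b) x : R).
Proof.
have -> : \1_(orthant b) x = \prod_(i < d) (0 < b i - tnth x i)%R%:R :> R.
  rewrite indicE; have [xb|xb] := pselect (orthant b x).
    by rewrite mem_set// big1// => i _; rewrite subr_gt0 xb.
  rewrite memNset//; apply/esym/eqP/prodf_eq0.
  move/existsNP : xb => [i] /negP xi; exists i => //.
  by rewrite subr_gt0 (negbTE xi).
apply: cvg_big; first exact: mul_continuous.
by move=> i _; rewrite [rv x _ _]mxE; exact: ramp_cvg.
Qed.

Let Rintegral_cut (m : {finite_measure set E -> \bar R}) b :
  \int[m]_x cut b n (rv x) @[n --> \oo] --> fine (m (orthant b)).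
Proof.
have mo := measurable_orthant b.
have -> : fine (m (orthant b)) = \int[m]_x (\1_(orthant b) x : R).
  by rewrite /Rintegral integral_indic// setIT.
apply: (Rintegral_dominated (g := cst 1)).
- by move=> n; apply: (measurable_rv (phi := cut b n)); have [] := bcontinuous_cut b n.
- exact: measurable_indic.
- by apply: aeW => x; exact: cut_cvg.
- exact: (itg_bounded m (measurable_cst (1 : R)) (fun=> lexx `|1|)).
- by apply: aeW => x n; exact: cut_le1.
Qed.

(** Products of ramps converge boundedly to indicators of open orthants, a pi-system covering the
    space. Uniqueness is applied to the positive measures p1 + n2 and p2 + n1 formed from the Jordan
    parts. *)
Lemma charge_unique nu1 nu2 : (forall phi, bcontinuous phi ->
    cint nu1 (phi \o rv) = cint nu2 (phi \o rv)) ->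
  forall A, measurable A -> nu1 A = nu2 A.
Proof.
move=> H.
pose p1 : {finite_measure set E -> \bar R} := jordan_pos (projT2 (hahn_choice nu1)).
pose n1 : {finite_measure set E -> \bar R} := jordan_neg (projT2 (hahn_choice nu1)).
pose p2 : {finite_measure set E -> \bar R} := jordan_pos (projT2 (hahn_choice nu2)).
pose n2 : {finite_measure set E -> \bar R} := jordan_neg (projT2 (hahn_choice nu2)).
have fE (m : {finite_measure set E -> \bar R}) A : measurable A -> m A = (fine (m A))%:E.
  by move=> mA; rewrite fineK// fin_num_measure.
have Ho b : fine (p1 (orthant b)) - fine (n1 (orthant b)) =
    fine (p2 (orthant b)) - fine (n2 (orthant b)).
  have c1 := cvgB (@Rintegral_cut p1 b) (@Rintegral_cut n1 b).
  have c2 := cvgB (@Rintegral_cut p2 b) (@Rintegral_cut n2 b).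
  rewrite -(cvg_lim (@Rhausdorff R) (c1 _)) -(cvg_lim (@Rhausdorff R) (c2 _)).
  by congr (lim (_ @ \oo)); apply/funext => n; exact: (H _ (bcontinuous_cut b n)).
have addE (m m' : {finite_measure set E -> \bar R}) A : measurable A ->
    measure_add m m' A = (fine (m A) + fine (m' A))%:E.
  by move=> mA; apply: (etrans (measure_addE m m' A)); rewrite EFinD -!fE.
have E12 A : measurable A -> measure_add p1 n2 A = measure_add p2 n1 A.
  move=> mA; apply: (measure_unique orthants (fun k => orthant (fun=> k%:R))) => //.
  - exact: measurable_orthants.
  - exact: orthants_setI.
  - by move=> k; exists (fun=> k%:R).
  - exact: orthant_cover.
  - move=> _ [b _ <-]; have mo := measurable_orthant b.
    apply: (etrans (addE p1 n2 _ mo)); apply: (etrans _ (esym (addE p2 n1 _ mo))).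
    have := Ho b.
    by move: (fine _) (fine _) (fine _) (fine _) => a1 a2 a3 a4 h; congr EFin; lra.
  - move=> k; rewrite [X in (X < _)%E](addE p1 n2 _ (measurable_orthant _)).
    exact: ltry.
have subE (p n : {finite_measure set E -> \bar R}) A : measurable A ->
    (p A - n A = (fine (p A) - fine (n A))%:E)%E.
  by move=> mA; rewrite EFinB -!fE.
move=> A mA; have [h] : (fine (p1 A) + fine (n2 A))%:E = (fine (p2 A) + fine (n1 A))%:E
  := etrans (esym (addE p1 n2 _ mA)) (etrans (E12 A mA) (addE p2 n1 _ mA)).
apply: (etrans (charge_jordan nu1 mA)); apply: (etrans _ (esym (charge_jordan nu2 mA))).
apply: (etrans (subE p1 n1 _ mA)); apply: (etrans _ (esym (subE p2 n2 _ mA))).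
by move: h; move: (fine _) (fine _) (fine _) (fine _) => a1 a2 a3 a4 h; congr EFin; lra.
Qed.

End charges_on_Rd.

Lemma ae_lebR (R : realType) (P : R -> Prop) :
  {ae (@lebesgue_measure R), forall t, P t} -> {ae @lebR R, forall t, P t}.
Proof. by move=> [A [mA A0 sA]]; exists A; split. Qed.

Lemma Rintegral_lebR (R : realType) (D : set R) (f : R -> R) : measurable D ->
  (@lebesgue_measure R).-integrable D (EFin \o f) ->
  (@lebR R).-integrable D (EFin \o f) /\
  Rintegral (@lebesgue_measure R) D f = \int[lebR]_(x in D) f x.
Proof.
move=> mD /(integrable_lebR (EFin \o f) mD) fi; split => //.
by congr fine; apply: integral_lebR => //; exact: measurable_int fi.
Qed.

(** * Differences of weak solutions *)

Section extend0.
Context {R : realType} {d : nat}.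
Local Notation E := (d.-tuple R).
Local Notation X := (R * E)%type.

Definition extend0 (T : R) (g : R -> E -> R) (p : X) : R :=
  if 0 <= p.1 <= T then g p.1 p.2 else 0.

Lemma extend0E (T : R) g : extend0 T g = (fun p : X => g p.1 p.2) \_ (`[0%R, T] `*` setT).
Proof.
apply/funext => p; rewrite /extend0 patchE.
congr (if _ then _ else _); apply/idP/idP => [h|].
  by rewrite inE /= in_itv.
by rewrite inE /= in_itv => -[].
Qed.

Lemma measurable_extend0 (T : R) (g : R -> E -> R) :
  measurable_fun (`[0%R, T] `*` setT) (fun p : X => g p.1 p.2) ->
  measurable_fun setT (extend0 T g).
Proof.
move=> mg; rewrite extend0E; apply/(measurable_restrictT _ _).1 => //.
exact: measurableX.
Qed.

End extend0.

Section solution.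
Context {R : realType} {d : nat}.
Local Notation E := (d.-tuple R).
Local Notation X := (R * E)%type.
Local Notation charge := ({charge set E -> \bar R}).
Local Notation mu := (prodm (@lebR R) (@leb R d)).
Variables (T : R) (a : R -> E -> R) (z0 : charge) (z1 z2 : R -> charge) (w : R -> E -> R).
Hypothesis ma : measurable_fun (`[0%R, T] `*` setT) (fun p : X => a p.1 p.2).
Hypothesis mw : measurable_fun (`[0%R, T] `*` setT) (fun p : X => w p.1 p.2).
Hypotheses (ws1 : weak_solution T a z0 z1) (ws2 : weak_solution T a z0 z2).
Hypothesis dw : {ae (@lebesgue_measure R), forall t, t \in `[0, T] ->
  forall A : set E, measurable A ->
    (z1 t A - z2 t A = \int[leb_tuple d]_(x in A) (w t x)%:E)%E}.

Definition w0 := extend0 T w.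
Definition flux := extend0 T (fun t x => a t x * w t x).
(** A difference of two integrals rather than the integral of a difference charge, which avoids a
    third Jordan decomposition. *)
Definition gap t (phi : 'rV[R]_d -> R) : R :=
  cint (z1 t) (phi \o rv) - cint (z2 t) (phi \o rv).

Lemma measurable_w0 : measurable_fun setT w0.
Proof. exact: measurable_extend0. Qed.

Lemma measurable_flux : measurable_fun setT flux.
Proof. by apply: measurable_extend0; exact: measurable_funM. Qed.

Lemma flux_out p : ~~ (0 <= p.1 <= T) -> flux p = 0.
Proof. by move=> /negbTE h; rewrite /flux /extend0 h. Qed.

Lemma ae_density : {ae lebR, forall s, 0 <= s <= T ->
  forall A : set E, measurable A ->
    (z1 s A - z2 s A = \int[leb d]_(x in A) (w0 (s, x))%:E)%E}.
Proof.
have := ae_lebR dw; apply: filterS => s H sT A mA.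
have sI : s \in `[0, T] by rewrite in_itv.
rewrite (H sI A mA) lebE.
by apply: eq_integral => x _; rewrite /w0 /extend0 /= sT.
Qed.

Let mw0s s : measurable_fun setT (fun x => w0 (s, x)).
Proof. by have := measurableT_comp measurable_w0 (pair1_measurable s). Qed.

Lemma ae_gap_density : {ae lebR, forall s, 0 <= s <= T ->
  itg (leb d) (fun x => w0 (s, x)) /\
  forall phi, bcontinuous phi -> gap s phi = \int[leb d]_x (phi (rv x) * w0 (s, x))}.
Proof.
have := ae_density; apply: filterS => s H /H {}H; split.
  exact: charge_density_itg (mw0s s) H.
move=> phi bphi; have := cint_density (mw0s s) H
  (bcontinuous_cintegrable (z1 s) bphi) (bcontinuous_cintegrable (z2 s) bphi).
by case.
Qed.

(** Subtracting the two equations cancels [z0]. The weak formulation only provides iterated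
    integrals, hence the hypothesis of joint integrability, which lets Fubini merge them. *)
Lemma gap_flux phi t : schwartz phi ->
  itg mu (fun p => flux p * laplacian phi (rv p.2)) -> 0 <= t <= T ->
  gap t phi = \int[mu]_p (flux p * laplacian phi (rv p.2) * le0i (p.1 - t)).
Proof.
move=> sphi fi tT.
have [c1 i1 e1] := ws1 sphi; have [c2 i2 e2] := ws2 sphi.
pose g s x := laplacian phi (rv x) * a s x.
pose D s := cint (z1 s) (g s) - cint (z2 s) (g s).
have mt : measurable (`[0, t]%classic : set R) by [].
have st : (`[0, t]%classic : set R) `<=` `[0, T]%classic.
  by move=> s; rewrite /= !in_itv /= => /andP[-> /le_trans]; apply; case/andP: tT.
have j1 : lebesgue_measure.-integrable `[0, t] (fun s => (cint (z1 s) (g s))%:E).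
  exact: integrableS i1.
have j2 : lebesgue_measure.-integrable `[0, t] (fun s => (cint (z2 s) (g s))%:E).
  exact: integrableS i2.
have tT' : t \in `[0, T] by rewrite in_itv.
have [{}j1 r1] := Rintegral_lebR mt j1; have [{}j2 r2] := Rintegral_lebR mt j2.
have -> : gap t phi = \int[lebR]_(s in `[0, t]) D s.
  rewrite /D (RintegralB mt j1 j2) -r1 -r2 /gap (e1 t tT') (e2 t tT').
  by rewrite opprD addrACA subrr add0r.
have jD : (@lebR R).-integrable `[0, t] (EFin \o D).
  by have := integrableB mt j1 j2; apply: eq_integrable => // s _ /=; rewrite EFinB.
have fk : itg mu (fun p => flux p * laplacian phi (rv p.2) * le0i (p.1 - t)).
  apply: (itg_le _ (itg_abs fi)) => [|p].
    apply: measurable_funM; first exact: itg_measurable fi.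
    by apply: measurable_le0i; exact: measurable_funB.
  by rewrite normrM ler_piMr// ger0_norm ?le0i_ge0// le0i_le1.
have [hi ->] := Rfubini1 fk.
rewrite [LHS]Rintegral_mkcond.
apply: ae_eq_Rint; [|exact: itg_measurable hi|].
  apply/(measurable_restrictT _ _).1 => //.
  by apply/measurable_EFinP; exact: measurable_int jD.
have := ae_density; have := ae_lebR c1; have := ae_lebR c2.
apply: filterS3 => s h2 h1 H /=; rewrite patchE.
have [s0T|s0T] := boolP (0 <= s <= T); last first.
  under eq_Rintegral do rewrite flux_out// !mul0r.
  rewrite Rintegral_cst// mul0r memNset//= => /st /=.
  by rewrite in_itv /= (negbTE s0T).
have sT' : s \in `[0, T] by rewrite in_itv.
have [k1 k2] := cint_density (mw0s s) (H s0T) (h1 sT') (h2 sT').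
rewrite le0iE subr_le0; have [lst|lst] := leP s t; last first.
  under eq_Rintegral do rewrite mulr0.
  rewrite Rintegral_cst// mul0r memNset//= in_itv /= => /andP[_].
  by rewrite leNgt lst.
rewrite mem_set /=; last by rewrite in_itv /= lst andbT; case/andP: s0T.
rewrite /D k2; apply: eq_Rintegral => x _.
by rewrite /w0 /flux /extend0 /= s0T /g; ring.
Qed.

(* The weak equation tested on the heat kernel. *)
Lemma ae_potential e : 0 < e ->
  (forall x, itg mu (fun q => flux q * lap_hk e x q.2)) ->
  {ae lebR, forall s, 0 <= s <= T -> forall x,
    potential flux e (s, x) = \int[leb d]_y (hk e x y * w0 (s, y))}.
Proof.
(* The exceptional times come from the density alone, so one null set serves all centres [x]. *)
move=> e0 fi; have := ae_gap_density; apply: filterS => s H s0T x.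
have [_ H'] := H s0T; have sk := schwartz_hkrow x e0.
have E1 y : laplacian (hkrow e x) (rv y) = lap_hk e x y.
  by rewrite laplacian_hkrow// lap_hkC.
have G := gap_flux sk _ s0T.
rewrite /potential -[RHS](_ : gap s (hkrow e x) = _).
  rewrite G; last by apply: eq_integrable (fi x) => // q _ /=; rewrite E1.
  by apply: eq_Rintegral => q _; rewrite E1.
rewrite (H' _ (schwartz_bcontinuous sk)); apply: eq_Rintegral => y _.
by rewrite hkrow_rv hkC.
Qed.

End solution.

(** * From vanishing flux to uniqueness *)

Section uniqueness.
Context {R : realType} {d : nat}.
Local Notation E := (d.-tuple R).
Local Notation X := (R * E)%type.
Local Notation charge := ({charge set E -> \bar R}).
Local Notation mu := (prodm (@lebR R) (@leb R d)).
Variables (T : R) (a : R -> E -> R) (z0 : charge) (z1 z2 : R -> charge) (w : R -> E -> R).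
Hypothesis T0 : 0 < T.
Hypothesis ma : measurable_fun (`[0%R, T] `*` setT) (fun p : X => a p.1 p.2).
Hypothesis a0 : forall t x, t \in `[0, T] -> 0 <= a t x.
Hypothesis mw : measurable_fun (`[0%R, T] `*` setT) (fun p : X => w p.1 p.2).
Hypotheses (wc1 : weakly_continuous T z1) (wc2 : weakly_continuous T z2).
Hypotheses (ws1 : weak_solution T a z0 z1) (ws2 : weak_solution T a z0 z2).
Hypothesis dw : {ae (@lebesgue_measure R), forall t, t \in `[0, T] ->
  forall A : set E, measurable A ->
    (z1 t A - z2 t A = \int[leb_tuple d]_(x in A) (w t x)%:E)%E}.

Local Notation w0 := (@w0 R d T w).
Local Notation flux := (@flux R d T a w).
Local Notation gap := (@gap R d z1 z2).

(** The indicator of ]t, T] when t <= T. For t > T it is -1 on ]T, t], harmlessly, since the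
    functions it multiplies vanish outside [[0, T]]. *)
Definition window (t s : R) : R := le0i (s - T) - le0i (s - t).

Lemma windowE t s : 0 <= t -> 0 <= s <= T -> window t s = (t < s)%R%:R.
Proof.
move=> t0 /andP[_ sT]; rewrite /window !le0iE !subr_le0 sT ltNge.
by case: (s <= t); rewrite ?subrr ?subr0.
Qed.

Lemma pos_neq0 (s : R) : 0 < s -> exists n, harmonic n < s.
Proof.
move=> s0; have /cvgrPdist_lt/(_ _ s0)[N _ H] := @cvg_harmonic R.
by exists N; have := H N (leqnn N); rewrite /= sub0r normrN gtr0_norm// harmonic_gt0.
Qed.

Lemma ae_lebR_neq (c : R) : {ae @lebR R, forall s, s != c}.
Proof.
exists [set c]; split => //; first exact: lebesgue_measure_set1.
by move=> p /= /negP; rewrite negbK => /eqP.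
Qed.

Lemma ae_lebR_dense (P : R -> Prop) (u v : R) : u < v -> {ae @lebR R, forall s, P s} ->
  exists2 s, u < s < v & P s.
Proof.
move=> uv [A [mA A0 sA]]; apply: contrapT => H.
have : (lebR `]u, v[%classic <= lebR A)%E.
  apply: le_measure; rewrite ?inE// => s; rewrite /= in_itv /= => suv.
  by apply: sA => /= Ps; apply: H; exists s.
rewrite [X in (_ <= X)%E]A0 lebRE lebesgue_measure_itv /= lte_fin uv lee_fin.
by rewrite leNgt subr_gt0 uv.
Qed.

Hypothesis w2 : forall t, 0 < t -> sqi mu (fun p => w0 p * window t p.1).

Lemma ae_w0_sqi : {ae @lebR R, forall s, 0 <= s <= T -> sqi (leb d) (fun x => w0 (s, x))}.
Proof.
have H : {ae @lebR R, forall s n, sqi (leb d) (fun x => w0 (s, x) * window (harmonic n) s)}.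
  apply: ae_foralln => n; have [mg gi] := w2 (harmonic_gt0 n).
  have := itg_prod1_ae gi; apply: filterS => s /= h; split => //.
  by have := measurableT_comp mg (pair1_measurable s).
have := ae_lebR_neq 0; move: H; apply: filterS2 => s H s0 /andP[s0' sT].
have {}s0 : 0 < s by rewrite lt_neqAle eq_sym s0.
have [n ns] := pos_neq0 s0; have := H n.
rewrite windowE ?harmonic_ge0 ?s0' ?sT// ns.
by under [X in sqi _ X]eq_fun do rewrite mulr1.
Qed.

(** Without flux the weak equation makes the heat regularisation of the density vanish; pairing it
    with the density and letting the variance tend to zero gives a zero L^2 norm. *)
Lemma flux0_gap0 : {ae mu, forall p, flux p = 0} ->
  {ae @lebR R, forall s, 0 <= s <= T -> forall phi, bcontinuous phi -> gap s phi = 0}.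
Proof.
move=> f0.
have pot (g : X -> R) : measurable_fun setT g ->
    itg mu (fun p => flux p * g p) /\ \int[mu]_p (flux p * g p) = 0.
  move=> mg; have mfg : measurable_fun setT (fun p => flux p * g p).
    by apply: measurable_funM => //; exact: measurable_flux.
  have [|i e] := ae_eq_itg (f := cst 0) mfg _ (integrable0 mu setT).
    by move: f0; apply: filterS => p ->; rewrite mul0r.
  by split => //; rewrite -e Rintegral_cst// mul0r.
have := ae_gap_density mw dw; have := ae_w0_sqi.
apply: filterS2 => s H2 H s0T phi bphi; have [w1 Hg] := H s0T; have w2s := H2 s0T.
have K0 e x : 0 < e -> \int[leb d]_y (hk e x y * w0 (s, y)) = 0.
  move=> e0; have sk := schwartz_hkrow x e0.
  have ml : measurable_fun [set: X] (fun p => laplacian (hkrow e x) (rv p.2)).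
    by have := measurableT_comp (schwartz_laplacian sk) (@measurable_snd _ _ R E).
  have [i1 _] := pot _ ml.
  have := Hg _ (schwartz_bcontinuous sk); rewrite (gap_flux mw ws1 ws2 dw sk i1 s0T).
  under [X in X = _ -> _]eq_Rintegral do rewrite -mulrA.
  rewrite (pot _ _).2.
    by move=> ->; apply: eq_Rintegral => y _; rewrite hkrow_rv hkC.
  by apply: measurable_funM => //; apply: measurable_le0i; exact: measurable_funB.
have B0 n : heatB (harmonic n) (fun y => w0 (s, y)) (fun y => w0 (s, y)) = 0.
  have [_ ->] := heatBE (harmonic_gt0 n) w2s w2s.
  under eq_Rintegral do rewrite K0 ?harmonic_gt0// mulr0.
  by rewrite Rintegral_cst// mul0r.
have := wconv_sqi w2s w1 w2s; rewrite /wconv.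
under eq_fun do rewrite B0.
move=> /(cvg_lim (@Rhausdorff R)); rewrite lim_cst// => e.
have sq : {ae leb d, forall y, w0 (s, y) ^+ 2 = 0}.
  apply: Rintegral_eq0; [exact: w2s.2|by move=> y; exact: sqr_ge0|].
  rewrite e; by [].
rewrite Hg//; apply: (@etrans _ _ (\int[leb d]_x (0 : R))); last by rewrite Rintegral_cst// mul0r.
apply: ae_eq_Rint => //.
  apply: measurable_funM; last exact: itg_measurable w1.
  by apply: (measurable_rv (phi := phi)); case: bphi.
by move: sq; apply: filterS => y /eqP; rewrite sqrf_eq0 => /eqP ->; rewrite mulr0.
Qed.

Lemma gap_continuous phi : bcontinuous phi -> {within `[0, T], continuous (gap ^~ phi)}.
Proof.
move=> bphi t; have h1 := wc1 bphi; have h2 := wc2 bphi.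
exact: (cvgB (h1 t) (h2 t)).
Qed.

Lemma flux0_unique : {ae mu, forall p, flux p = 0} ->
  forall t, t \in `[0, T] -> forall A : set E, measurable A -> z1 t A = z2 t A.
Proof.
move=> /flux0_gap0 g0 t; rewrite in_itv /= => /andP[t0 tT].
apply: charge_unique => phi bphi; apply/eqP; rewrite -subr_eq0 -normr_le0.
apply/ler_addgt0Pl => e e0; rewrite addr0.
have := gap_continuous bphi => /subspace_continuousP/(_ t).
rewrite /= in_itv /= t0 tT => /(_ isT)/cvgrPdist_lt/(_ _ e0)/nbhs_ballP[r /= r0 H].
have ge_r (x : R) : 0 <= x -> 0 < x + r by move=> x0; rewrite ltr_wpDl.
(* The neighbourhood of [t] meets [[0, T]] in an interval of positive length even when [t] is an
   endpoint, so it contains a good time. *)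
have uv : Num.max 0 (t - r) < Num.min T (t + r).
  rewrite gt_max !lt_min T0 ge_r// ltrBlDr (le_lt_trans tT) ?ltrDl//=.
  by rewrite ltrBlDr -addrA ltrDl addr_gt0.
have [s /andP[s1 s2] gs] := ae_lebR_dense uv g0.
rewrite gt_max in s1; rewrite lt_min in s2.
case/andP: s1 => s1 s1'; case/andP: s2 => s2 s2'.
have sT : 0 <= s <= T by rewrite !ltW.
have : `|gap t phi - gap s phi| < e.
  apply: (H s); last by rewrite /= in_itv.
  by rewrite /ball /= ltr_distlC; apply/andP; split => //; rewrite ltrBlDr.
by rewrite (gs sT _ bphi) subr0 => /ltW.
Qed.

(* [flux * w0 = a * w0 ^+ 2], so a nonpositive integral forces [flux] to vanish. *)
Lemma flux_eq0
  (H0 : forall e x, 0 < e -> itg mu (fun q => flux q * hk e x q.2))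
  (H1 : forall e, 0 < e ->
     itg (prodm mu mu) (fun pq => `|flux pq.1| * hk e pq.1.2 pq.2.2 * `|flux pq.2|))
  (f2 : forall t, 0 < t -> sqi mu (fun p => flux p * window t p.1))
  (small : forall t1 eps, 0 < t1 -> 0 < eps -> exists t0, [/\ 0 <= t0 <= T, t0 < t1,
     sqi mu (fun p => flux p * window t0 p.1), sqi mu (fun p => w0 p * window t0 p.1) &
     forall n, - quadform flux (harmonic n) t0 <= eps]) :
  {ae mu, forall p, flux p = 0}.
Proof.
have mf := measurable_flux ma mw.
have fwE p : flux p * w0 p = extend0 T a p * w0 p ^+ 2.
  by rewrite /flux /w0 /extend0; case: ifP => _; ring.
have a00 p : 0 <= extend0 T a p.
  by rewrite /extend0; case: ifP => // h; rewrite a0// in_itv.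
have fw0 p : 0 <= flux p * w0 p by rewrite fwE mulr_ge0 ?sqr_ge0.
have fw_eq0 p : flux p * w0 p = 0 -> flux p = 0.
  rewrite fwE => /eqP; rewrite mulf_eq0 sqrf_eq0 => /orP[|] /eqP h.
    by move: h; rewrite /flux /extend0; case: ifP => // _ ->; rewrite mul0r.
  by move: h; rewrite /flux /w0 /extend0; case: ifP => // _ ->; rewrite mulr0.
have wsq0 t s : 0 <= window t s ^+ 2 by exact: sqr_ge0.
have key t1 : 0 < t1 -> {ae mu, forall p, (flux p * window t1 p.1) * (w0 p * window t1 p.1) = 0}.
  move=> t10; apply: (Rintegral_eq0 (sqiM (f2 _ t10) (w2 t10))).
    by move=> p; rewrite mulrACA -expr2 mulr_ge0.
  apply/ler_addgt0Pl => e e0; rewrite addr0.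
  (* The integrand is nonnegative and the window of [t0] contains that of [t1]; [pairing_limit]
     halves the bound, hence 2 * e. *)
  have [t0 [t0T t01 F2 W2 q]] := small t1 (2 * e) t10 (mulr_gt0 (ltr0n R 2) e0).
  have := pairing_limit mf H0 H1 _ _ t0T F2 W2 q.
  rewrite mulrAC divff// mul1r => lim; apply: le_trans (lim _ _).
  - apply: le_Rint; [exact: sqiM (f2 _ t10) (w2 t10)|exact: sqiM F2 W2|move=> p].
    rewrite ![_ * window _ _ * _]mulrACA -!expr2.
    have [h|/flux_out ->] := boolP (0 <= p.1 <= T); last by rewrite !mul0r.
    rewrite ler_wpM2l// !windowE ?(ltW t10)//; last by case/andP: t0T.
    by case: (ltP t1 p.1) => [/(lt_trans t01) ->|_]; rewrite ?lexx// expr0n /= sqr_ge0.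
  - move=> e' e'0; apply: (ae_potential mw ws1 ws2 dw e'0) => x.
    have mk : measurable_fun [set: X] (fun=> 1 : R) by exact: measurable_cst.
    have := potential_itg mf H0 x e'0 mk (fun=> eq_ind_r (fun z => z <= 1) (lexx 1) (normr1 R)).
    by apply: eq_integrable => // q' _ /=; rewrite mulr1.
  - have := ae_gap_density mw dw; apply: filterS => s H s0T; by case: (H s0T).
have {}key : {ae mu, forall p n, (flux p * window (harmonic n) p.1) * (w0 p * window (harmonic n) p.1) = 0}.
  by apply: ae_foralln => n; exact: key (harmonic_gt0 n).
have := @ae_fst_neq R d 0; move: key; apply: filterS2 => p H p0.
have [h|/flux_out//] := boolP (0 <= p.1 <= T).
have {}p0 : 0 < p.1 by rewrite lt_neqAle eq_sym p0; case/andP: h.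
have [n np] := pos_neq0 p0; apply: fw_eq0; have := H n.
by rewrite windowE ?harmonic_ge0// np !mulr1.
Qed.

End uniqueness.

(** * Uniform bound on the mass of the difference *)

Section gap_bound.
Context {R : realType} {d : nat}.
Local Notation charge := ({charge set (d.-tuple R) -> \bar R}).
Variables (T : R) (z1 z2 : R -> charge).
Hypothesis T0 : 0 < T.
Hypotheses (wc1 : weakly_continuous T z1) (wc2 : weakly_continuous T z2).

Lemma gap_bound : exists2 M, 0 < M & forall (t : R) phi (B : R), 0 <= t <= T ->
  bcontinuous phi -> 0 < B -> (forall v, `|phi v| <= B) -> `|gap z1 z2 t phi| <= M * B.
Proof.
(* The family is indexed by all of [R]; off [[0, T]], where continuity gives nothing, it is set to
   zero. *)
pose L t phi := if 0 <= t <= T then gap z1 z2 t phi else 0.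
have [] := @uniform_boundedness R d R L.
- move=> t f g bf bg; rewrite /L; case: ifP => _; last by rewrite addr0.
  by rewrite /gap !cintD//; ring.
- move=> t c f bf; rewrite /L; case: ifP => _; last by rewrite mulr0.
  by rewrite /gap !cintZ//; ring.
- move=> t; have [C1 H1] := cint_bounded (z1 t); have [C2 H2] := cint_bounded (z2 t).
  exists (`|C1| + `|C2|) => f bf f1; rewrite /L; case: ifP => _; last by rewrite normr0 addr_ge0.
  rewrite (le_trans (ler_normB _ _))// lerD//.
    by rewrite (le_trans (H1 f bf f1))// ler_norm.
  by rewrite (le_trans (H2 f bf f1))// ler_norm.
- move=> f bf; have [B HB] : exists B, forall t, t \in `[0, T] -> `|gap z1 z2 t f| <= B.
    have cn : {within `[0, T], continuous (fun t => `|gap z1 z2 t f|)}.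
      by move=> t; apply: cvg_norm; exact: (gap_continuous wc1 wc2 bf).
    have [c _ Hc] := EVT_max (ltW T0) cn.
    by exists `|gap z1 z2 c f|.
  exists `|B| => t; rewrite /L; case: ifP => [tT|_]; last by rewrite normr0.
  by rewrite (le_trans (HB t _)) ?in_itv// ler_norm.
move=> M [M0 HM]; exists M => // t phi B tT bphi B0 phiB.
have h1 v : `|B^-1 * phi v| <= 1.
  by rewrite normrM gtr0_norm ?invr_gt0// mulrC ler_pdivrMr// mul1r.
have := HM t _ (bcontinuousZ B^-1 bphi) h1.
rewrite /L tT /gap !cintZ// -mulrBr normrM gtr0_norm ?invr_gt0//.
by rewrite mulrC ler_pdivrMr.
Qed.

End gap_bound.

(** * Dimension one: the quadratic form near time zero *)

Lemma gk_lipschitz (R : realType) (e : R) : 0 < e -> exists2 C, 0 <= C &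
  forall s t : R, `|gk e s - gk e t| <= C * `|s - t|.
Proof.
move=> e0; have [C C0 HC] := gk_bounds e0 (lexx e).
have e4 : 0 < 4 * e by rewrite mulr_gt0.
exists (C * (Num.sqrt (2 * pi * (4 * e)))^-1).
  by rewrite mulr_ge0 ?invr_ge0// ltW.
move=> s t; wlog st : s t / s <= t.
  move=> H; have [/H//|/ltW /H] := leP s t.
  by rewrite distrC [`|t - s|]distrC.
have [||c _ E] := @MVT_segment R (gk e) (gk1 e) _ _ st.
- by move=> x _; exact: is_derive_gk.
- by apply: continuous_subspaceT => x; exact: continuous_gk.
rewrite distrC E normrM [`|s - t|]distrC ler_wpM2r//.
have [_ h _] := HC e c (lexx _) (lexx _); apply: le_trans h _.
by rewrite (ler_wpM2l (ltW C0))// gk_peak.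
Qed.

Section one_dimensional.
Context {R : realType}.
Local Notation E := (1.-tuple R).
Local Notation X := (R * E)%type.
Local Notation charge := ({charge set E -> \bar R}).
Local Notation mu := (prodm (@lebR R) (@leb R 1)).
Variables (T : R) (a : R -> E -> R) (z0 : charge) (z1 z2 : R -> charge) (w : R -> E -> R).
Hypothesis T0 : 0 < T.
Hypothesis ma : measurable_fun (`[0%R, T] `*` setT) (fun p : X => a p.1 p.2).
Hypothesis mw : measurable_fun (`[0%R, T] `*` setT) (fun p : X => w p.1 p.2).
Hypotheses (wc1 : weakly_continuous T z1) (wc2 : weakly_continuous T z2).
Hypotheses (ws1 : weak_solution T a z0 z1) (ws2 : weak_solution T a z0 z2).
Hypothesis dw : {ae (@lebesgue_measure R), forall t, t \in `[0, T] ->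
  forall A : set E, measurable A ->
    (z1 t A - z2 t A = \int[leb_tuple 1]_(x in A) (w t x)%:E)%E}.

Local Notation w0 := (@w0 R 1 T w).
Local Notation flux := (@flux R 1 T a w).
Local Notation gap := (@gap R 1 z1 z2).
Hypothesis fi : itg mu flux.

Let x0 (x : E) : R := tnth x ord0.

Lemma hk1dE e (x y : E) : hk e x y = gk e (x0 x - x0 y).
Proof. by rewrite /hk big_ord1. Qed.

Lemma lap_hk1dE e (x y : E) : lap_hk e x y = gk2 e (x0 x - x0 y).
Proof. by rewrite /lap_hk big_ord1 /hk2 big_ord1 eqxx. Qed.

Lemma flux_hk (e : R) x : 0 < e -> itg mu (fun q => flux q * hk e x q.2).
Proof.
move=> e0; apply: (itg_le _ (itgZ (Num.sqrt (2 * pi * e))^-1 (itg_abs fi))) => [|q].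
  by apply: measurable_funM; [exact: itg_measurable fi|exact: measurable_hk].
rewrite normrM mulrC ler_wpM2r// ger0_norm ?hk_ge0//.
by rewrite hk1dE gk_peak.
Qed.

Lemma flux_hk_flux (e : R) : 0 < e ->
  itg (prodm mu mu) (fun pq => `|flux pq.1| * hk e pq.1.2 pq.2.2 * `|flux pq.2|).
Proof.
move=> e0; have [ti _] := itg_tensor (itg_abs fi) (itg_abs fi).
have mf := measurable_flux ma mw.
apply: (itg_le _ (itgZ (Num.sqrt (2 * pi * e))^-1 ti)) => [|pq].
  apply: measurable_funM.
    apply: measurable_funM; first by do 2 apply: measurableT_comp => //.
    by apply: measurable_hk; exact: measurableT_comp.
  by do 2 apply: measurableT_comp => //.
have nn : 0 <= `|flux pq.1| * hk e pq.1.2 pq.2.2 * `|flux pq.2|.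
  by rewrite !mulr_ge0 ?hk_ge0.
rewrite (ger0_norm nn) -mulrA mulrCA ler_wpM2r ?mulr_ge0//.
by rewrite hk1dE gk_peak.
Qed.

Let J t : R := \int[mu]_p (`|flux p| * le0i (p.1 - t)).

Let J_itg t : itg mu (fun p => `|flux p| * le0i (p.1 - t)).
Proof.
apply: (itg_le _ (itg_abs fi)) => [|p].
  apply: measurable_funM; first exact: itg_measurable (itg_abs fi).
  by apply: measurable_le0i; exact: measurable_funB.
by rewrite normrM normr_id ler_piMr// ger0_norm ?le0i_ge0// le0i_le1.
Qed.

Let J_le (s t : R) : s <= t -> J s <= J t.
Proof.
move=> st; apply: le_Rint => // p; rewrite ler_wpM2l// !le0iE !subr_le0.
by case: (leP p.1 s) => [/le_trans/(_ st) ->|_]; rewrite ?lexx ?ler0n.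
Qed.

Let J_small (eps : R) : 0 < eps -> exists2 t, 0 < t & J t <= eps.
Proof.
move=> e0; have : J (harmonic n) @[n --> \oo] --> \int[mu]_p (0 : R).
  apply: (Rintegral_dominated (g := fun p => `|flux p|)) => //.
  - by move=> n; exact: itg_measurable (J_itg _).
  - have := @ae_fst_neq R 1 0; apply: filterS => p p0.
    have [h|/flux_out ->] := boolP (0 <= p.1 <= T); last first.
      by under eq_fun do rewrite normr0 mul0r; exact: cvg_cst.
    have {}p0 : 0 < p.1 by rewrite lt_neqAle eq_sym p0; case/andP: h.
    have /cvgrPdist_lt/(_ _ p0)[N _ H] := @cvg_harmonic R.
    apply: cvg_near_cst; exists N => // n /= Nn; rewrite le0iE subr_le0.
    have := H n Nn; rewrite /= sub0r normrN gtr0_norm ?harmonic_gt0// => hp.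
    by rewrite leNgt hp mulr0.
  - exact: itg_abs.
  - apply: aeW => p n; rewrite normrM normr_id ler_piMr//.
    by rewrite ger0_norm ?le0i_ge0// le0i_le1.
rewrite Rintegral_cst// mul0r => /cvgrPdist_le/(_ _ e0)[N _ /(_ N (leqnn N)) /=].
rewrite sub0r normrN => h; exists (harmonic N); first exact: harmonic_gt0.
exact: le_trans (ler_norm _) h.
Qed.

Section estimate.
Variables (M t0 : R).
Hypothesis M0 : 0 < M.
Hypothesis HM : forall (t : R) phi (B : R), 0 <= t <= T ->
  bcontinuous phi -> 0 < B -> (forall v, `|phi v| <= B) -> `|gap t phi| <= M * B.
Hypothesis t0T : 0 <= t0 <= T.
Hypothesis w1 : itg (leb 1) (fun x => w0 (t0, x)).
Hypothesis Hg : forall phi, bcontinuous phi ->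
  gap t0 phi = \int[leb 1]_x (phi (rv x) * w0 (t0, x)).

Let F p := flux p * le0i (p.1 - t0).

Let iF : itg mu F.
Proof.
apply: (itg_le _ (itg_abs fi)) => [|p].
  apply: measurable_funM; first exact: itg_measurable fi.
  by apply: measurable_le0i; exact: measurable_funB.
by rewrite normrM ler_piMr// ger0_norm ?le0i_ge0// le0i_le1.
Qed.

Let JF : \int[mu]_p `|F p| = J t0.
Proof.
by apply: eq_Rintegral => p _; rewrite normrM [`|le0i _|]ger0_norm// le0i_ge0.
Qed.

Let mx (c : R) : measurable_fun [set: X] (fun p => x0 p.2 - c).
Proof.
apply: measurable_funB => //.
by have := measurableT_comp (measurable_tnth (ord0 : 'I_1)) (@measurable_snd _ _ R E).
Qed.

Let gap_hkrow (r : R) (y : E) : 0 < r ->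
  gap t0 (hkrow r y) = \int[mu]_p (F p * lap_hk r p.2 y).
Proof.
move=> r0; have sk := schwartz_hkrow y r0.
have mk : measurable_fun [set: X] (fun=> 1 : R) by exact: measurable_cst.
have pi : itg mu (fun q => flux q * laplacian (hkrow r y) (rv q.2)).
  have := potential_itg (measurable_flux ma mw) flux_hk y r0 mk
    (fun=> eq_ind_r (fun z => z <= 1) (lexx 1) (normr1 R)).
  apply: eq_integrable => // q _ /=.
  by rewrite laplacian_hkrow// lap_hkC mulr1.
rewrite (gap_flux mw ws1 ws2 dw sk pi t0T); apply: eq_Rintegral => p _.
by rewrite laplacian_hkrow// /F mulrAC.
Qed.

Let hkrow_le (r : R) (y : E) (v : 'rV[R]_1) : 0 < r -> `|hkrow r y v| <= (Num.sqrt (2 * pi * r))^-1.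
Proof. by move=> r0; rewrite /hkrow big_ord1 ger0_norm ?gk_ge0// gk_peak. Qed.

(** The weak equation turns the integral into [gap] on a Gaussian, at most [M] times its peak. In
    dimension one the peak is of order r^(-1/2), as [heat_interpolation] requires. *)
Let flux_gk2 (r c : R) : 0 < r -> `|\int[mu]_p (F p * gk2 r (x0 p.2 - c))| <= M / Num.sqrt r.
Proof.
move=> r0; pose y : E := [tuple c].
have -> : \int[mu]_p (F p * gk2 r (x0 p.2 - c)) = gap t0 (hkrow r y).
  by rewrite gap_hkrow//; apply: eq_Rintegral => p _; rewrite lap_hk1dE.
apply: (HM t0T); [exact: schwartz_bcontinuous (schwartz_hkrow y r0)| |move=> v].
  by rewrite invr_gt0 sqrtr_gt0.
apply: le_trans (hkrow_le y v r0) _.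
rewrite lef_pV2 ?posrE ?sqrtr_gt0 ?mulr_gt0 ?pi_gt0//.
rewrite ler_sqrt ?mulr_ge0 ?pi_ge0 ?(ltW r0)// ler_peMl ?(ltW r0)//.
by rewrite (@le_trans _ _ (2 * 2))// ?ler_pM2l ?pi_ge2// -natrM ler1n.
Qed.

(** The heat kernel convolved with the time primitive of the flux at [t0], on row vectors so that
    [gap] can be tested on it. *)
Let v (e : R) (u : 'rV[R]_1) : R := \int[mu]_p (F p * gk e (x0 p.2 - u 0 0)).

Let v_itg (e c : R) : 0 < e -> itg mu (fun p => F p * gk e (x0 p.2 - c)).
Proof.
move=> e0; apply: (itg_le _ (itgZ (Num.sqrt (2 * pi * e))^-1 (itg_abs iF))) => [|p].
  apply: measurable_funM; first exact: itg_measurable iF.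
  by apply: measurableT_comp (mx c); exact: measurable_gk.
by rewrite normrM mulrC ler_wpM2r// ger0_norm ?gk_ge0// gk_peak.
Qed.

Let v_bound (e h : R) u : 0 < e -> 0 < h -> `|v e u| <= J t0 / Num.sqrt h + M * Num.sqrt h.
Proof.
move=> e0 h0; have K (r : R) : 0 < r -> `|\int[mu]_p (F p * gk2 r (x0 p.2 - u 0 0))| <= M / Num.sqrt r.
  by move=> r0; exact: flux_gk2.
have := heat_interpolation iF (mx (u 0 0)) K e0 h0.
by rewrite JF [_^-1 * _]mulrC.
Qed.

Let bcontinuous_v (e : R) : 0 < e -> bcontinuous (v e).
Proof.
move=> e0; split; last first.
  by exists (J t0 / Num.sqrt 1 + M * Num.sqrt 1) => u; exact: v_bound.
have [C C0 HC] := gk_lipschitz e0.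
have lip u u' : `|v e u - v e u'| <= C * J t0 * `|u 0 0 - u' 0 0|.
  rewrite /v -RintegralB//; [|exact: v_itg|exact: v_itg].
  have iB := itgB (v_itg (u 0 0) e0) (v_itg (u' 0 0) e0).
  apply: le_trans (le_normr_Rintegral measurableT iB) _.
  rewrite -JF mulrAC -(RintegralZl _ measurableT (itg_abs iF)).
  apply: le_Rint; [exact: itg_abs iB|exact: itgZ _ (itg_abs iF)|move=> p].
  rewrite -mulrBr normrM mulrC ler_wpM2r//.
  apply: le_trans (HC _ _) _; rewrite ler_wpM2l// distrC.
  by rewrite [X in `|X|](_ : _ = u 0 0 - u' 0 0)//; ring.
have J0 : 0 <= J t0 by apply: Rintegral_ge0 => p _; rewrite mulr_ge0 ?le0i_ge0.
move=> u; apply/(@cvgrPdist_le _ _ _ (nbhs u)) => eps eps0.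
have CJ : 0 < C * J t0 + 1 by rewrite ltr_wpDl// mulr_ge0.
have /(@cvgrPdist_le _ _ _ (nbhs u)) H : (fun u : 'rV[R]_1 => u 0 0) @ u --> u 0 0.
  exact: coord_continuous.
have := H (eps / (C * J t0 + 1)) (divr_gt0 eps0 CJ); apply: filterS => u' h.
apply: le_trans (lip u u') _; apply: (@le_trans _ _ ((C * J t0 + 1) * `|u 0 0 - u' 0 0|)).
  by rewrite ler_wpM2r// lerDl.
by rewrite mulrC -ler_pdivlMr.
Qed.

(** The weak equation rewrites one of the two convolutions as [gap] on the kernel; the density at
    [t0] makes it an honest integral, and Fubini moves the kernel onto the other factor. *)
Let quadform_gap (e : R) : 0 < e -> quadform flux e t0 = gap t0 (v e).
Proof.
move=> e0; rewrite Hg; last exact: bcontinuous_v.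
pose k (q : X * E) : R := F q.1 * (hk e q.1.2 q.2 * w0 (t0, q.2)).
have mw1 := itg_measurable w1.
have ki : itg (prodm mu (leb 1)) k.
  have [ti _] := itg_tensor (itg_abs iF) (itg_abs w1).
  apply: (itg_le _ (itgZ (Num.sqrt (2 * pi * e))^-1 ti)) => [|q].
    apply: measurable_funM.
      by apply: measurableT_comp => //; exact: itg_measurable iF.
    apply: measurable_funM; last by have := measurableT_comp mw1 (@measurable_snd _ _ X E).
    by apply: measurable_hk => //; exact: measurableT_comp.
  rewrite /k normrM (normrM (hk _ _ _)) mulrCA ler_wpM2r ?mulr_ge0//.
  by rewrite ger0_norm ?hk_ge0// hk1dE gk_peak.
have [_ e1] := Rfubini1 ki; have [_ e2] := Rfubini2 ki.
transitivity (\int[(prodm mu (leb 1))]_q k q); last first.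
  rewrite e2; apply: eq_Rintegral => y _; rewrite /k /= /v.
  rewrite -RintegralZr//; last exact: v_itg.
  by apply: eq_Rintegral => p _; rewrite hk1dE /rv mxE mulrA.
rewrite e1; have qi : itg (prodm mu mu) (fun pq => pairing flux e pq *
    (le0i (pq.1.1 - t0) * le0i (pq.2.1 - t0))).
  apply: (pairing_itg (measurable_flux ma mw) flux_hk_flux e0) => [|pq].
    by apply: measurable_funM; apply: measurable_le0i; apply: measurable_funB => //; exact: measurableT_comp.
  by rewrite normrM mulr_ile1// ger0_norm ?le0i_ge0// le0i_le1.
rewrite /quadform; have [_ ->] := Rfubini1 qi; apply: eq_Rintegral => p _.
transitivity (F p * gap t0 (hkrow e p.2)).
  rewrite gap_hkrow// -RintegralZl//.
    by apply: eq_Rintegral => q _; rewrite /pairing /F /= [lap_hk e q.2 _]lap_hkC; ring.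
  have mk : measurable_fun [set: X] (fun q => le0i (q.1 - t0)).
    by apply: measurable_le0i; exact: measurable_funB.
  have mk1 (q : X) : `|le0i (q.1 - t0)| <= 1 by rewrite ger0_norm ?le0i_ge0// le0i_le1.
  have := potential_itg (measurable_flux ma mw) flux_hk p.2 e0 mk mk1.
  by apply: eq_integrable => // q _ /=; rewrite lap_hkC /F mulrAC.
rewrite Hg; last exact: schwartz_bcontinuous (schwartz_hkrow p.2 e0).
rewrite -RintegralZl//.
  by apply: eq_Rintegral => y _; rewrite /k /= hkrow_rv hkC.
apply: (itg_le _ (itgZ (Num.sqrt (2 * pi * e))^-1 (itg_abs w1))) => [|y].
  apply: measurable_funM => //; apply: (measurable_rv (phi := hkrow e p.2)).
  by have [] := schwartz_bcontinuous (schwartz_hkrow p.2 e0).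
by rewrite normrM ler_wpM2r// hkrow_le.
Qed.

Lemma quadform_bound (e h : R) : 0 < e -> 0 < h ->
  `|quadform flux e t0| <= M * (J t0 / Num.sqrt h + M * Num.sqrt h).
Proof.
move=> e0 h0; rewrite quadform_gap//; apply: (HM t0T).
- exact: bcontinuous_v.
- rewrite ltr_wpDl//; last by rewrite mulr_gt0// sqrtr_gt0.
  by rewrite divr_ge0// /J; apply: Rintegral_ge0 => p _; rewrite mulr_ge0 ?le0i_ge0.
- by move=> u; exact: v_bound.
Qed.

End estimate.

Lemma quadform_small (t1 eps : R) : 0 < t1 -> 0 < eps -> exists t0, [/\ 0 < t0, t0 < T, t0 < t1 &
  forall e : R, 0 < e -> - quadform flux e t0 <= eps].
Proof.
move=> t10 eps0; have [M M0 HM] := gap_bound T0 wc1 wc2.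
(* [h] makes the term M ^ 2 sqrt h equal to eps / 2, independently of time; the time is then taken
   small enough for M J / sqrt h to be at most eps / 2. *)
pose h := (eps / (2 * M ^+ 2)) ^+ 2.
have q0 : 0 < eps / (2 * M ^+ 2) by rewrite divr_gt0// mulr_gt0// exprn_gt0.
have h0 : 0 < h by rewrite exprn_gt0.
have sh : Num.sqrt h = eps / (2 * M ^+ 2) by rewrite sqrtr_sqr gtr0_norm.
have sh0 : 0 < Num.sqrt h by rewrite sh.
have [t t_gt0 Jt] := J_small (divr_gt0 (mulr_gt0 eps0 sh0) (mulr_gt0 (ltr0n R 2) M0)).
have uv : 0 < Num.min (Num.min T t1) t by rewrite !lt_min T0 t10 t_gt0.
have [s /andP[s0 s1] H] := ae_lebR_dense uv (ae_gap_density mw dw).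
rewrite !lt_min in s1; case/andP: s1 => /andP[sT st1] st.
have s0T : 0 <= s <= T by rewrite !ltW.
have [w1 Hg] := H s0T.
exists s; split => // e e0; apply: le_trans (ler_norm _) _; rewrite normrN.
apply: le_trans (quadform_bound M0 HM s0T w1 Hg e0 h0) _.
have Js : J s <= eps * Num.sqrt h / (2 * M) by apply: le_trans (J_le (ltW st)) Jt.
rewrite mulrDr (splitr eps) lerD//.
  rewrite mulrA ler_pdivrMr// mulrC -ler_pdivlMr//.
  by rewrite (le_trans Js)// le_eqVlt; apply/orP; left; apply/eqP; field; rewrite gt_eqF.
by rewrite sh le_eqVlt; apply/orP; left; apply/eqP; field; rewrite gt_eqF.
Qed.

End one_dimensional.

(** * Integrability over time slabs *)

Section slab.
Context {R : realType} {d : nat}.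
Local Notation E := (d.-tuple R).
Local Notation X := (R * E)%type.
Local Notation mu := (prodm (@lebR R) (@leb R d)).
Implicit Types (T t : R) (g : R -> E -> R).

Lemma integral_leb_tx (D : set X) (f : X -> \bar R) :
  (\int[leb_tx d]_(p in D) f p = \int[mu]_(p in D) f p)%E.
Proof.
have -> : leb_tx d = (@lebR R \x^ leb d)%E :> (set X -> \bar R) by rewrite /leb_tx lebE.
by apply: eq_measure_integral => A mA _; exact: product_measure12.
Qed.

Lemma itg_slab (D : set X) (g h : X -> R) : measurable D -> measurable_fun D g ->
  (forall p, 0 <= g p) -> (\int[leb_tx d]_(p in D) (g p)%:E < +oo)%E ->
  measurable_fun setT h -> (forall p, `|h p| <= (g \_ D) p) -> itg mu h.
Proof.
move=> mD mg g0 goo mh hg; apply: (itg_le mh _ hg).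
apply/integrableP; split.
  by apply/measurable_EFinP/(measurable_restrictT _ _).1.
apply: le_lt_trans goo; rewrite integral_leb_tx [leRHS]integral_mkcond.
rewrite le_eqVlt; apply/orP; left; apply/eqP; apply: eq_integral => p _ /=.
rewrite !patchE; case: ifP => _; last by rewrite normr0.
by rewrite ger0_norm.
Qed.

Lemma norm_window_le1 T t (s : R) : `|window T t s| <= 1.
Proof.
rewrite /window !le0iE; case: (s - T <= 0); case: (s - t <= 0).
- by rewrite subrr normr0.
- by rewrite subr0 normr1.
- by rewrite sub0r normrN normr1.
- by rewrite subrr normr0.
Qed.

Lemma sqi_window_le T t (f : X -> R) : sqi mu f -> sqi mu (fun p => f p * window T t p.1).
Proof.
move=> f2; apply: (sqi_le _ f2) => [|p]; last by rewrite normrM ler_piMr// norm_window_le1.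
apply: measurable_funM; first exact: f2.1.
by apply: measurable_funB; apply: measurable_le0i; exact: measurable_funB.
Qed.

Lemma sqi_extend0 T g : measurable_fun (`[0%R, T] `*` setT) (fun p : X => g p.1 p.2) ->
  (\int[leb_tx d]_(p in `[0%R, T] `*` setT) ((g p.1 p.2) ^+ 2)%:E < +oo)%E ->
  sqi mu (extend0 T g).
Proof.
move=> mg goo; have me := measurable_extend0 mg; split => //.
apply: (itg_slab _ _ _ goo) => //.
- exact: measurableX.
- exact: measurable_funX.
- by move=> p; exact: sqr_ge0.
- exact: measurable_funX.
- move=> p; rewrite extend0E !patchE; case: ifP => _.
    by rewrite ger0_norm ?sqr_ge0.
  by rewrite expr0n normr0.
Qed.

Lemma sqi_extend0_window T t g : 0 < t ->
  measurable_fun (`[0%R, T] `*` setT) (fun p : X => g p.1 p.2) ->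
  (\int[leb_tx d]_(p in `[t, T]%classic `*` setT) ((g p.1 p.2) ^+ 2)%:E < +oo)%E ->
  sqi mu (fun p => extend0 T g p * window T t p.1).
Proof.
move=> t0 mg goo; have me := measurable_extend0 mg.
have mew : measurable_fun setT (fun p : X => extend0 T g p * window T t p.1).
  apply: measurable_funM => //.
  by apply: measurable_funB; apply: measurable_le0i; exact: measurable_funB.
split => //; apply: (itg_slab _ _ _ goo) => //.
- exact: measurableX.
- apply: measurable_funX; apply: measurable_funS mg; first exact: measurableX.
  move=> p [/=]; rewrite !in_itv /= => /andP[h1 h2] _; split => //.
  by rewrite (le_trans (ltW t0)).
- by move=> p; exact: sqr_ge0.
- exact: measurable_funX.
- move=> p; rewrite patchE ger0_norm ?sqr_ge0// exprMn.
  have [pT|pT] := boolP (0 <= p.1 <= T); last first.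
    rewrite /extend0 (negbTE pT) expr0n mul0r.
    by case: ifP => // _; exact: sqr_ge0.
  rewrite /extend0 pT windowE ?(ltW t0)//.
  have [tp|tp] := ltP t p.1; last first.
    by rewrite expr0n mulr0; case: ifP => // _; exact: sqr_ge0.
  rewrite expr1n mulr1 mem_set//; split => //=; rewrite in_itv /= (ltW tp).
  by case/andP: pT.
Qed.

Lemma itg_extend0 T g : measurable_fun (`[0%R, T] `*` setT) (fun p : X => g p.1 p.2) ->
  (\int[leb_tx d]_(p in `[0%R, T] `*` setT) (`|g p.1 p.2|)%:E < +oo)%E ->
  itg mu (extend0 T g).
Proof.
move=> mg goo; apply: (itg_slab _ _ _ goo) => //.
- exact: measurableX.
- exact: measurableT_comp.
- exact: measurable_extend0.
- move=> p; rewrite extend0E !patchE; case: ifP => // _.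
  by rewrite normr0.
Qed.

End slab.

(** * Square integrable flux up to time zero *)

Section square_integrable.
Context {R : realType} {d : nat}.
Local Notation E := (d.-tuple R).
Local Notation X := (R * E)%type.
Local Notation mu := (prodm (@lebR R) (@leb R d)).
Variables (T : R) (f : X -> R).
Hypothesis T0 : 0 < T.
Hypothesis f2 : sqi mu f.
Hypothesis fout : forall p, ~~ (0 <= p.1 <= T) -> f p = 0.

Let one (s : R) : R := \1_(`[0, T]%classic) s.

Let oneE s : one s = (0 <= s <= T)%R%:R.
Proof. by rewrite /one indicE; congr (nat_of_bool _)%:R; rewrite mem_setE in_itv. Qed.

Let one_itg : itg (@lebR R) one /\ \int[lebR]_s one s = T.
Proof.
have moo : lebesgue_measure (`[0, T]%classic : set R) = T%:E.
  by rewrite lebesgue_measure_itv /= lte_fin T0 sube0.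
split.
  by apply/integrable_lebR => //; exact: integrable_indic_itv.
by apply: (etrans _ (congr1 fine moo)); rewrite /Rintegral integral_indic// setIT.
Qed.

Let f_one p : f p * one p.1 = f p.
Proof.
rewrite oneE; have [h|/fout ->] := boolP (0 <= p.1 <= T); last by rewrite mul0r.
by rewrite mulr1.
Qed.

Let mone : measurable_fun setT one. Proof. exact: measurable_indic. Qed.

Lemma sqi_hk_itg e x : 0 < e -> itg mu (fun q => f q * hk e x q.2).
Proof.
move=> e0; have [mk ki] := sqi_hk x e0.
have s2 : sqi mu (fun q => one q.1 * hk e x q.2).
  split.
    by apply: measurable_funM; [exact: measurableT_comp|exact: measurable_hk].
  have [h _] := itg_tensor one_itg.1 ki.
  apply: eq_integrable h => // q _ /=; congr EFin; rewrite exprMn; congr (_ * _).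
  by rewrite oneE; case: (_ <= _ <= _); rewrite ?expr1n ?expr0n.
by apply: eq_integrable (sqiM f2 s2) => // q _ /=; rewrite mulrA f_one.
Qed.

(** Schur's test on space-time: the kernel has mass one in space but is constant in time, so cutting
    both times to [[0, T]] gives rows and columns of mass at most [T]. *)
Lemma sqi_hk_sqi e : 0 < e ->
  itg (prodm mu mu) (fun pq => `|f pq.1| * hk e pq.1.2 pq.2.2 * `|f pq.2|).
Proof.
move=> e0; pose k (pq : X * X) := one pq.1.1 * one pq.2.1 * hk e pq.1.2 pq.2.2.
have one01 s : 0 <= one s <= 1 by rewrite oneE ler0n lern1 leq_b1.
have mk : measurable_fun setT k.
  have m1 : measurable_fun [set: X * X] (fun pq => pq.1.1) by exact: measurableT_comp.
  have m2 : measurable_fun [set: X * X] (fun pq => pq.2.1) by exact: measurableT_comp.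
  apply: measurable_funM; last by apply: measurable_hk; exact: measurableT_comp.
  by have := measurable_funM (measurableT_comp mone m1) (measurableT_comp mone m2).
have k0 pq : 0 <= k pq.
  have /andP[h1 _] := one01 pq.1.1; have /andP[h2 _] := one01 pq.2.1.
  by rewrite /k !mulr_ge0 ?hk_ge0.
have kx (p : X) : itg mu (fun q : X => one p.1 * (one q.1 * hk e p.2 q.2)) /\
    \int[mu]_q (one p.1 * (one q.1 * hk e p.2 q.2)) <= T.
  have [h1 h2] := hk_integral p.2 e0; have [i1 i2] := itg_tensor one_itg.1 h1.
  split; first exact: itgZ.
  rewrite (RintegralZl _ measurableT i1) i2 h2 one_itg.2 mulr1 ler_piMl ?(ltW T0)//.
  by case/andP: (one01 p.1).
have k1 p : itg mu (fun q => k (p, q)) /\ \int[mu]_q k (p, q) <= T.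
  by under eq_fun do rewrite /k /= -mulrA; exact: kx.
have k2 q : itg mu (fun p => k (p, q)) /\ \int[mu]_p k (p, q) <= T.
  have E1 : (fun p => k (p, q)) = fun p => one q.1 * (one p.1 * hk e q.2 p.2).
    by apply/funext => p; rewrite /k /= hkC; ring.
  by rewrite E1; exact: kx.
have nf2 : sqi mu (fun p => `|f p|).
  by apply: (sqi_le _ f2) => [|p]; [exact: measurableT_comp f2.1|rewrite normr_id].
apply: eq_integrable (schur_itg mk k0 k1 k2 nf2 nf2) => // pq _ /=; congr EFin.
rewrite /k -{2}(f_one pq.1) -{2}(f_one pq.2) !normrM.
rewrite ![`|one _|]ger0_norm; [ring|by case/andP: (one01 pq.2.1)|by case/andP: (one01 pq.1.1)].
Qed.

(** The cut-off keeps times s <= 0 and [f] lives on s >= 0, so only the null slice s = 0 is left. *)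
Lemma quadform0 e : 0 < e -> quadform f e 0 = 0.
Proof.
move=> e0; have [i ->] := energy_identity f2.1 sqi_hk_itg sqi_hk_sqi 0 e0.
rewrite (_ : \int[mu]_p _ = 0) ?mulr0//.
apply: (@etrans _ _ (\int[mu]_p (0 : R))); last by rewrite Rintegral_cst// mul0r.
apply: ae_eq_Rint => //; first exact: itg_measurable i.
have := @ae_fst_neq R d 0; apply: filterS => p p0.
have [/andP[h _]|/fout ->] := boolP (0 <= p.1 <= T); last by rewrite !mul0r.
by rewrite le0iE subr0 leNgt lt_neqAle eq_sym p0 h /= mulr0 mul0r.
Qed.

End square_integrable.

Theorem theorem3p1 (R : realType) (d : nat) (T : R)
  (a : R -> d.-tuple R -> R)
  (z0 : {charge set (d.-tuple R) -> \bar R})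
  (z1 z2 : R -> {charge set (d.-tuple R) -> \bar R})
  (w : R -> d.-tuple R -> R) :
  (0 < d)%N -> 0 < T ->
  measurable_fun (`[0%R, T] `*` setT) (fun p : R * d.-tuple R => a p.1 p.2) ->
  (forall t x, t \in `[0, T] -> 0 <= a t x) ->
  weakly_continuous T z1 -> weakly_continuous T z2 ->
  weak_solution T a z0 z1 -> weak_solution T a z0 z2 ->
  (* Hypothesis (B): w is a density of z := z1 - z2 *)
  L1loc T w ->
  {ae (@lebesgue_measure R), forall t, t \in `[0, T] ->
     forall A : set (d.-tuple R), measurable A ->
       (z1 t A - z2 t A = \int[leb_tuple d]_(x in A) (w t x)%:E)%E} ->
  ( (* (B1) *)
    ((\int[leb_tx d]_(p in `[0%R, T] `*` setT) ((w p.1 p.2) ^+ 2)%:E < +oo)%E /\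
     (\int[leb_tx d]_(p in `[0%R, T] `*` setT)
        ((a p.1 p.2 * w p.1 p.2) ^+ 2)%:E < +oo)%E)
  \/
    (* (B2) *)
    (d = 1%N /\
     forall t0 : R, 0 < t0 ->
      [/\ (\int[leb_tx d]_(p in `[t0, T]%classic `*` setT) ((w p.1 p.2) ^+ 2)%:E < +oo)%E,
          (\int[leb_tx d]_(p in `[0%R, T] `*` setT)
             (`|a p.1 p.2 * w p.1 p.2|)%:E < +oo)%E &
          (\int[leb_tx d]_(p in `[t0, T]%classic `*` setT)
             ((a p.1 p.2 * w p.1 p.2) ^+ 2)%:E < +oo)%E])) ->
  forall t, t \in `[0, T] ->
    forall A : set (d.-tuple R), measurable A -> z1 t A = z2 t A.
Proof.
move=> d0 T0 ma a0 wc1 wc2 ws1 ws2 [mw _] dw HB.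
have mf : measurable_fun (`[0%R, T] `*` setT) (fun p : R * d.-tuple R => a p.1 p.2 * w p.1 p.2).
  exact: measurable_funM.
case: HB => [[w2 f2]|[d1 HB]].
- have {}w2 := sqi_extend0 (g := w) mw w2.
  have {}f2 := sqi_extend0 (g := fun t x => a t x * w t x) mf f2.
  have fout p : ~~ (0 <= p.1 <= T) -> flux T a w p = 0 by exact: flux_out.
  have ww t : 0 < t -> sqi (prodm (@lebR R) (leb d)) (fun p => w0 T w p * window T t p.1).
    by move=> _; exact: sqi_window_le.
  apply: (flux0_unique T0 ma mw wc1 wc2 ws1 ws2 dw ww).
  apply: (flux_eq0 ma a0 mw ws1 ws2 dw ww (sqi_hk_itg T0 f2 fout) (sqi_hk_sqi T0 f2 fout)).
    by move=> t _; exact: sqi_window_le.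
  move=> t1 eps t10 eps0; exists 0; split => //; [by rewrite lexx ltW|exact: sqi_window_le|
    exact: sqi_window_le|].
  by move=> n; rewrite (quadform0 T0 f2 fout)// ?oppr0 ?ltW// harmonic_gt0.
subst d.
have ww t : 0 < t -> sqi (prodm (@lebR R) (leb 1)) (fun p => w0 T w p * window T t p.1).
  by move=> t0; have [w2 _ _] := HB t t0; exact: (sqi_extend0_window (g := w) t0 mw w2).
have ff t : 0 < t -> sqi (prodm (@lebR R) (leb 1)) (fun p => flux T a w p * window T t p.1).
  move=> t0; have [_ _ f2] := HB t t0.
  exact: (sqi_extend0_window (g := fun t x => a t x * w t x) t0 mf f2).
(* The L^1 bound covers all of [[0, T]] whatever the positive time, so 1 is an arbitrary choice. *)
have fi : itg (prodm (@lebR R) (leb 1)) (flux T a w).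
  by have [_ f1 _] := HB 1 ltr01; exact: (itg_extend0 (g := fun t x => a t x * w t x) mf f1).
apply: (flux0_unique T0 ma mw wc1 wc2 ws1 ws2 dw ww).
apply: (flux_eq0 ma a0 mw ws1 ws2 dw ww (flux_hk fi) (flux_hk_flux ma mw fi) ff).
move=> t1 eps t10 eps0.
have [t0 [t00 t0T t01 q]] := quadform_small T0 ma mw wc1 wc2 ws1 ws2 dw fi t10 eps0.
exists t0; split => //; [by rewrite !ltW|exact: ff|exact: ww|].
by move=> n; apply: q; exact: harmonic_gt0.
Qed.
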